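(* Let $b_1,b_2,\gamma$ be half-integers (elements of $\frac12\mathbb{Z}$) such that $b_1\ge0$, $\gamma\ge1$, $\frac{1-\gamma}2\le b_2\le\frac12+b_1$. Then the integral transform $$S_{b_1,b_2,\gamma}:f(x)\mapsto\frac1\gamma\int_0^\infty G^{20}_{04}\bigl((xy)^{\frac1\gamma}\bigm|b_1,b_2,1-\gamma-b_1,1-\gamma-b_2\bigr)f(y)\,dy$$ is a unitary operator on $L^2(\mathbb{R}_+)$.
   Context: $L^2(\mathbb{R}_+)$ is with respect to Lebesgue measure. $G^{20}_{04}$ is Meijer's $G$-function: for $x>0$, $G^{20}_{04}(x\mid b_1,b_2,b_3,b_4)=\frac1{2\pi i}\int_L\frac{\Gamma(b_1-\lambda)\Gamma(b_2-\lambda)}{\Gamma(1-b_3+\lambda)\Gamma(1-b_4+\lambda)}x^\lambda d\lambda$, where $L$ goes from $\gamma'-i\infty$ to $\gamma'+i\infty$ leaving all the points $b_1+\mathbb{N}$, $b_2+\mathbb{N}$ to the right, and $\gamma'>\frac14(\operatorname{Re}(b_1+b_2+b_3+b_4)-1)$. The integral transform is defined on a dense subspace such as $C_0^\infty(\mathbb{R}_+)$ and extended by continuity to $L^2(\mathbb{R}_+)$. *)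

(* Defs.v *)
(* MathComp-Analysis; R is an arbitrary realType and R[i] its complex numbers. *)
From HB Require Import structures.
From mathcomp Require Import all_boot all_order all_algebra.
From mathcomp Require Import all_classical all_reals all_analysis.
From mathcomp Require Export complex.

Set Implicit Arguments.
Unset Strict Implicit.
Unset Printing Implicit Defensive.

Import Order.TTheory GRing.Theory Num.Theory.
Import numFieldNormedType.Exports.

Local Open Scope classical_set_scope.
Local Open Scope ring_scope.
Local Open Scope complex_scope.

Section MeijerG.
Variable R : realType.
Implicit Types (x : R) (z l : R[i]) (phi : R -> R).

Definition cexp z : R[i] :=
  (expR (complex.Re z) * cos (complex.Im z)) +i*
  (expR (complex.Re z) * sin (complex.Im z)).

Definition cpow x l : R[i] := cexp ((ln x)%:C * l).

Definition climit (u : nat -> R[i]) : R[i] :=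
  lim (complex.Re (u n) @[n --> \oo]) +i* lim (complex.Im (u n) @[n --> \oo]).

Definition cintegral (D : set R) (F : R -> R[i]) : R[i] :=
  (\int[lebesgue_measure]_(t in D) complex.Re (F t)) +i*
  (\int[lebesgue_measure]_(t in D) complex.Im (F t)).

(* Gauss's product, Gamma(z) = lim n! n^z / (z (z + 1) ... (z + n)), valid at
   every z that is not a pole. At a pole 0, -1, -2, ... the quotient is
   eventually a division by 0, so the value is 0, and (cGamma z)^-1 = 0 is then
   the correct value of the entire function 1/Gamma. *)
Definition cGamma z : R[i] :=
  climit (fun n => n`!%:R * cpow n%:R z / \prod_(0 <= k < n.+1) (z + k%:R)).

Definition meijer_integrand (b1 b2 b3 b4 : R[i]) x l : R[i] :=
  cGamma (b1 - l) * cGamma (b2 - l) / (cGamma (1 - b3 + l) * cGamma (1 - b4 + l))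
  * cpow x l.

(* The contour L is the graph t |-> phi t + i t of a C^1 function phi of the
   imaginary part, oriented upwards and equal to the vertical line
   Re l = g' outside a compact set; a point w lies to the right of L iff
   phi (Im w) < Re w. *)
Definition meijer_contour (b1 b2 b3 b4 : R[i]) phi : Prop :=
  [/\ (forall t, derivable phi t 1) /\ continuous (derive1 phi),
      exists g' T : R, (complex.Re (b1 + b2 + b3 + b4) - 1) / 4 < g' /\
        forall t, T <= `|t| -> phi t = g',
      forall n : nat, phi (complex.Im (b1 + n%:R)) < complex.Re (b1 + n%:R) &
      forall n : nat, phi (complex.Im (b2 + n%:R)) < complex.Re (b2 + n%:R)].

(* G^{20}_{04}(x | b1, b2, b3, b4), computed along the contour given by phi;
   dl = (phi' t + i) dt. *)
Definition meijerG2004 phi (b1 b2 b3 b4 : R[i]) x : R[i] :=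
  (0 +i* (2 * pi))^-1 *
  cintegral setT (fun t =>
    meijer_integrand b1 b2 b3 b4 x (phi t +i* t) * (derive1 phi t +i* 1)).

End MeijerG.

Section L2.
Variable R : realType.
Implicit Types (f g : R -> R[i]) (S T : (R -> R[i]) -> (R -> R[i])).

Definition Rplus : set R := [set x | 0 < x].

Definition L2normsq f : \bar R :=
  (\int[lebesgue_measure]_(x in Rplus)
    (complex.Re (f x) ^+ 2 + complex.Im (f x) ^+ 2)%:E)%E.

(* L^2(R_+) is handled through representatives, which are functions on the whole
   line whose values outside R_+ are irrelevant; equality is aeeq below. *)
Definition L2 f : Prop :=
  [/\ measurable_fun Rplus (fun x => complex.Re (f x)),
      measurable_fun Rplus (fun x => complex.Im (f x)) &
      (L2normsq f < +oo)%E].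

Definition aeeq f g : Prop := f = g %[ae lebesgue_measure in Rplus].

Definition L2dot f g : R[i] := cintegral Rplus (fun x => f x * (g x)^*).

Definition smooth (h : R -> R) : Prop :=
  forall n t, derivable (derive1n n h) t 1.

Definition test_function f : Prop :=
  [/\ smooth (fun x => complex.Re (f x)), smooth (fun x => complex.Im (f x)) &
      exists2 a : R, 0 < a & exists c : R, forall x, x \notin `[a, c] -> f x = 0].

Definition L2_operator S : Prop :=
  (forall f, L2 f -> L2 (S f)) /\
  (forall f g, L2 f -> L2 g -> aeeq f g -> aeeq (S f) (S g)).

Definition L2_continuous S : Prop :=
  forall (f_ : nat -> R -> R[i]) f, (forall n, L2 (f_ n)) -> L2 f ->
    L2normsq (f_ n \- f) @[n --> \oo] --> 0%E ->
    L2normsq (S (f_ n) \- S f) @[n --> \oo] --> 0%E.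

Definition L2_extension T S : Prop :=
  [/\ L2_operator S, L2_continuous S &
      forall f, test_function f -> aeeq (S f) (T f)].

Definition L2_unitary S : Prop :=
  [/\ L2_operator S,
      forall (a : R[i]) f g, L2 f -> L2 g ->
        aeeq (S (fun x => a * f x + g x)) (fun x => a * S f x + S g x),
      forall f g, L2 f -> L2 g -> L2dot (S f) (S g) = L2dot f g &
      forall g, L2 g -> exists2 f, L2 f & aeeq (S f) g].

End L2.

Definition half_integer (R : realType) (x : R) : Prop := 2 * x \is a Num.int.

Definition S_transform (R : realType) (phi : R -> R) (b1 b2 gamma : R)
    (f : R -> R[i]) (x : R) : R[i] :=
  (gamma^-1)%:C * cintegral (@Rplus R) (fun y =>
    meijerG2004 phi b1%:C b2%:C (1 - gamma - b1)%:C (1 - gamma - b2)%:C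
      ((x * y) `^ gamma^-1) * f y).

(* Main.v *)
(** Shift the variable of the Mellin-Barnes integral to [s = l + gamma / 2] and
    put [c_j = b_j + gamma / 2 > 0]. The quotient of Gamma functions becomes
    [m(s) = prod_j Gamma(c_j - s) / Gamma(c_j + s)], which has modulus [1] on the
    line [Re s = 0]. Moving the contour to that line shows that on test functions
    the transform is: take the Mellin transform on [Re = 1/2], multiply it by the
    unimodular function [m(i t)], transform back at [x] rather than [1 / x].
    By Plancherel it is isometric, and it is symmetric for the bilinear pairing
    [int f g] because its kernel depends on [x y] only. Hence it extends to an
    isometry [S] of [L^2(R_+)] with [<S f, conj g> = <f, conj (S g)>], and then
    [f = conj (S (conj g))] satisfies [S f = g].

    On the line [Re s = 0] the Mellin-Barnes integral does not converge absolutely.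
    Therefore [Gamma] is replaced by the n-th Gauss product and [exp (s^2 / n)] is
    inserted: the integrand becomes elementary and rapidly decreasing, the contour
    is moved by a homotopy, and [n] tends to infinity on both sides. *)
Require Import Defs.
From HB Require Import structures.
From mathcomp Require Import all_boot all_order all_algebra.
From mathcomp Require Import all_classical all_reals all_analysis.
From mathcomp Require Import measurable_realfun ring lra.
Set Implicit Arguments.
Unset Strict Implicit.
Unset Printing Implicit Defensive.
Import Order.TTheory GRing.Theory Num.Theory.
Import numFieldNormedType.Exports.
Local Open Scope classical_set_scope.
Local Open Scope ring_scope.
Local Open Scope complex_scope.

(** * Complex numbers over a real type *)

(** The parameters are paired: [1 - b_3 + l = gamma + b_1 + l] is [c_1 + s], and likewise for [b_2].
    As [b_1 + b_2 + b_3 + b_4 = 2 - 2 gamma], the condition on the contour says that its vertical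
    ends lie at [Re s = sg > 1/4]. There the quotient decays like [|t|^(-4 sg)], just enough for
    absolute convergence. The quotient of n-th Gauss products follows this decay only for
    [|t| <= n]; beyond, [exp (s^2 / n)] is at most a constant times [exp (- |t|)]. Hence the two
    regularisations, run with the same [n], have one integrable majorant along the contour. On the
    line [Re s = 0] the quotient has modulus [1], so there the limit is taken only after integrating
    against the test function, whose Mellin transform supplies the missing decay. At each finite [n]
    both sides are the same number, and the two limits must agree. *)

Section ComplexBasics.
Variable R : realType.
Implicit Types (z w : R[i]).
Local Notation Re := (@complex.Re R).
Local Notation Im := (@complex.Im R).

(** The modulus with values in [R], whereas the norm of [R[i]] has complex values; all estimates are
    inequalities between real numbers. *)
Definition cabs z : R := Num.sqrt (Re z ^+ 2 + Im z ^+ 2).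

(** A named conjugate that simplification leaves folded, so that the rules collected in [cE] can
    recognise it. *)
Definition cconj z : R[i] := z^*.
#[global] Arguments cconj : simpl never.

Lemma ReM z w : Re (z * w) = Re z * Re w - Im z * Im w.
Proof. by case: z; case: w. Qed.
Lemma ImM z w : Im (z * w) = Re z * Im w + Im z * Re w.
Proof. by case: z; case: w. Qed.
Lemma ReD z w : Re (z + w) = Re z + Re w.
Proof. by case: z; case: w. Qed.
Lemma ImD z w : Im (z + w) = Im z + Im w.
Proof. by case: z; case: w. Qed.
Lemma ReN z : Re (- z) = - Re z.
Proof. by case: z. Qed.
Lemma ImN z : Im (- z) = - Im z.
Proof. by case: z. Qed.
Lemma ReB z w : Re (z - w) = Re z - Re w.
Proof. by rewrite ReD ReN. Qed.
Lemma ImB z w : Im (z - w) = Im z - Im w.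
Proof. by rewrite ImD ImN. Qed.
Lemma ReC (x : R) : Re x%:C = x. Proof. by []. Qed.
Lemma ImC (x : R) : Im x%:C = 0. Proof. by []. Qed.
Lemma ReJ z : Re (cconj z) = Re z. Proof. by case: z. Qed.
Lemma ImJ z : Im (cconj z) = - Im z. Proof. by case: z. Qed.
Lemma Re0 : Re 0 = 0. Proof. by []. Qed.
Lemma Im0 : Im 0 = 0. Proof. by []. Qed.
Lemma Re1 : Re 1 = 1. Proof. by []. Qed.
Lemma Im1 : Im 1 = 0. Proof. by []. Qed.
Lemma complex_nat n : n%:R = (n%:R)%:C :> R[i].
Proof. by rewrite rmorph_nat. Qed.
Lemma Re_nat n : Re n%:R = n%:R. Proof. by rewrite complex_nat. Qed.
Lemma Im_nat n : Im n%:R = 0. Proof. by rewrite complex_nat. Qed.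
Lemma cV z : z^-1 = (Re z / (Re z ^+ 2 + Im z ^+ 2)) +i* (- (Im z / (Re z ^+ 2 + Im z ^+ 2))).
Proof. by case: z. Qed.
Lemma ReV z : Re z^-1 = Re z / (Re z ^+ 2 + Im z ^+ 2).
Proof. by case: z. Qed.
Lemma ImV z : Im z^-1 = - (Im z / (Re z ^+ 2 + Im z ^+ 2)).
Proof. by case: z. Qed.
Lemma ceqP z w : Re z = Re w -> Im z = Im w -> z = w.
Proof. by case: z; case: w => a b c d /= -> ->. Qed.
Definition cE := (ReM, ImM, ReD, ImD, ReN, ImN, ReJ, ImJ, Re0, Im0, Re1, Im1, Re_nat, Im_nat).

Lemma CM (x y : R) : (x * y)%:C = x%:C * y%:C :> R[i].
Proof. by apply: ceqP; rewrite !cE /= ?mulr0 ?mul0r ?subr0 ?addr0. Qed.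
Lemma cJM z w : (cconj (z * w)) = (cconj z) * (cconj w).
Proof. by apply: ceqP; rewrite !cE; ring. Qed.
Lemma cJD z w : (cconj (z + w)) = (cconj z) + (cconj w).
Proof. by apply: ceqP; rewrite !cE; ring. Qed.
Lemma cJK z : (cconj (cconj z)) = z.
Proof. by apply: ceqP; rewrite !cE; ring. Qed.

Lemma cabs_ge0 z : 0 <= cabs z. Proof. exact: sqrtr_ge0. Qed.
Lemma sqr_cabs z : cabs z ^+ 2 = Re z ^+ 2 + Im z ^+ 2.
Proof. by rewrite sqr_sqrtr // addr_ge0 // sqr_ge0. Qed.
Lemma cabsM z w : cabs (z * w) = cabs z * cabs w.
Proof.
rewrite /cabs -sqrtrM ?addr_ge0 ?sqr_ge0 // !cE; congr Num.sqrt; ring.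
Qed.
Lemma cabs0 : cabs 0 = 0. Proof. by rewrite /cabs /= expr0n addr0 sqrtr0. Qed.
Lemma cabs1 : cabs 1 = 1. Proof. by rewrite /cabs /= expr0n addr0 expr1n sqrtr1. Qed.
Lemma cabsC (x : R) : cabs x%:C = `|x|.
Proof. by rewrite /cabs /= expr0n addr0 sqrtr_sqr. Qed.
Lemma cabsN z : cabs (- z) = cabs z.
Proof. by rewrite /cabs !cE !sqrrN. Qed.
Lemma cabsJ z : cabs (cconj z) = cabs z.
Proof. by rewrite /cabs !cE !sqrrN. Qed.
Lemma cabs_nat n : cabs n%:R = n%:R.
Proof. by rewrite complex_nat cabsC ger0_norm. Qed.
Lemma cabs_eq0 z : cabs z = 0 -> z = 0.
Proof.
move=> h; have := sqr_cabs z; rewrite h expr0n /= => /esym/eqP.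
rewrite paddr_eq0 ?sqr_ge0 // !sqrf_eq0 => /andP[/eqP a /eqP b].
exact: ceqP.
Qed.
Lemma cabs_gt0 z : z != 0 -> 0 < cabs z.
Proof.
move=> z0; rewrite lt_neqAle cabs_ge0 andbT eq_sym.
by apply: contra z0 => /eqP /cabs_eq0 ->.
Qed.
Lemma cabsV z : cabs z^-1 = (cabs z)^-1.
Proof.
have [->|z0] := eqVneq z 0; first by rewrite invr0 cabs0 invr0.
apply: (mulfI (lt0r_neq0 (cabs_gt0 z0))).
by rewrite -cabsM !mulfV ?cabs1 // lt0r_neq0 // cabs_gt0.
Qed.
Lemma le_Re_cabs z : `|Re z| <= cabs z.
Proof. by rewrite -sqrtr_sqr ler_wsqrtr // lerDl sqr_ge0. Qed.
Lemma le_Im_cabs z : `|Im z| <= cabs z.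
Proof. by rewrite -sqrtr_sqr ler_wsqrtr // lerDr sqr_ge0. Qed.
Lemma cabsD z w : cabs (z + w) <= cabs z + cabs w.
Proof.
(* Cauchy-Schwarz in the plane, read off from [Re (z * cconj w) <= cabs z * cabs w]. *)
have h : Re z * Re w + Im z * Im w <= cabs z * cabs w.
  have := le_Re_cabs (z * (cconj w)); rewrite cabsM cabsJ !cE mulrN opprK.
  by apply: le_trans; exact: ler_norm.
rewrite -(@ler_pXn2r _ 2) ?nnegrE ?addr_ge0 ?cabs_ge0 // sqrrD !sqr_cabs !cE.
rewrite !sqrrD; lra.
Qed.
Lemma cabsB z w : cabs (z - w) <= cabs z + cabs w.
Proof. by rewrite -[in leRHS](cabsN w) cabsD. Qed.
Lemma cabs_distC z w : cabs (z - w) = cabs (w - z).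
Proof. by rewrite -cabsN opprB. Qed.
Lemma lerB_cabs z w : cabs z - cabs w <= cabs (z + w).
Proof.
by rewrite lerBlDr -[X in cabs X <= _](addrK w) (le_trans (cabsB _ _)).
Qed.
Lemma le_cabs_ReIm z : cabs z <= `|Re z| + `|Im z|.
Proof.
rewrite -(@ler_pXn2r _ 2) ?nnegrE ?addr_ge0 ?cabs_ge0 // sqr_cabs.
by rewrite sqrrD !real_normK ?num_real // lerD2r lerDl mulrn_wge0.
Qed.
Lemma cabs_prod (I : Type) (r : seq I) (P : pred I) (F : I -> R[i]) :
  cabs (\prod_(i <- r | P i) F i) = \prod_(i <- r | P i) cabs (F i).
Proof. exact: (big_morph _ cabsM cabs1). Qed.
Lemma mulcJ z : z * (cconj z) = (cabs z ^+ 2)%:C.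
Proof. by apply: ceqP; rewrite sqr_cabs ?(ReC, ImC) !cE; ring. Qed.

Lemma mulJc z : cconj z * z = (cabs z ^+ 2)%:C.
Proof. by rewrite mulrC mulcJ. Qed.
Lemma Re_cexp z : Re (cexp z) = expR (Re z) * cos (Im z). Proof. by []. Qed.
Lemma Im_cexp z : Im (cexp z) = expR (Re z) * sin (Im z). Proof. by []. Qed.
Lemma cexpD z w : cexp (z + w) = cexp z * cexp w.
Proof.
rewrite /cexp ReD ImD expRD cosD sinD.
by apply: ceqP; rewrite [RHS]cE !(Re_cexp, Im_cexp) [LHS]/=; ring.
Qed.
Lemma cexp0 : cexp (0 : R[i]) = 1.
Proof. by apply: ceqP; rewrite /cexp /= expR0 ?cos0 ?sin0 ?mulr1 ?mulr0. Qed.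
Lemma cabs_cexp z : cabs (cexp z) = expR (Re z).
Proof.
rewrite /cabs /cexp /= !exprMn -mulrDr cos2Dsin2 mulr1 sqrtr_sqr.
by rewrite ger0_norm // expR_ge0.
Qed.
Lemma cexp_neq0 z : cexp z != 0.
Proof.
apply/eqP => h; have := cabs_cexp z; rewrite h cabs0 => /esym/eqP.
by rewrite gt_eqF // expR_gt0.
Qed.
Lemma cexpN z : cexp (- z) = (cexp z)^-1.
Proof.
by apply: (mulfI (cexp_neq0 z)); rewrite -cexpD subrr cexp0 mulfV // cexp_neq0.
Qed.
Lemma cexpJ z : cexp (cconj z) = (cconj (cexp z)).
Proof. by apply: ceqP; rewrite /cexp !cE /= ?cosN ?sinN ?mulrN. Qed.
Lemma cexpC (x : R) : cexp x%:C = (expR x)%:C.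
Proof. by apply: ceqP; rewrite /cexp /= ?cos0 ?sin0 ?mulr1 ?mulr0. Qed.
End ComplexBasics.

(** * Componentwise limits of complex-valued functions *)

Section ComplexLimits.
Variable R : realType.
Local Notation Re := (@complex.Re R).
Local Notation Im := (@complex.Im R).

Definition ccvg (T : Type) (F : set_system T) (f : T -> R[i]) (l : R[i]) : Prop :=
  (Re (f x) @[x --> F] --> Re l) /\ (Im (f x) @[x --> F] --> Im l).

Section Filter.
Context (T : Type) (F : set_system T) {FF : Filter F}.
Implicit Types (f g : T -> R[i]) (a b : R[i]).

Lemma ccvg_cst a : ccvg F (fun=> a) a.
Proof. by split; exact: cvg_cst. Qed.
Lemma ccvgC (f : T -> R) (a : R) :
  (f x @[x --> F] --> a) -> ccvg F (fun x => (f x)%:C) a%:C.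
Proof. by move=> h; split; [exact: h | exact: cvg_cst]. Qed.
Lemma ccvgD f g a b : ccvg F f a -> ccvg F g b -> ccvg F (fun x => f x + g x) (a + b).
Proof.
move=> [fa fa'] [gb gb']; split; rewrite !cE; under eq_fun do rewrite !cE;
  exact: cvgD.
Qed.
Lemma ccvgN f a : ccvg F f a -> ccvg F (fun x => - f x) (- a).
Proof.
move=> [fa fa']; split; rewrite !cE; under eq_fun do rewrite !cE; exact: cvgN.
Qed.
Lemma ccvgJ f a : ccvg F f a -> ccvg F (fun x => (cconj (f x))) (cconj a).
Proof.
move=> [fa fa']; split; rewrite !cE; under eq_fun do rewrite !cE; first exact: fa.
exact: cvgN.
Qed.
Lemma ccvgB f g a b : ccvg F f a -> ccvg F g b -> ccvg F (fun x => f x - g x) (a - b).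
Proof. by move=> fa gb; apply: ccvgD => //; exact: ccvgN. Qed.
Lemma ccvgM f g a b : ccvg F f a -> ccvg F g b -> ccvg F (fun x => f x * g x) (a * b).
Proof.
move=> [fa fa'] [gb gb']; split; rewrite !cE; under eq_fun do rewrite !cE.
  by apply: cvgB; apply: cvgM.
by apply: cvgD; apply: cvgM.
Qed.
Lemma cvg_sqr_cabs f a : ccvg F f a -> cabs (f x) ^+ 2 @[x --> F] --> cabs a ^+ 2.
Proof.
move=> [fa fa']; rewrite sqr_cabs; under eq_fun do rewrite sqr_cabs !expr2.
by rewrite !expr2; apply: cvgD; apply: cvgM.
Qed.
Lemma ccvgV f a : a != 0 -> ccvg F f a -> ccvg F (fun x => (f x)^-1) a^-1.
Proof.
move=> a0 fa; have := cvg_sqr_cabs fa; case: fa => fa fb.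
rewrite sqr_cabs; under eq_fun do rewrite sqr_cabs.
move=> /cvgV h; have {}h := h _; split.
  rewrite ReV; under eq_fun do rewrite ReV; apply: cvgM => //.
  by apply: h; rewrite -sqr_cabs sqrf_eq0 gt_eqF // cabs_gt0.
rewrite ImV; under eq_fun do rewrite ImV; apply: cvgN; apply: cvgM => //.
by apply: h; rewrite -sqr_cabs sqrf_eq0 gt_eqF // cabs_gt0.
Qed.
Lemma ccvg_cexp f a : ccvg F f a -> ccvg F (fun x => cexp (f x)) (cexp a).
Proof.
move=> [fa fb].
have fe : expR (Re (f x)) @[x --> F] --> expR (Re a).
  by apply: (cvg_comp _ _ fa); exact: continuous_expR.
split; apply: cvgM => //; apply: (cvg_comp _ _ fb).
  exact: continuous_cos.
exact: continuous_sin.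
Qed.
Lemma cvg_cabs f a : ccvg F f a -> cabs (f x) @[x --> F] --> cabs a.
Proof.
move=> fa; have := cvg_sqr_cabs fa => h.
have := (cvg_comp _ _ h (@sqrt_continuous R (cabs a ^+ 2))).
rewrite sqrtr_sqr ger0_norm ?cabs_ge0 // => k.
apply: cvg_trans k; apply: near_eq_cvg; near=> x.
by rewrite /= sqrtr_sqr ger0_norm // cabs_ge0.
Unshelve. all: end_near. Qed.
Lemma ccvg_prod (f_ : nat -> T -> R[i]) (a_ : nat -> R[i]) n : (forall k : nat, ccvg F (f_ k) (a_ k)) ->
  ccvg F (fun x => \prod_(0 <= k < n) f_ k x) (\prod_(0 <= k < n) a_ k).
Proof.
move=> h; elim: n => [|n ih].
  by rewrite big_nil; under eq_fun do rewrite big_nil; exact: ccvg_cst.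
rewrite big_nat_recr //=; under eq_fun do rewrite big_nat_recr //=.
exact: ccvgM.
Qed.
Lemma ccvg_cabs0 f a : cabs (f x - a) @[x --> F] --> 0 -> ccvg F f a.
Proof.
move=> /cvgrPdist_lt h; split; apply/cvgrPdist_lt => e /h; apply: filterS => x;
  rewrite sub0r normrN ger0_norm ?cabs_ge0 //; apply: le_lt_trans.
  by rewrite -ReB cabs_distC le_Re_cabs.
by rewrite -ImB cabs_distC le_Im_cabs.
Qed.
End Filter.

Lemma ccvg_lim (u : nat -> R[i]) l : ccvg \oo u l -> climit u = l.
Proof.
by move=> [a b]; rewrite /climit (cvg_lim _ a) // (cvg_lim _ b) //; case: l {a b}.
Qed.

End ComplexLimits.

(** * Integrals of complex-valued functions *)

Section ComplexIntegral.
Variable R : realType.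
Local Notation Re := (@complex.Re R).
Local Notation Im := (@complex.Im R).
Context d (T : measurableType d) (mu : {measure set T -> \bar R}).
Implicit Types (F G : T -> R[i]) (D : set T).

Definition cint D F : R[i] :=
  (\int[mu]_(t in D) Re (F t)) +i* (\int[mu]_(t in D) Im (F t)).
#[global] Arguments cint : simpl never.
Lemma Re_cint D F : Re (cint D F) = \int[mu]_(t in D) Re (F t). Proof. by []. Qed.
Lemma Im_cint D F : Im (cint D F) = \int[mu]_(t in D) Im (F t). Proof. by []. Qed.
Definition cmeas D F := measurable_fun D (fun t => Re (F t)) /\ measurable_fun D (fun t => Im (F t)).
Definition cintegrable D F :=
  mu.-integrable D (fun t => (Re (F t))%:E) /\ mu.-integrable D (fun t => (Im (F t))%:E).

Lemma cmeas_cst D (a : R[i]) : cmeas D (fun=> a).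
Proof. by split; exact: measurable_cst. Qed.
Lemma cmeasC D (f : T -> R) : measurable_fun D f -> cmeas D (fun x => (f x)%:C).
Proof. by move=> h; split => //; exact: measurable_cst. Qed.
Lemma cmeasD D F G : cmeas D F -> cmeas D G -> cmeas D (fun x => F x + G x).
Proof.
move=> [a b] [c e]; split; under eq_fun do rewrite !cE; exact: measurable_funD.
Qed.
Lemma cmeasN D F : cmeas D F -> cmeas D (fun x => - F x).
Proof.
move=> [a b]; split; under eq_fun do rewrite !cE; exact: measurable_funN.
Qed.
Lemma cmeasB D F G : cmeas D F -> cmeas D G -> cmeas D (fun x => F x - G x).
Proof. by move=> hF hG; apply: cmeasD => //; exact: cmeasN. Qed.
Lemma cmeasJ D F : cmeas D F -> cmeas D (fun x => (cconj (F x))).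
Proof.
move=> [a b]; split; under eq_fun do rewrite !cE; first exact: a.
exact: measurable_funN.
Qed.
Lemma cmeasM D F G : cmeas D F -> cmeas D G -> cmeas D (fun x => F x * G x).
Proof.
move=> [a b] [c e]; split; under eq_fun do rewrite !cE.
  by apply: measurable_funB; apply: measurable_funM.
by apply: measurable_funD; apply: measurable_funM.
Qed.
Lemma cmeas_cexp D F : cmeas D F -> cmeas D (fun x => cexp (F x)).
Proof.
move=> [a b]; rewrite /cexp; split => /=; apply: measurable_funM.
- exact: (measurableT_comp (@measurable_expR R)).
- by apply: (measurableT_comp _ b); apply: continuous_measurable_fun; exact: continuous_cos.
- exact: (measurableT_comp (@measurable_expR R)).
- by apply: (measurableT_comp _ b); apply: continuous_measurable_fun; exact: continuous_sin.
Qed.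
Lemma measurable_sqr_cabs D F : cmeas D F -> measurable_fun D (fun x => cabs (F x) ^+ 2).
Proof.
move=> [a b]; under eq_fun do rewrite sqr_cabs.
by apply: measurable_funD; apply: measurable_funX.
Qed.
Lemma measurable_cabs D F : cmeas D F -> measurable_fun D (fun x => cabs (F x)).
Proof.
move=> h; have h2 := measurable_sqr_cabs h.
have -> : (fun x => cabs (F x)) = (fun x => Num.sqrt (cabs (F x) ^+ 2)).
  by apply/funext => x; rewrite sqrtr_sqr ger0_norm // cabs_ge0.
apply: (measurableT_comp _ h2); apply: continuous_measurable_fun.
exact: sqrt_continuous.
Qed.
Lemma cmeas_cvg D (F_ : nat -> T -> R[i]) F : (forall n, cmeas D (F_ n)) ->
  (forall x, D x -> ccvg \oo (F_ ^~ x) (F x)) -> cmeas D F.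
Proof.
move=> h k; split.
  apply: (@measurable_fun_cvg _ _ _ D (fun n x => Re (F_ n x))); last by move=> x /k [].
  by move=> m; case: (h m).
apply: (@measurable_fun_cvg _ _ _ D (fun n x => Im (F_ n x))); last by move=> x /k [].
by move=> m; case: (h m).
Qed.

Lemma cintegrable_le D F (g : T -> R) : measurable D -> cmeas D F ->
  mu.-integrable D (EFin \o g) -> (forall x, D x -> cabs (F x) <= g x) ->
  cintegrable D F.
Proof.
move=> mD [mF mF'] ig h; split; apply: (le_integrable mD _ _ ig).
- exact/measurable_EFinP.
- move=> x /h h' /=; rewrite lee_fin (le_trans (le_Re_cabs _)) //.
  by rewrite (le_trans h') // ler_norm.
- exact/measurable_EFinP.
- move=> x /h h' /=; rewrite lee_fin (le_trans (le_Im_cabs _)) //.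
  by rewrite (le_trans h') // ler_norm.
Qed.
Lemma cintegrable_cmeas D F : cintegrable D F -> cmeas D F.
Proof. by move=> [a b]; split; apply/measurable_EFinP; [exact: (measurable_int _ a)|exact: (measurable_int _ b)]. Qed.
Lemma cintegrable_cabs D F : measurable D -> cintegrable D F ->
  mu.-integrable D (fun x => (cabs (F x))%:E).
Proof.
move=> mD iF; have mF := cintegrable_cmeas iF; case: iF => a b.
have := integrableD mD (integrable_abse a) (integrable_abse b).
apply: le_integrable => //.
  by apply/measurable_EFinP; exact: measurable_cabs.
move=> x Dx /=; rewrite lee_fin ger0_norm ?cabs_ge0 //.
by rewrite (le_trans (le_cabs_ReIm _)) // ler_norm.
Qed.

Lemma eq_cint D F G : (forall x, D x -> F x = G x) -> cint D F = cint D G.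
Proof.
by move=> h; rewrite /cint; congr (_ +i* _); apply: eq_Rintegral => x /set_mem /h ->.
Qed.
Lemma eq_cintegrable D F G : measurable D -> (forall x, D x -> F x = G x) ->
  cintegrable D F -> cintegrable D G.
Proof.
move=> mD h [a b]; split.
  by apply: eq_integrable a => // x /set_mem /h ->.
by apply: eq_integrable b => // x /set_mem /h ->.
Qed.
Lemma cintD D F G : measurable D -> cintegrable D F -> cintegrable D G ->
  cint D (fun x => F x + G x) = cint D F + cint D G.
Proof.
move=> mD [a b] [c e]; apply: ceqP; rewrite !cE /cint /=.
  by rewrite -RintegralD //; apply: eq_Rintegral => x _; rewrite cE.
by rewrite -RintegralD //; apply: eq_Rintegral => x _; rewrite cE.
Qed.
Lemma cintegrableZ D F (z : R[i]) : measurable D -> cintegrable D F ->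
  cintegrable D (fun x => z * F x).
Proof.
move=> mD iF; have ic := cintegrable_cabs mD iF.
apply: (@cintegrable_le _ _ (fun x => cabs z * cabs (F x))) => //.
- by apply: cmeasM; [exact: cmeas_cst|exact: cintegrable_cmeas].
- by rewrite /comp; under eq_fun do rewrite EFinM; exact: integrableZl.
- by move=> x _; rewrite cabsM.
Qed.
Lemma cintZ D F (z : R[i]) : measurable D -> cintegrable D F ->
  cint D (fun x => z * F x) = z * cint D F.
Proof.
move=> mD [a b]; apply: ceqP; rewrite cE /cint /=.
  rewrite -!RintegralZl // -RintegralB //; last 2 first.
  - by rewrite /comp; under eq_fun do rewrite EFinM; exact: integrableZl.
  - by rewrite /comp; under eq_fun do rewrite EFinM; exact: integrableZl.
  by apply: eq_Rintegral => x _; rewrite cE.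
rewrite -!RintegralZl // -RintegralD //; last 2 first.
- by rewrite /comp; under eq_fun do rewrite EFinM; exact: integrableZl.
- by rewrite /comp; under eq_fun do rewrite EFinM; exact: integrableZl.
by apply: eq_Rintegral => x _; rewrite cE.
Qed.
Lemma cintZr D F (z : R[i]) : measurable D -> cintegrable D F ->
  cint D (fun x => F x * z) = cint D F * z.
Proof.
move=> mD iF; rewrite mulrC -cintZ //; apply: eq_cint => x _; exact: mulrC.
Qed.
Lemma cintN D F : measurable D -> cintegrable D F ->
  cint D (fun x => - F x) = - cint D F.
Proof.
move=> mD iF; rewrite -mulN1r -cintZ //; apply: eq_cint => x _.
by rewrite mulN1r.
Qed.
Lemma cintB D F G : measurable D -> cintegrable D F -> cintegrable D G ->
  cint D (fun x => F x - G x) = cint D F - cint D G.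
Proof.
move=> mD iF iG; rewrite cintD // ?cintN //.
apply: (@eq_cintegrable _ (fun x => -1 * G x)) => //.
  by move=> x _; rewrite mulN1r.
exact: cintegrableZ.
Qed.
Lemma cintJ D F : cintegrable D F -> measurable D -> cint D (fun x => (cconj (F x))) = (cconj (cint D F)).
Proof.
move=> [a b] mD; apply: ceqP; rewrite cE /cint /=.
  by apply: eq_Rintegral => x _; rewrite cE.
rewrite -mulN1r -RintegralZl //; apply: eq_Rintegral => x _; rewrite cE.
by rewrite mulN1r.
Qed.
(** The factor [2] comes from bounding real and imaginary parts separately. It is harmless, since
    the resulting bounds only have to be finite or to tend to [0]. *)
Lemma cint_le D F (g : T -> R) : measurable D -> cmeas D F ->
  mu.-integrable D (EFin \o g) -> (forall x, D x -> cabs (F x) <= g x) ->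
  cabs (cint D F) <= 2 * \int[mu]_(x in D) g x.
Proof.
move=> mD mF ig h; have [a b] := cintegrable_le mD mF ig h.
rewrite (le_trans (le_cabs_ReIm _)) // mulr_natl mulr2n /cint /= lerD //.
- rewrite (le_trans (le_normr_Rintegral _ _)) //; apply: le_Rintegral => //.
    exact: (integrable_norm a).
  by move=> x Dx; rewrite (le_trans (le_Re_cabs _)) // h.
- rewrite (le_trans (le_normr_Rintegral _ _)) //; apply: le_Rintegral => //.
    exact: (integrable_norm b).
  by move=> x Dx; rewrite (le_trans (le_Im_cabs _)) // h.
Qed.
Lemma cint_dct D (F_ : nat -> T -> R[i]) F (g : T -> R) : measurable D ->
  (forall n, cmeas D (F_ n)) -> (forall x, D x -> ccvg \oo (F_ ^~ x) (F x)) ->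
  mu.-integrable D (EFin \o g) -> (forall n x, D x -> cabs (F_ n x) <= g x) ->
  cintegrable D F /\ ccvg \oo (fun n => cint D (F_ n)) (cint D F).
Proof.
move=> mD mF cF ig h.
have gF x : D x -> cabs (F x) <= g x.
  move=> Dx; have k : cabs (F_ n x) @[n --> \oo] --> cabs (F x) by exact: cvg_cabs (cF x Dx).
  rewrite -(cvg_lim _ k) //; apply: limr_le; first by apply/cvg_ex; exists (cabs (F x)); exact: k.
  by apply: nearW => n; exact: h.
have mF' : cmeas D F by exact: cmeas_cvg cF.
have iF := cintegrable_le mD mF' ig gF; split => //.
have [iR iI] := iF.
(* [p] stands for [Re] or [Im]; both have the listed properties, so one argument serves for the two
   components. The same device recurs below. *)
have key (p : R[i] -> R) : (forall z, `|p z| <= cabs z) ->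
   (forall n, measurable_fun D (fun x => p (F_ n x))) ->
   (forall x, D x -> p (F_ n x) @[n --> \oo] --> p (F x)) ->
   mu.-integrable D (fun x => (p (F x))%:E) ->
   \int[mu]_(x in D) p (F_ n x) @[n --> \oo] --> \int[mu]_(x in D) p (F x).
  move=> pc mp pF ip; apply: fine_cvg; rewrite fineK; last exact: integrable_fin_num.
  apply: (@dominated_cvg _ _ _ _ _ mD _ _ (EFin \o g)) => //.
  - by move=> n; apply/measurable_EFinP; exact: mp.
  - by move=> x Dx; apply: cvg_EFin; [exact: nearW|exact: pF].
  - by move=> n x Dx; rewrite abse_EFin lee_fin (le_trans (pc _)) // h.
split; apply: key => //.
- exact: le_Re_cabs.
- by move=> n; apply (mF n).
- by move=> x /cF [].
- exact: le_Im_cabs.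
- by move=> n; apply (mF n).
- by move=> x /cF [].
Qed.
End ComplexIntegral.

(** * Fubini for integrands dominated by a product of integrable functions *)

Section DominatedFubini.
Variable R : realType.
Context d1 d2 (T1 : measurableType d1) (T2 : measurableType d2).
Variables (m1 : {sigma_finite_measure set T1 -> \bar R}) (m2 : {sigma_finite_measure set T2 -> \bar R}).
Variables (g1 : T1 -> R) (g2 : T2 -> R).
Hypothesis ig1 : m1.-integrable setT (EFin \o g1).
Hypothesis ig2 : m2.-integrable setT (EFin \o g2).

Section Real.
Variable f : T1 * T2 -> R.
Hypothesis mf : measurable_fun setT f.
Hypothesis fg : forall x y, `|f (x, y)| <= g1 x * g2 y.

Let isec1 x : m2.-integrable setT (fun y => (f (x, y))%:E).
Proof.
have : m2.-integrable setT (fun y => (g1 x)%:E * (EFin \o g2) y)%E by exact: integrableZl.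
apply: le_integrable => //; first exact/measurable_EFinP/measurable_fun_pair2.
by move=> y _ /=; rewrite lee_fin (le_trans (fg _ _)) // ler_norm.
Qed.
Let isec2 y : m1.-integrable setT (fun x => (f (x, y))%:E).
Proof.
have : m1.-integrable setT (fun x => (g2 y)%:E * (EFin \o g1) x)%E by exact: integrableZl.
apply: le_integrable => //; first exact/measurable_EFinP/measurable_fun_pair1.
by move=> x _ /=; rewrite lee_fin (le_trans (fg _ _)) // mulrC ler_norm.
Qed.
Let if12 : (m1 \x m2)%E.-integrable setT (EFin \o f).
Proof.
apply/integrable12ltyP; first exact/measurable_EFinP.
(* Tonelli: the iterated integral of [|f|] is at most the product of the integrals of [|g1|] and
   [|g2|]. *)
apply: (@le_lt_trans _ _ (\int[m1]_x ((fine (\int[m2]_y (`|g2 y|)%:E))%:E * (`|g1 x|)%:E))%E).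
  apply: ge0_le_integral => //.
  - by move=> x _; apply: integral_ge0.
  - apply: (@measurable_fun_fubini_tonelli_F _ _ _ _ _ m2 (fun z => `|(EFin \o f) z|%E)) => //.
    by apply: measurableT_comp => //; exact/measurable_EFinP.
  - apply/measurable_EFinP; apply: measurable_funM; first exact: measurable_cst.
    by apply: measurableT_comp => //; apply/measurable_EFinP; exact: (measurable_int _ ig1).
  - move=> x _.
    have ig2' : m2.-integrable setT (EFin \o (Num.norm \o g2)) by exact: (integrable_norm ig2).
    rewrite fineK; last exact: integrable_fin_num.
    rewrite muleC -integralZl //; apply: ge0_le_integral => //.
    + by apply: measurableT_comp => //; exact/measurable_EFinP/measurable_fun_pair2.
    + by apply/measurable_EFinP; apply: measurable_funM => //; apply: measurableT_comp => //;
        apply/measurable_EFinP; exact: (measurable_int _ ig2).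
    + move=> y _ /=; rewrite lee_fin (le_trans (fg _ _)) //.
      by rewrite -normrM ler_norm.
rewrite ge0_integralZl //.
- have /integrableP[_] : m1.-integrable setT (EFin \o (Num.norm \o g1)) by exact: (integrable_norm ig1).
  move=> h0; have h : (\int[m1]_x (`|g1 x|)%:E < +oo)%E.
    apply: le_lt_trans h0; rewrite le_eqVlt; apply/orP; left; apply/eqP.
    by apply: eq_integral => x _; rewrite /= normr_id. apply: lte_mul_pinfty => //.
  by rewrite lee_fin fine_ge0 // integral_ge0.
- apply: measurableT_comp => //; apply: measurableT_comp => //.
  by apply/measurable_EFinP; exact: (measurable_int _ ig1).
- by rewrite lee_fin fine_ge0 // integral_ge0.
Qed.

Lemma Rintegral_fubini : \int[m1]_x \int[m2]_y f (x, y) = \int[m2]_y \int[m1]_x f (x, y).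
Proof.
rewrite /Rintegral; congr fine.
rewrite (eq_integral (fun x => \int[m2]_y (f (x, y))%:E)%E); last first.
  by move=> x _; rewrite fineK //; exact: integrable_fin_num.
rewrite [RHS](eq_integral (fun y => \int[m1]_x (f (x, y))%:E)%E); last first.
  by move=> y _; rewrite fineK //; exact: integrable_fin_num.
exact: (Fubini if12).
Qed.
Lemma integrable_Rintegral : m1.-integrable setT (fun x => (\int[m2]_y f (x, y))%:E).
Proof.
have := integrable_fubini_F if12; apply: eq_integrable => // x _.
by rewrite /fubini_F fineK //; exact: integrable_fin_num.
Qed.
End Real.

Variable F : T1 * T2 -> R[i].
Hypothesis mF : cmeas setT F.
Hypothesis Fg : forall x y, cabs (F (x, y)) <= g1 x * g2 y.

Lemma cint_fubini : cint m1 setT (fun x => cint m2 setT (fun y => F (x, y))) =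
  cint m2 setT (fun y => cint m1 setT (fun x => F (x, y))).
Proof.
case: mF => mr mi; rewrite /cint /=; congr (_ +i* _).
  apply: (@Rintegral_fubini (fun z => complex.Re (F z))) => // x y.
  by rewrite (le_trans (le_Re_cabs _)).
apply: (@Rintegral_fubini (fun z => complex.Im (F z))) => // x y.
by rewrite (le_trans (le_Im_cabs _)).
Qed.
Lemma cintegrable_cint : cintegrable m1 setT (fun x => cint m2 setT (fun y => F (x, y))).
Proof.
case: mF => mr mi; split => /=.
  apply: (@integrable_Rintegral (fun z => complex.Re (F z))) => // x y.
  by rewrite (le_trans (le_Re_cabs _)).
apply: (@integrable_Rintegral (fun z => complex.Im (F z))) => // x y.
by rewrite (le_trans (le_Im_cabs _)).
Qed.
End DominatedFubini.

(** * Derivatives and the fundamental theorem for complex functions of a real variable *)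

Section LineIntegrals.
Variable R : realType.
Local Notation Re := (@complex.Re R).
Local Notation Im := (@complex.Im R).
Local Notation mu := (@lebesgue_measure R).
Implicit Types (F G : R -> R[i]).

Definition ccont F := forall x, ccvg (nbhs x) F (F x).
Definition cderiv F (x : R) (a : R[i]) :=
  is_derive x 1 (fun t => Re (F t)) (Re a) /\ is_derive x 1 (fun t => Im (F t)) (Im a).

Lemma ccont_Re F : ccont F -> continuous (fun x => Re (F x)).
Proof. by move=> h x; case: (h x). Qed.
Lemma ccont_Im F : ccont F -> continuous (fun x => Im (F x)).
Proof. by move=> h x; case: (h x). Qed.
Lemma ccont_cmeas D F : measurable D -> ccont F -> cmeas D F.
Proof.
move=> mD h; split; apply: measurable_funTS; apply: continuous_measurable_fun.
  exact: ccont_Re.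
exact: ccont_Im.
Qed.

Lemma cderivD F G x a b : cderiv F x a -> cderiv G x b ->
  cderiv (fun t => F t + G t) x (a + b).
Proof.
move=> [? ?] [? ?]; split; rewrite !cE; under eq_fun do rewrite !cE; exact: is_deriveD.
Qed.
Lemma cderivM F G x a b : cderiv F x a -> cderiv G x b ->
  cderiv (fun t => F t * G t) x (a * G x + F x * b).
Proof.
move=> [? ?] [? ?]; split; rewrite !cE; under eq_fun do rewrite !cE.
  by apply: is_derive_eq; rewrite /GRing.scale /=; ring.
by apply: is_derive_eq; rewrite /GRing.scale /=; ring.
Qed.
Lemma cderiv_cst a x : cderiv (fun=> a) x 0.
Proof. by split; apply: is_derive_eq. Qed.
Lemma cderivC (f : R -> R) (x a : R) : is_derive x 1 f a -> cderiv (fun t => (f t)%:C) x a%:C.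
Proof. by move=> ?; split => //=; apply: is_derive_eq. Qed.
Lemma cderiv_ccvg F x a : cderiv F x a -> ccvg (nbhs x) F (F x).
Proof.
move=> [[h _] [k _]]; split.
  by apply/differentiable_continuous/derivable1_diffP.
by apply/differentiable_continuous/derivable1_diffP.
Qed.
Lemma cderiv_cexp F x a : cderiv F x a ->
  cderiv (fun t => cexp (F t)) x (a * cexp (F x)).
Proof.
move=> [h k].
have h1 : is_derive x 1 (fun t => expR (Re (F t))) (expR (Re (F x)) *: Re a).
  by have := is_derive1_comp (is_derive_expR (Re (F x))) h.
have h2 : is_derive x 1 (fun t => cos (Im (F t))) (- sin (Im (F x)) *: Im a).
  by have := is_derive1_comp (is_derive_cos (Im (F x))) k.
have h3 : is_derive x 1 (fun t => sin (Im (F t))) (cos (Im (F x)) *: Im a).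
  by have := is_derive1_comp (is_derive_sin (Im (F x))) k.
split; rewrite !cE !(Re_cexp, Im_cexp); under eq_fun do rewrite !(Re_cexp, Im_cexp).
  by apply: is_derive_eq; rewrite /GRing.scale /=; ring.
by apply: is_derive_eq; rewrite /GRing.scale /=; ring.
Qed.
Lemma cderivV F x a : F x != 0 -> cderiv F x a ->
  cderiv (fun t => (F t)^-1) x (- a * (F x)^-1 ^+ 2).
Proof.
move=> F0 [h k].
have n0 : Re (F x) ^+ 2 + Im (F x) ^+ 2 != 0.
  by rewrite -sqr_cabs sqrf_eq0 gt_eqF // cabs_gt0.
have dn : is_derive x 1 (fun t => Re (F t) ^+ 2 + Im (F t) ^+ 2)
    (2 * Re (F x) * Re a + 2 * Im (F x) * Im a).
  under eq_fun do rewrite !expr2.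
  by apply: is_derive_eq; rewrite /GRing.scale /=; ring.
have dn' := @is_deriveV _ (fun t => Re (F t) ^+ 2 + Im (F t) ^+ 2) x _ 1 n0 dn.
split.
  under eq_fun do rewrite ReV.
  apply: is_derive_eq; rewrite expr2 !cE !ReV !ImV /GRing.scale /=.
  by field.
under eq_fun do rewrite ImV.
apply: is_derive_eq; rewrite expr2 !cE !ReV !ImV /GRing.scale /=.
by field.
Qed.

Lemma cint_ftc F f a b : a <= b -> (forall x, x \in `[a, b] -> cderiv F x (f x)) ->
  (forall x, x \in `[a, b] -> ccvg (nbhs x) f (f x)) ->
  cint mu `[a, b] f = F b - F a.
Proof.
rewrite le_eqVlt => /predU1P[->|ab] dF cf.
  by rewrite subrr /cint set_itv1 !Rintegral_set1.
have key (p : R[i] -> R) : (forall z w, p (z - w) = p z - p w) ->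
   (forall x, x \in `[a, b] -> is_derive x 1 (fun t => p (F t)) (p (f x))) ->
   (forall x, x \in `[a, b] -> p (f t) @[t --> x] --> p (f x)) ->
   \int[mu]_(x in `[a, b]) p (f x) = p (F b - F a).
  move=> pB dp cp; rewrite pB /Rintegral (@continuous_FTC2 _ (fun x => p (f x)) (fun x => p (F x))) //.
  - by apply: continuous_in_subspaceT => x /set_mem; exact: cp.
  - have cF x : x \in `[a, b] -> p (F t) @[t --> x] --> p (F x).
      by move=> /dp[h _]; apply/differentiable_continuous/derivable1_diffP.
    split.
    + by move=> x xab; case: (dp x (subset_itv_oo_cc xab)).
    + by apply: cvg_at_right_filter; apply: cF; rewrite in_itv /= lexx ltW.
    + by apply: cvg_at_left_filter; apply: cF; rewrite in_itv /= lexx ltW.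
  - by move=> x xab; have [_ h] := dp x (subset_itv_oo_cc xab); rewrite derive1E h.
apply: ceqP; rewrite /cint /=; apply: key.
- exact: ReB.
- by move=> x /dF [].
- by move=> x /cf [].
- exact: ImB.
- by move=> x /dF [].
- by move=> x /cf [].
Qed.

Lemma ccont_cintegrable_itv F a b : (forall x, x \in `[a, b] -> ccvg (nbhs x) F (F x)) ->
  cintegrable mu `[a, b] F.
Proof.
move=> cF; split; apply: continuous_compact_integrable; try exact: segment_compact.
  by apply: continuous_in_subspaceT => x /set_mem /cF [].
by apply: continuous_in_subspaceT => x /set_mem /cF [].
Qed.

End LineIntegrals.

(** * Integrals over the line, substitutions, and the passage from the half-line by the
    exponential *)

Section RealLineIntegrals.
Variable R : realType.
Local Notation Re := (@complex.Re R).
Local Notation Im := (@complex.Im R).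
Local Notation mu := (@lebesgue_measure R).
Implicit Types (F G : R -> R[i]).

(** [L] is a real number, so the half-line integral is finite; this yields integrability on the line
    together with the value. *)
Lemma even_integral (g : R -> R) (L : R) : (forall x, 0 <= g x) -> continuous g ->
  (forall x, g (- x) = g x) -> (\int[mu]_(x in `[0%R, +oo[) (g x)%:E = L%:E)%E ->
  mu.-integrable setT (EFin \o g) /\ \int[mu]_x g x = 2 * L.
Proof.
move=> g0 cg ge gL.
have e : (\int[mu]_x (g x)%:E = (2 * L)%:E)%E.
  rewrite ge0_symfun_integralT //; last by move=> x /=; rewrite ge.
  rewrite (_ : [set x | _] = `[0, +oo[%classic) ?gL ?EFinM //.
  by apply/seteqP; split => x /=; rewrite in_itv /= andbT.
split; last by rewrite /Rintegral e.
apply/integrableP; split.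
  by apply/measurable_EFinP; exact: continuous_measurable_fun.
have -> : (\int[mu]_x `|(EFin \o g) x| = \int[mu]_x (g x)%:E)%E.
  by apply: eq_integral => x _ /=; rewrite ger0_norm.
by rewrite e ltry.
Qed.

Lemma continuous_expRN (e : R) : continuous (fun x : R => expR (- e * `|x|)).
Proof.
move=> x; apply: (@continuous_comp _ _ _ (fun x : R => - e * `|x|) expR);
  last exact: continuous_expR.
by apply: cvgM; [exact: cvg_cst|exact: norm_continuous].
Qed.

Lemma integrable_expRN (e : R) : 0 < e ->
  mu.-integrable setT (EFin \o (fun x => expR (- e * `|x|))).
Proof.
(* [0 - - e^-1] is the limit at infinity minus the value at [0] of the antiderivative
   [- e^-1 * expR (- e * x)]. *)
move=> e0; suff /(even_integral (fun x => expR_ge0 (- e * `|x|))) h : (\int[mu]_(x in `[0%R, +oo[) (expR (- e * `|x|))%:E = (0 - - (e^-1))%:E)%E.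
  have [||//] := h _ _; [exact: continuous_expRN|by move=> x; rewrite normrN].
transitivity (\int[mu]_(x in `[0%R, +oo[) (expR (- e * x))%:E)%E.
  apply: eq_integral => x.
  by move=> /set_mem /=; rewrite in_itv /= andbT => x0; rewrite ger0_norm.
have dF (x : R) : is_derive x 1 (fun x => - (e^-1 * expR (- e * x))) (expR (- e * x)).
  by apply: is_derive_eq; rewrite /GRing.scale /=; field; rewrite gt_eqF.
have cF : continuous (fun x => - (e^-1 * expR (- e * x))).
  by move=> x; apply/differentiable_continuous/derivable1_diffP.
rewrite (@ge0_continuous_FTC2y _ _ (fun x => - (e^-1 * expR (- e * x))) 0 0) //.
- by rewrite mulr0 expR0 mulr1 EFinB.
- apply: continuous_subspaceT => x.
  apply: (@continuous_comp _ _ _ (fun x : R => - e * x) expR); last exact: continuous_expR.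
  by apply: cvgM; [exact: cvg_cst|exact: cvg_id].
- rewrite -oppr0 -(mulr0 e^-1); apply: cvgN; apply: cvgM; first exact: cvg_cst.
  under eq_fun do rewrite mulNr.
  apply: (@cvg_comp _ _ _ (fun x => e * x) (fun x => expR (- x)) _ +oo%R); last exact: cvgr_expR.
  exact: gt0_cvgMry.
- by apply: cvg_at_right_filter; exact: cF.
- by move=> x _; rewrite derive1E; exact: derive_val.
Qed.

Lemma integrable_oneDsqrV : mu.-integrable setT (EFin \o (fun x : R => (1 + x ^+ 2)^-1)).
Proof.
have [||||//] := @even_integral (fun x : R => (1 + x ^+ 2)^-1) (pi / 2).
- by move=> x; rewrite invr_ge0 addr_ge0 // sqr_ge0.
- exact: continuous_oneDsqrV.
- by move=> x; rewrite sqrrN.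
- exact: integral0y_oneDsqr.
Qed.
Lemma Rintegral_oneDsqrV : \int[mu]_x (1 + x ^+ 2)^-1 = pi :> R.
Proof.
have [||||_ ->] := @even_integral (fun x : R => (1 + x ^+ 2)^-1) (pi / 2); last by field.
- by move=> x; rewrite invr_ge0 addr_ge0 // sqr_ge0.
- exact: continuous_oneDsqrV.
- by move=> x; rewrite sqrrN.
- exact: integral0y_oneDsqr.
Qed.

Lemma cint_mkcond (D : set R) F : cint mu D F = cint mu setT (fun x => F x * (\1_D x)%:C).
Proof.
have key (p : R[i] -> R) : p 0 = 0 -> \int[mu]_(x in D) p (F x) = \int[mu]_x p (F x * (\1_D x)%:C).
  move=> p0; rewrite Rintegral_mkcond; apply: eq_Rintegral => x _.
  by rewrite patchE indicE; case: ifPn => _; rewrite ?mulr1 // mulr0.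
by rewrite /cint /=; congr (_ +i* _); exact: key.
Qed.

Lemma cmeas_indic (D E : set R) : measurable E -> cmeas D (fun x : R => (\1_E x : R)%:C).
Proof.
by move=> mE; apply: cmeasC; apply: measurable_funTS; exact: measurable_indic.
Qed.

(** Reduces integrals over the line to compact windows, where the fundamental theorem of calculus is
    available. *)
Lemma cvg_cint_window F : cintegrable mu setT F ->
  ccvg \oo (fun n => cint mu `[- n%:R, n%:R] F) (cint mu setT F).
Proof.
move=> iF; have mF := cintegrable_cmeas iF.
have [||||_] := @cint_dct _ _ _ mu setT (fun (n:nat) x => F x * (\1_(`[- n%:R, n%:R]%classic) x)%:C) F
  (fun x => cabs (F x)) measurableT.
- by move=> n; apply: cmeasM => //; exact: cmeas_indic.
- move=> x _; suff h : \forall n \near \oo, F x * (\1_(`[- n%:R, n%:R]%classic) x)%:C = F x.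
    by split; apply: cvg_near_cst; apply: filterS h => n ->.
  near=> n; rewrite indicE mem_set ?mulr1 //= in_itv /= -ler_norml.
  by near: n; exact: nbhs_infty_ger.
- exact: cintegrable_cabs.
- move=> n x _; rewrite cabsM cabsC indicE.
  by case: (_ \in _); rewrite ?normr1 ?mulr1 // normr0 mulr0 cabs_ge0.
by under [X in ccvg _ X _]eq_fun do rewrite -cint_mkcond.
Unshelve. all: by end_near. Qed.

Lemma ge0_integral_affine (f : R -> R) (a b : R) : 0 < a -> continuous f -> (forall x, 0 <= f x) ->
  (\int[mu]_x (f x)%:E = a%:E * \int[mu]_x (f (a * x + b))%:E)%E.
Proof.
move=> a0 cf f0.
have dF (x : R) : is_derive x 1 (fun x => a * x + b) a.
  by apply: is_derive_eq; rewrite /GRing.scale /= addr0 mulr1.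
have F' : derive1 (fun x : R => a * x + b) = cst a.
  by apply/funext => x; rewrite derive1E; apply: derive_val.
have cF : continuous (fun x : R => a * x + b).
  by move=> x; apply/differentiable_continuous/derivable1_diffP.
rewrite (@increasing_ge0_integration_by_substitutionT _ (fun x => a * x + b)) //.
- rewrite F' -ge0_integralZl ?lee_fin ?ltW //.
  + by apply: eq_integral => x _; rewrite -EFinM /= mulrC.
  + apply/measurable_EFinP; apply: continuous_measurable_fun => x.
    by apply: (@continuous_comp _ _ _ (fun x => a * x + b) f); [exact: cF|exact: cf].
  + by move=> x _; rewrite lee_fin.
- by move=> x y xy; rewrite ltrD2r ltr_pM2l.
- by rewrite F'; move=> x; exact: cvg_cst.
- by rewrite F'; exact: is_cvg_cst.
- by rewrite F'; exact: is_cvg_cst.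
- apply: (@cvg_comp _ _ _ (fun x => a * x) (fun x => x + b) _ -oo%R); last exact: cvg_addrr_Ny.
  exact: gt0_cvgMrNy.
- apply: (@cvg_comp _ _ _ (fun x => a * x) (fun x => x + b) _ +oo%R); last exact: cvg_addrr.
  exact: gt0_cvgMry.
Qed.

Lemma posneg_fin_num (g : R -> R) : mu.-integrable setT (fun x => (g x)%:E) ->
  ((\int[mu]_x (Num.max (g x) 0)%:E)%E \is a fin_num) /\ ((\int[mu]_x (Num.max (- g x) 0)%:E)%E \is a fin_num).
Proof.
move=> ig; split.
  have := integrable_fin_num measurableT (integrable_funepos measurableT ig).
  by congr (_ \is a fin_num); apply: eq_integral => x _; rewrite funeposE EFin_max.
have := integrable_fin_num measurableT (integrable_funeneg measurableT ig).
by congr (_ \is a fin_num); apply: eq_integral => x _; rewrite funenegE -EFinN EFin_max.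
Qed.
Lemma Rintegral_posneg (g : R -> R) : mu.-integrable setT (fun x => (g x)%:E) ->
  \int[mu]_x g x = fine (\int[mu]_x (Num.max (g x) 0)%:E)%E - fine (\int[mu]_x (Num.max (- g x) 0)%:E)%E.
Proof.
move=> ig; have [a b] := posneg_fin_num ig.
rewrite -fineB // /Rintegral integralE; congr (fine (_ - _))%E; apply: eq_integral => x _.
  by rewrite funeposE EFin_max.
by rewrite funenegE -EFinN EFin_max.
Qed.

(** The substitution for nonnegative functions is applied to [|f|] for integrability, then to the
    continuous functions [max f 0] and [max (- f) 0] for the value. *)
Lemma integral_affine (f : R -> R) (a b : R) : 0 < a -> continuous f ->
  mu.-integrable setT (EFin \o f) ->
  mu.-integrable setT (fun x => (f (a * x + b))%:E) /\
  \int[mu]_x f x = a * \int[mu]_x f (a * x + b).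
Proof.
move=> a0 cf intf.
have cF : continuous (fun x : R => a * x + b).
  by move=> x; apply: cvgD; [apply: cvgM; [exact: cvg_cst|exact: cvg_id]|exact: cvg_cst].
have cfF : continuous (fun x : R => f (a * x + b)).
  by move=> x; apply: (@continuous_comp _ _ _ (fun x => a * x + b) f); [exact: cF|exact: cf].
have intfF : mu.-integrable setT (fun x => (f (a * x + b))%:E).
  apply/integrableP; split; first by apply/measurable_EFinP; exact: continuous_measurable_fun.
  have /integrableP[_] := intf.
  have := @ge0_integral_affine (fun x => `|f x|) a b a0.
  under eq_integral do rewrite -abse_EFin.
  move=> -> //; last by move=> x; apply: (@continuous_comp _ _ _ f (fun x => `|x|)); [exact: cf|exact: norm_continuous].
  (* Were the right-hand integral infinite, [a] times it would be infinite as well, but that is the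
     finite integral of [|f|]. *)
  move=> h; rewrite ltNge leye_eq; apply/negP => /eqP e.
  by move: h; rewrite e gt0_muley ?lte_fin // ltxx.
split => //.
have cpos (g : R -> R) : continuous g -> continuous (fun x => Num.max (g x) 0).
  move=> cg x; apply: (@continuous_comp _ _ _ g (fun x => Num.max x 0)); first exact: cg.
  by apply: continuous_max; [exact: cvg_id|exact: cvg_cst].
rewrite (Rintegral_posneg intf) (Rintegral_posneg intfF).
rewrite (@ge0_integral_affine (fun x => Num.max (f x) 0) a b) //; last 2 first.
- exact: cpos.
- by move=> x; rewrite le_max lexx orbT.
rewrite (@ge0_integral_affine (fun x => Num.max (- f x) 0) a b) //; last 2 first.
- by apply: cpos => x; apply: cvgN; exact: cf.
- by move=> x; rewrite le_max lexx orbT.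
have [ip im] := posneg_fin_num intfF.
by rewrite !fineM // mulrBr.
Qed.

Lemma cint_affine F (a b : R) : 0 < a -> ccont F -> cintegrable mu setT F ->
  cintegrable mu setT (fun x => F (a * x + b)) /\
  cint mu setT F = a%:C * cint mu setT (fun x => F (a * x + b)).
Proof.
move=> a0 cF [ir ii].
have [ir' er] := integral_affine b a0 (ccont_Re cF) ir.
have [ii' ei] := integral_affine b a0 (ccont_Im cF) ii.
split; first by split.
by apply: ceqP; rewrite !cE /= mul0r ?subr0 ?addr0.
Qed.

Lemma integral_exp (f : R -> R) (a b : R) : a <= b ->
  (forall x : R, 0 < x -> f y @[y --> x] --> f x) ->
  (\int[mu]_(x in `[expR a, expR b]) (f x)%:E =
   \int[mu]_(x in `[a, b]) (f (expR x) * expR x)%:E)%E.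
Proof.
have dE : derive1 (@expR R) = expR by apply/funext => x; rewrite derive1E; exact: derive_val.
move=> ab cf; rewrite (@integration_by_substitution_increasing _ expR) //.
- by rewrite dE; apply: eq_integral.
- by move=> x y _ _; rewrite ltr_expR.
- by rewrite dE => x _; exact: continuous_expR.
- rewrite dE.
  by apply/cvg_ex; exists (expR a); apply: cvg_at_right_filter; exact: continuous_expR.
- rewrite dE.
  by apply/cvg_ex; exists (expR b); apply: cvg_at_left_filter; exact: continuous_expR.
- split => //.
  + by apply: cvg_at_right_filter; exact: continuous_expR.
  + by apply: cvg_at_left_filter; exact: continuous_expR.
- apply: continuous_in_subspaceT => x /set_mem /=; rewrite in_itv /= => /andP[h _].
  by apply: cf; rewrite (lt_le_trans _ h) // expR_gt0.
Qed.

Lemma bigcup_itv_exp : \bigcup_n `[expR (- n%:R), expR n%:R]%classic = @Rplus R.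
Proof.
apply/seteqP; split => x /=.
  by move=> [n _ /=]; rewrite in_itv /= => /andP[h _]; rewrite /Rplus /= (lt_le_trans _ h) // expR_gt0.
rewrite /Rplus /= => x0.
have [n hn] : exists n : nat, `|ln x| <= n%:R.
  exists (Num.truncn `|ln x|).+1; exact/ltW/truncnS_gt.
exists n => //=; rewrite in_itv /= -[x](@lnK R) ?posrE // !ler_expR.
by rewrite -ler_norml.
Qed.

Lemma bigcup_itvT : \bigcup_n `[- n%:R, n%:R]%classic = [set: R].
Proof.
apply/seteqP; split => x //= _.
exists (Num.truncn `|x|).+1 => //=; rewrite in_itv /= -ler_norml.
exact/ltW/truncnS_gt.
Qed.

(** The windows [[exp (- n), exp n]] exhaust the half-line. On each of them the substitution is over
    a compact interval, and monotone convergence passes to the union on both sides. *)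
Lemma ge0_integral_exp (f : R -> R) : (forall x : R, 0 < x -> f y @[y --> x] --> f x) ->
  (forall x, 0 < x -> 0 <= f x) ->
  (\int[mu]_(x in @Rplus R) (f x)%:E = \int[mu]_x (f (expR x) * expR x)%:E)%E.
Proof.
move=> cf f0.
have mp : measurable_fun (@Rplus R) f.
  have -> : @Rplus R = `]0, +oo[%classic by apply/seteqP; split => x; rewrite /Rplus /= in_itv /= andbT.
  apply: open_continuous_measurable_fun; first exact: interval_open.
  by move=> x /set_mem /=; rewrite in_itv /= andbT; exact: cf.
have c2 : continuous (fun x => f (expR x) * expR x).
  move=> x; apply: cvgM; last exact: continuous_expR.
  apply: (@continuous_comp _ _ _ expR f); first exact: continuous_expR.
  by apply: cf; exact: expR_gt0.
have sub n : `[expR (- n%:R), expR n%:R]%classic `<=` @Rplus R by rewrite -bigcup_itv_exp => x ?; exists n.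
have h1 := @ge0_nondecreasing_set_cvg_integral _ (measurableTypeR R) R (fun n : nat => `[expR (- n%:R), expR n%:R]%classic) (EFin \o f) mu.
have h2 := @ge0_nondecreasing_set_cvg_integral _ (measurableTypeR R) R (fun n : nat => `[- n%:R, n%:R]%classic) (fun x : R => (f (expR x) * expR x)%:E) mu.
rewrite -bigcup_itv_exp -bigcup_itvT.
have e : (fun n : nat => \int[mu]_(x in `[expR (- n%:R), expR n%:R]) (EFin \o f) x)%E =
    (fun n : nat => \int[mu]_(x in `[(- n%:R)%R, n%:R%R]) (f (expR x) * expR x)%:E)%E.
  apply/funext => n; apply: integral_exp => //.
  by rewrite -subr_ge0 opprK addr_ge0.
have k1 : (fun n : nat => \int[mu]_(x in `[(- n%:R)%R, n%:R%R]) (f (expR x) * expR x)%:E)%E @ \oo -->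
    (\int[mu]_(x in \bigcup_n `[expR (- n%:R), expR n%:R]%classic) (f x)%:E)%E.
  rewrite -e; apply: h1 => //.
  - by move=> n m nm; apply/subsetPset; apply: subset_itv; rewrite bnd_simp ler_expR ?lerN2 ler_nat.
  - by move=> n; apply/measurable_EFinP; apply: measurable_funS mp => //; rewrite -bigcup_itv_exp; apply: bigcup_measurable.
  - by move=> n x /sub; exact: f0.
have k2 : (fun n : nat => \int[mu]_(x in `[(- n%:R)%R, n%:R%R]) (f (expR x) * expR x)%:E)%E @ \oo -->
    (\int[mu]_(x in \bigcup_n `[(- n%:R)%R, n%:R%R]%classic) (f (expR x) * expR x)%:E)%E.
  apply: h2 => //.
  - by move=> n m nm; apply/subsetPset; apply: subset_itv; rewrite bnd_simp ?lerN2 ler_nat.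
  - by move=> n; apply/measurable_EFinP/measurable_funTS; exact: continuous_measurable_fun.
  - by move=> n x _; rewrite lee_fin mulr_ge0 ?expR_ge0 // f0 // expR_gt0.
by rewrite -(cvg_lim _ k1) // -(cvg_lim _ k2).
Qed.

Lemma cint_exp F (N : R) : 0 <= N -> (forall x : R, 0 < x -> ccvg (nbhs x) F (F x)) ->
  (forall x, x \notin `[expR (- N), expR N] -> F x = 0) ->
  cint mu (@Rplus R) F = cint mu setT (fun x => F (expR x) * (expR x)%:C).
Proof.
move=> N0 cF F0.
have NN : - N <= N by rewrite -subr_ge0 opprK addr_ge0.
have -> : cint mu (@Rplus R) F = cint mu `[expR (- N), expR N] F.
  rewrite cint_mkcond [RHS]cint_mkcond; apply: eq_cint => x _; rewrite !indicE.
  have [/F0 ->|] := boolP (x \notin `[expR (- N), expR N]); first by rewrite !mul0r.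
  rewrite negbK => h; rewrite !mem_set //.
  by move: h; rewrite in_itv /Rplus /= => /andP[h _]; rewrite (lt_le_trans _ h) // expR_gt0.
have -> : cint mu setT (fun x => F (expR x) * (expR x)%:C) = cint mu `[(- N)%R, N] (fun x => F (expR x) * (expR x)%:C).
  rewrite [RHS]cint_mkcond; apply: eq_cint => x _; rewrite !indicE.
  have [h|h] := boolP (x \in `[(- N)%R, N]); first by rewrite mem_set ?mulr1.
  rewrite F0 ?mul0r //; apply: contra h.
  by rewrite !in_itv /= !ler_expR.
rewrite /cint; congr (_ +i* _); rewrite /Rintegral.
  rewrite (@integral_exp (fun x => Re (F x))) //; last by move=> x /cF [].
  by congr fine; apply: eq_integral => x _; rewrite cE /= mulr0 subr0.
rewrite (@integral_exp (fun x => Im (F x))) //; last by move=> x /cF [].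
by congr fine; apply: eq_integral => x _; rewrite cE /= mulr0 add0r.
Qed.

Local Notation lineT := (measurableTypeR R).

Lemma ccont_cmeasT F : ccont F -> cmeas [set: lineT] F.
Proof. by move=> cF; apply: ccont_cmeas. Qed.
Lemma cintegrable_leT F (g : R -> R) : cmeas [set: lineT] F ->
  mu.-integrable setT (EFin \o g) -> (forall x, cabs (F x) <= g x) -> cintegrable mu setT F.
Proof.
by move=> mF ig Fg; apply: (@cintegrable_le _ _ lineT mu setT F g) => // x _; exact: Fg.
Qed.
Lemma cint_leT F (g : R -> R) : cmeas [set: lineT] F ->
  mu.-integrable setT (EFin \o g) -> (forall x, cabs (F x) <= g x) ->
  cabs (cint mu setT F) <= 2 * \int[mu]_x g x.
Proof.
by move=> mF ig Fg; apply: (@cint_le _ _ lineT mu setT F g) => // x _; exact: Fg.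
Qed.
Lemma cint_dctT (F_ : nat -> R -> R[i]) F (g : R -> R) :
  (forall n, cmeas [set: lineT] (F_ n)) -> (forall x, ccvg \oo (F_ ^~ x) (F x)) ->
  mu.-integrable setT (EFin \o g) -> (forall n x, cabs (F_ n x) <= g x) ->
  cintegrable mu setT F /\ ccvg \oo (fun n => cint mu setT (F_ n)) (cint mu setT F).
Proof.
move=> mF cF ig Fg; by apply: (@cint_dct _ _ lineT mu setT F_ F g).
Qed.
Lemma eq_cintT F G : (forall x, F x = G x) -> cint mu setT F = cint mu setT G.
Proof. by move=> FG; apply: eq_cint => x _; exact: FG. Qed.

End RealLineIntegrals.

(** * Plancherel *)

Section Plancherel.
Variable R : realType.
Local Notation Re := (@complex.Re R).
Local Notation Im := (@complex.Im R).
Local Notation mu := (@lebesgue_measure R).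
Implicit Types (F G : R -> R[i]).

Definition expi (x : R) : R[i] := cexp (0 +i* x).

#[global] Arguments expi : simpl never.
Lemma expiD x y : expi (x + y) = expi x * expi y.
Proof. by rewrite /expi -cexpD; congr cexp; apply: ceqP; rewrite !cE /= ?addr0. Qed.
Lemma cabs_expi x : cabs (expi x) = 1.
Proof. by rewrite /expi cabs_cexp expR0. Qed.
Lemma expiJ x : (cconj (expi x)) = expi (- x).
Proof. by rewrite /expi -cexpJ; congr cexp; apply: ceqP; rewrite !cE /= ?oppr0. Qed.
Lemma ccvg_expi (T : Type) (F : set_system T) {FF : Filter F} (f : T -> R) (a : R) :
  (f x @[x --> F] --> a) -> ccvg F (fun x => expi (f x)) (expi a).
Proof. by move=> h; apply: ccvg_cexp; split; [exact: cvg_cst|exact: h]. Qed.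
Lemma cmeas_expi d (T : measurableType d) (D : set T) (f : T -> R) :
  measurable_fun D f -> cmeas D (fun x => expi (f x)).
Proof. by move=> mf; apply: cmeas_cexp; split => //; exact: measurable_cst. Qed.

Lemma cint_itv_split F (a b c : R) : a <= b -> b <= c -> cintegrable mu `[a, c] F ->
  cint mu `[a, c] F = cint mu `[a, b] F + cint mu `[b, c] F.
Proof.
move=> ab bc [ir ii].
have key (f : R -> R) : mu.-integrable `[a, c] (EFin \o f) ->
    \int[mu]_(x in `[a, c]) f x = \int[mu]_(x in `[a, b]) f x + \int[mu]_(x in `[b, c]) f x.
  move=> intf; have := @Rintegral_itvB R f (BLeft a) (BRight c) b intf.
  rewrite !bnd_simp => /(_ ab bc) h.
  rewrite Rintegral_itv_obnd_cbnd in h; first by rewrite -h addrC subrK.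
  by apply: integrableS intf => //; apply: subset_itvr; rewrite bnd_simp.
by apply: ceqP; rewrite cE /cint /= key.
Qed.

Lemma cderiv_id (x : R) : cderiv (fun t : R => t%:C) x 1.
Proof. by split => /=; [exact: is_derive_id|apply: is_derive_eq]. Qed.

Lemma cderiv_cexpM (a : R[i]) (x : R) :
  cderiv (fun u : R => cexp (a * u%:C)) x (a * cexp (a * x%:C)).
Proof.
apply: cderiv_cexp; have := cderivM (cderiv_cst a x) (cderiv_id x).
by rewrite mul0r add0r mulr1.
Qed.

Lemma ccont_cexpM (a : R[i]) : ccont (fun u : R => cexp (a * u%:C)).
Proof. by move=> x; apply: cderiv_ccvg (cderiv_cexpM a x). Qed.

Lemma cint_cexp (a : R[i]) (u v : R) : a != 0 -> u <= v ->
  cint mu `[u, v] (fun x : R => cexp (a * x%:C)) = a^-1 * (cexp (a * v%:C) - cexp (a * u%:C)).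
Proof.
move=> a0 uv; rewrite (@cint_ftc _ (fun x : R => a^-1 * cexp (a * x%:C))) //.
- by rewrite mulrBr.
- move=> x _; have := cderivM (cderiv_cst a^-1 x) (cderiv_cexpM a x).
  by rewrite mul0r add0r mulrA mulVf // mul1r.
- by move=> x _; exact: ccont_cexpM.
Qed.

Lemma cvg_expRn (e : R) : 0 < e -> expR (- e * n%:R) @[n --> \oo] --> 0.
Proof.
move=> e0; apply: (@cvg_comp _ _ _ (fun n : nat => n%:R : R) (fun x => expR (- e * x)) _ +oo%R); first exact: cvgr_idn.
under eq_fun do rewrite mulNr.
apply: (@cvg_comp _ _ _ (fun x => e * x) (fun x => expR (- x)) _ +oo%R); last exact: cvgr_expR.
exact: gt0_cvgMry.
Qed.

(** The Fourier transform of the Abel weight is the Poisson kernel. *)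
Lemma cint_abel (e tau : R) : 0 < e ->
  cint mu setT (fun u => (expR (- e * `|u|))%:C * expi (tau * u)) =
  (2 * e / (e ^+ 2 + tau ^+ 2))%:C.
Proof.
move=> e0; set F := fun u : R => _.
have cF : ccont F.
  move=> x; apply: ccvgM; first by apply: ccvgC; exact: continuous_expRN.
  by apply: ccvg_expi; apply: cvgM; [exact: cvg_cst|exact: cvg_id].
have iF : cintegrable mu setT F.
  apply: (@cintegrable_leT _ _ (fun u => expR (- e * `|u|))) => //.
  - exact: ccont_cmeasT.
  - exact: integrable_expRN.
  - by move=> x; rewrite /F cabsM cabs_expi mulr1 cabsC ger0_norm // expR_ge0.
(* The exponent is [b * u] on the negative half-line and [a * u] on the positive one, so the
   integral is [1 / b - 1 / a]. *)
pose a : R[i] := (- e) +i* tau; pose b : R[i] := e +i* tau.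
have a0 : a != 0 by apply/eqP => /(congr1 Re) /= /eqP; rewrite oppr_eq0 gt_eqF.
have b0 : b != 0 by apply/eqP => /(congr1 Re) /= /eqP; rewrite gt_eqF.
have h1 := cvg_cint_window iF.
have h2 : ccvg \oo (fun n => cint mu `[- n%:R, n%:R] F) (b^-1 * (1 - 0) + a^-1 * (0 - 1)).
  rewrite (_ : (fun _ => _) = fun n : nat =>
     b^-1 * (1 - cexp (b * (- n%:R)%:C)) + a^-1 * (cexp (a * n%:R%:C) - 1)); last first.
    apply/funext => n; rewrite (@cint_itv_split _ _ 0) //; last first.
    - by apply: (@ccont_cintegrable_itv R F) => x _; exact: cF.
    congr (_ + _).
      rewrite (_ : 1 = cexp (b * 0%:C)) -?cint_cexp ?mulr0 ?cexp0 ?oppr_le0 //.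
      apply: eq_cint => x /=; rewrite in_itv /= => /andP[_ x0].
      rewrite /F ler0_norm // -cexpC -cexpD; congr cexp.
      by apply: ceqP; rewrite !cE /=; ring.
    rewrite (_ : 1 = cexp (a * 0%:C)) -?cint_cexp ?mulr0 ?cexp0 //.
    apply: eq_cint => x /=; rewrite in_itv /= => /andP[x0 _].
    rewrite /F ger0_norm // -cexpC -cexpD; congr cexp.
    by apply: ceqP; rewrite !cE /=; ring.
  apply: ccvgD; apply: ccvgM; try exact: ccvg_cst.
    apply: ccvgB; first exact: ccvg_cst.
    apply: ccvg_cabs0; under eq_fun do rewrite subr0 cabs_cexp.
    rewrite (_ : (fun _ => _) = (fun n : nat => expR (- e * n%:R))); first exact: cvg_expRn.
    by apply/funext => n; rewrite ReM /=; congr expR; ring.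
  apply: ccvgB; last exact: ccvg_cst.
  apply: ccvg_cabs0; under eq_fun do rewrite subr0 cabs_cexp.
  rewrite (_ : (fun _ => _) = (fun n : nat => expR (- e * n%:R))); first exact: cvg_expRn.
  by apply/funext => n; rewrite ReM /=; congr expR; ring.
rewrite -(ccvg_lim h1) (ccvg_lim h2).
have n0 : e ^+ 2 + tau ^+ 2 != 0 by rewrite gt_eqF // ltr_wpDr ?sqr_ge0 // exprn_gt0.
by rewrite subr0 sub0r mulr1 mulrN1; apply: ceqP; rewrite !cE !(ReV, ImV) /= sqrrN; field.
Qed.

Variables (h : R -> R[i]) (M k : R).
Hypothesis (ch : ccont h) (hM : forall t, cabs (h t) <= M).
Hypothesis (ih : cintegrable mu setT h) (k0 : 0 < k).

Definition fourier (u : R) : R[i] := cint mu setT (fun t => h t * expi (k * t * u)).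

#[global] Arguments fourier : simpl never.
Let iabs : mu.-integrable setT (EFin \o (fun t => cabs (h t))).
Proof. exact: cintegrable_cabs. Qed.
Let A := \int[mu]_t cabs (h t).
Let A0 : 0 <= A. Proof. by apply: Rintegral_ge0 => x _; exact: cabs_ge0. Qed.
Let M0 : 0 <= M. Proof. exact: le_trans (cabs_ge0 _) (hM 0). Qed.
Local Notation lineT := (measurableTypeR R).
Let mh : cmeas [set: lineT] h. Proof. exact: (cintegrable_cmeas ih). Qed.

Lemma cabs_fourier u : cabs (fourier u) <= 2 * A.
Proof.
apply: cint_leT => //.
  by apply: cmeasM => //; apply: cmeas_expi; apply: measurable_funM => //.
by move=> t; rewrite cabsM cabs_expi mulr1.
Qed.

(** Sequential continuity: dominated convergence with the majorant [cabs (h t)] along any sequence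
    that tends to [x]. *)
Lemma ccont_fourier : ccont fourier.
Proof.
move=> x.
have key (p : R[i] -> R) : (forall u : nat -> R[i], forall l, ccvg \oo u l -> p (u n) @[n --> \oo] --> p l) ->
    p (fourier y) @[y --> x] --> p (fourier x).
  move=> pc; apply/(@cvg_nbhsP _ R^o (fun y => p (fourier y))) => u ux; apply: pc.
  apply: (proj2 (@cint_dctT _ (fun n t => h t * expi (k * t * u n)) _ (fun t => cabs (h t)) _ _ _ _)) => //.
  - by move=> n; apply: cmeasM => //; apply: cmeas_expi; apply: measurable_funM => //; exact: measurable_funM.
  - move=> t; apply: ccvgM; first exact: ccvg_cst.
    by apply: ccvg_expi; apply: cvgM => //; exact: cvg_cst.
  - by move=> n t; rewrite cabsM cabs_expi mulr1.
split; apply: key => u l; first by case.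
by case.
Qed.

Let eps (n : nat) : R := n.+1%:R^-1.
Let eps0 n : 0 < eps n. Proof. by rewrite invr_gt0 ltr0n. Qed.
(** Abel summation: [w] makes [|fourier|^2] integrable before this is known, [W] is the Poisson
    kernel that [w] turns into, and [Phi n] is the Poisson integral of the conjugate of [h]. *)
Let w (n : nat) (u : R) : R := expR (- eps n * `|u|).
Let W (n : nat) (tau : R) : R := 2 * eps n / (eps n ^+ 2 + tau ^+ 2).
Let den_gt0 n tau : 0 < eps n ^+ 2 + tau ^+ 2.
Proof. by rewrite ltr_wpDr ?sqr_ge0 // exprn_gt0. Qed.
Let Phi n t := cint mu setT (fun s => (cconj (h s)) * (W n (k * (t - s)))%:C).

Let mw n : measurable_fun [set: lineT] (w n).
Proof. by apply: continuous_measurable_fun; exact: continuous_expRN. Qed.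

(** Fubini twice. The Fourier transform is merely bounded, so it is the weight [w n] that makes the
    integrand absolutely integrable in [u]; integrating [u] out first leaves the Poisson kernel. *)
Let step1 n : cint mu setT (fun u => (w n u)%:C * (cconj (fourier u)) * fourier u) =
  cint mu setT (fun t => h t * Phi n t).
Proof.
have m1 : measurable_fun [set: lineT * lineT] fst by exact: measurable_fst.
have m2 : measurable_fun [set: lineT * lineT] snd by exact: measurable_snd.
have mc (f : R -> R[i]) (p : R * R -> R) : cmeas [set: lineT] f -> measurable_fun [set: lineT * lineT] p -> cmeas [set: lineT * lineT] (fun z => f (p z)).
  by move=> [a b] mp; split; [apply: (measurableT_comp a mp)|apply: (measurableT_comp b mp)].
have mr (f : R -> R) (p : R * R -> R) : measurable_fun [set: lineT] f -> measurable_fun [set: lineT * lineT] p -> measurable_fun [set: lineT * lineT] (fun z => f (p z)).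
  by move=> a mp; apply: (measurableT_comp a mp).
have mf : cmeas [set: lineT] fourier by apply: ccont_cmeasT; exact: ccont_fourier.
(* Only the second Fourier transform is written out; the conjugate one stays a bounded factor until
   [t] has become the outer variable. *)
transitivity (cint mu setT (fun u => cint mu setT (fun t => (w n u)%:C * (cconj (fourier u)) * (h t * expi (k * t * u))))).
  apply: eq_cint => u _; rewrite cintZ //.
  apply: (@cintegrable_leT _ _ (fun t => cabs (h t))) => //.
    apply: cmeasM => //; apply: cmeas_expi; apply: measurable_funM => //; exact: measurable_funM.
  by move=> t; rewrite cabsM cabs_expi mulr1.
rewrite (@cint_fubini _ _ _ _ _ mu mu (fun u => w n u * (2 * A)) (fun t => cabs (h t)) _ _
  (fun z => (w n z.1)%:C * (cconj (fourier z.1)) * (h z.2 * expi (k * z.2 * z.1)))) //; last 3 first.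
- have := integrableZr measurableT (2 * A) (integrable_expRN (eps0 n)).
  by apply: eq_integrable.
- apply: cmeasM; apply: cmeasM.
  + by apply: cmeasC; exact: mr.
  + by apply: cmeasJ; exact: mc.
  + exact: mc.
  + apply: cmeas_expi; apply: measurable_funM => //; apply: measurable_funM => //.
- move=> u t /=; rewrite !cabsM cabs_expi mulr1 cabsJ cabsC ger0_norm ?expR_ge0 //.
  by rewrite ler_wpM2r ?cabs_ge0 // ler_wpM2l ?expR_ge0 // cabs_fourier.
apply: eq_cint => t _ /=.
transitivity (cint mu setT (fun u => h t * cint mu setT (fun s => (cconj (h s)) * ((w n u)%:C * expi (k * (t - s) * u))))).
  apply: eq_cint => u _.
  have mm : cmeas setT (fun s => h s * expi (k * s * u)).
    apply: cmeasM => //; apply: cmeas_expi; apply: measurable_funM => //; exact: measurable_funM.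
  have ii : cintegrable mu setT (fun s => h s * expi (k * s * u)).
    apply: (@cintegrable_leT _ _ (fun t => cabs (h t))) => //.
    by move=> s; rewrite cabsM cabs_expi mulr1.
  have fE : (cconj (fourier u)) = cint mu setT (fun s => (cconj (h s)) * expi (- (k * s * u))).
    rewrite /fourier -(@cintJ _ _ lineT mu) //.
    by apply: eq_cintT => s; rewrite cJM; congr (_ * _); exact: expiJ.
  rewrite (_ : cint _ _ _ = ((w n u)%:C * expi (k * t * u)) * (cconj (fourier u))); first by ring.
  rewrite fE. rewrite -cintZ //; last first.
    apply: (@cintegrable_leT _ _ (fun t => cabs (h t))) => //.
      by apply: cmeasM; [exact: cmeasJ|apply: cmeas_expi; apply: measurable_funN; apply: measurable_funM => //; exact: measurable_funM].
    by move=> s; rewrite cabsM cabs_expi mulr1 cabsJ.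
  apply: eq_cintT => s.
  rewrite (_ : k * (t - s) * u = k * t * u + (- (k * s * u))); last by ring.
  by rewrite expiD; ring.
rewrite cintZ //; last first.
  apply: (@cintegrable_cint _ _ _ _ _ mu mu (w n) (fun s => cabs (h s)) _ _
    (fun z => (cconj (h z.2)) * ((w n z.1)%:C * expi (k * (t - z.2) * z.1)))) => //.
  - exact: integrable_expRN.
  - apply: cmeasM; first by apply: cmeasJ; exact: mc.
    apply: cmeasM; first by apply: cmeasC; exact: mr.
    apply: cmeas_expi; apply: measurable_funM => //; apply: measurable_funM => //.
    exact: measurable_funB.
  - move=> u s /=; rewrite !cabsM cabs_expi mulr1 cabsJ cabsC ger0_norm ?expR_ge0 //.
    by rewrite mulrC.
congr (_ * _).
rewrite (@cint_fubini _ _ _ _ _ mu mu (w n) (fun s => cabs (h s)) _ _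
  (fun z => (cconj (h z.2)) * ((w n z.1)%:C * expi (k * (t - z.2) * z.1)))) //; last 3 first.
- exact: integrable_expRN.
- apply: cmeasM; first by apply: cmeasJ; exact: mc.
  apply: cmeasM; first by apply: cmeasC; exact: mr.
  apply: cmeas_expi; apply: measurable_funM => //; apply: measurable_funM => //.
  exact: measurable_funB.
- move=> u s /=; rewrite !cabsM cabs_expi mulr1 cabsJ cabsC ger0_norm ?expR_ge0 //.
  by rewrite mulrC.
apply: eq_cint => s _ /=; rewrite cintZ.
- by rewrite cint_abel.
- by [].
- apply: (@cintegrable_leT _ _ (w n)) => //.
  + apply: cmeasM; first exact: cmeasC.
    by apply: cmeas_expi; apply: measurable_funM.
  + exact: integrable_expRN.
  + by move=> u; rewrite cabsM cabs_expi mulr1 cabsC ger0_norm ?expR_ge0.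
Qed.

(** The rescaling [s = t + eps n / k * r] turns every kernel into a multiple of the fixed density
    [1 / (1 + r^2)]. *)
Let WE n t r : W n (k * (t - (eps n / k * r + t))) = 2 * (eps n)^-1 * (1 + r ^+ 2)^-1.
Proof.
have n0 : eps n != 0 by rewrite gt_eqF.
have r0 : 1 + r ^+ 2 != 0 by rewrite gt_eqF // ltr_wpDr ?sqr_ge0.
have -> : k * (t - (eps n / k * r + t)) = - (eps n * r) by field; rewrite gt_eqF.
rewrite /W; have -> : eps n ^+ 2 + (- (eps n * r)) ^+ 2 = eps n ^+ 2 * (1 + r ^+ 2) by ring.
by field; rewrite n0 r0.
Qed.

(** In this form [n] occurs only inside the continuous function [h], so the limit follows by
    dominated convergence with majorant [M / (1 + r^2)]. *)
Let PhiE n t : Phi n t = (2 / k)%:C * cint mu setT (fun r => (cconj (h (eps n / k * r + t))) * ((1 + r ^+ 2)^-1)%:C).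
Proof.
have a0 : 0 < eps n / k by rewrite divr_gt0.
have cF : ccont (fun s => (cconj (h s)) * (W n (k * (t - s)))%:C).
  move=> s; apply: ccvgM; first by apply: ccvgJ; exact: ch.
  apply: ccvgC; apply: cvgM; first exact: cvg_cst.
  apply: cvgV; first by rewrite gt_eqF.
  apply: cvgD; first exact: cvg_cst.
  have c1 : continuous (fun s : R => k * (t - s)).
    by move=> y; apply: cvgM; [exact: cvg_cst|apply: cvgB; [exact: cvg_cst|exact: cvg_id]].
  by under eq_fun do rewrite expr2; rewrite expr2; apply: cvgM; exact: c1.
have iF : cintegrable mu setT (fun s => (cconj (h s)) * (W n (k * (t - s)))%:C).
  apply: (@cintegrable_leT _ _ (fun s => 2 * (eps n)^-1 * cabs (h s))).
  - exact: ccont_cmeasT.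
  - by have := integrableZl measurableT (2 * (eps n)^-1) iabs; apply: eq_integrable.
  - move=> s; rewrite cabsM cabsJ cabsC mulrC ler_wpM2r ?cabs_ge0 // ger0_norm; last first.
      by rewrite divr_ge0 ?mulr_ge0 // ltW.
    set tau := k * (t - s); rewrite /W ler_pdivrMr //.
    have -> : 2 / eps n * (eps n ^+ 2 + tau ^+ 2) = 2 * eps n + 2 / eps n * tau ^+ 2 by field; rewrite gt_eqF.
    by rewrite lerDl mulr_ge0 ?sqr_ge0 // divr_ge0 // ltW.
have [iFa e1] := @cint_affine R _ (eps n / k) t a0 cF iF.
rewrite /Phi e1 [in LHS](@eq_cintT _ _ (fun r => (2 * (eps n)^-1)%:C * ((cconj (h (eps n / k * r + t))) * ((1 + r ^+ 2)^-1)%:C))).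
  rewrite cintZ //.
    by rewrite mulrA -CM; congr (_%:C * _); field; rewrite !gt_eqF.
  apply: (@cintegrable_leT _ _ (fun r => M * (1 + r ^+ 2)^-1)).
  - apply: ccont_cmeasT => r; apply: ccvgM.
      apply: ccvgJ.
      have c1 : continuous (fun r : R => eps n / k * r + t).
        by move=> y; apply: cvgD; [apply: cvgM; [exact: cvg_cst|exact: cvg_id]|exact: cvg_cst].
      have [u v] := ch (eps n / k * r + t).
      by split; [apply: (cvg_comp _ _ (c1 r) u)|apply: (cvg_comp _ _ (c1 r) v)].
    by apply: ccvgC; exact: continuous_oneDsqrV.
  - by have := integrableZl measurableT M (@integrable_oneDsqrV R); apply: eq_integrable.
  - move=> r; rewrite cabsM cabsJ cabsC ger0_norm ?invr_ge0 ?addr_ge0 ?sqr_ge0 //.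
    by rewrite ler_wpM2r ?invr_ge0 ?addr_ge0 ?sqr_ge0.
by move=> r; rewrite WE CM; ring.
Qed.

Let shift_cont t : ccont (fun r => h (t + r)).
Proof.
move=> r; have c1 : continuous (fun r : R => t + r) by move=> y; apply: cvgD; [exact: cvg_cst|exact: cvg_id].
have [u v] := ch (t + r).
by split; [apply: (cvg_comp _ _ (c1 r) u)|apply: (cvg_comp _ _ (c1 r) v)].
Qed.

Let cvg_Phi t : ccvg \oo (fun n => Phi n t) ((2 * pi / k)%:C * (cconj (h t))).
Proof.
have -> : (2 * pi / k)%:C * (cconj (h t)) = (2 / k)%:C * cint mu setT (fun r => (cconj (h t)) * ((1 + r ^+ 2)^-1)%:C).
  rewrite (_ : cint _ _ _ = (cconj (h t)) * pi%:C); first by rewrite (_ : 2 * pi / k = 2 / k * pi) ?CM; ring.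
  have iV : cintegrable mu setT (fun r : R => ((1 + r ^+ 2)^-1)%:C).
    split; first exact: integrable_oneDsqrV.
    by rewrite /=; apply: eq_integrable (integrable0 _ _) => //.
  rewrite cintZ //; congr (_ * _); apply: ceqP; rewrite /cint /=; first exact: Rintegral_oneDsqrV.
  by rewrite /Rintegral integral0.
under [X in ccvg _ X _]eq_fun do rewrite PhiE.
apply: ccvgM; first exact: ccvg_cst.
apply: (proj2 (@cint_dctT _ (fun n r => (cconj (h (eps n / k * r + t))) * ((1 + r ^+ 2)^-1)%:C) _ (fun r => M * (1 + r ^+ 2)^-1) _ _ _ _)).
- move=> n; apply: ccont_cmeasT => r; apply: ccvgM.
    apply: ccvgJ.
    have c1 : continuous (fun r : R => eps n / k * r + t).
      by move=> y; apply: cvgD; [apply: cvgM; [exact: cvg_cst|exact: cvg_id]|exact: cvg_cst].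
    have [u v] := ch (eps n / k * r + t).
    by split; [apply: (cvg_comp _ _ (c1 r) u)|apply: (cvg_comp _ _ (c1 r) v)].
  by apply: ccvgC; exact: continuous_oneDsqrV.
- move=> r; apply: ccvgM; last exact: ccvg_cst.
  apply: ccvgJ.
  have c1 : (eps n / k * r + t) @[n --> \oo] --> t.
    rewrite -[X in _ --> X]add0r; apply: cvgD; last exact: cvg_cst.
    rewrite -(mul0r r); apply: cvgM; last exact: cvg_cst.
    rewrite -(mul0r k^-1); apply: cvgM; last exact: cvg_cst.
    exact: cvg_harmonic.
  have [u v] := ch t.
  by split; [apply: (cvg_comp _ _ c1 u)|apply: (cvg_comp _ _ c1 v)].
- by have := integrableZl measurableT M (@integrable_oneDsqrV R); apply: eq_integrable.
- move=> n r; rewrite cabsM cabsJ cabsC ger0_norm ?invr_ge0 ?addr_ge0 ?sqr_ge0 //.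
  by rewrite ler_wpM2r ?invr_ge0 ?addr_ge0 ?sqr_ge0.
Qed.

(** The outer [2] is the constant of [cint_le], and [pi] is the integral of [1 / (1 + r^2)]. *)
Let B := 2 * (2 / k * (M * pi)).
Let Phi_le n t : cabs (Phi n t) <= B.
Proof.
have k2 : 0 <= 2 / k by rewrite divr_ge0 // ltW.
rewrite PhiE cabsM cabsC ger0_norm // /B mulrCA ler_wpM2l //.
rewrite -(@Rintegral_oneDsqrV R) -RintegralZl //; last exact: integrable_oneDsqrV.
apply: cint_leT.
- apply: ccont_cmeasT => r; apply: ccvgM.
    apply: ccvgJ.
    have c1 : continuous (fun r : R => eps n / k * r + t).
      by move=> y; apply: cvgD; [apply: cvgM; [exact: cvg_cst|exact: cvg_id]|exact: cvg_cst].
    have [u v] := ch (eps n / k * r + t).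
    by split; [apply: (cvg_comp _ _ (c1 r) u)|apply: (cvg_comp _ _ (c1 r) v)].
  by apply: ccvgC; exact: continuous_oneDsqrV.
- by have := integrableZl measurableT M (@integrable_oneDsqrV R); apply: eq_integrable.
- move=> r; rewrite cabsM cabsJ cabsC ger0_norm ?invr_ge0 ?addr_ge0 ?sqr_ge0 //.
  by rewrite ler_wpM2r ?invr_ge0 ?addr_ge0 ?sqr_ge0.
Qed.

(** Measurability in [t] comes from Fubini: the iterated integral of a dominated function of
    [(t, s)] is integrable, hence measurable. *)
Let mhPhi n : cmeas [set: lineT] (fun t => h t * Phi n t).
Proof.
have m1 : measurable_fun [set: lineT * lineT] fst by exact: measurable_fst.
have m2 : measurable_fun [set: lineT * lineT] snd by exact: measurable_snd.
have mc (f : R -> R[i]) (p : R * R -> R) : cmeas [set: lineT] f -> measurable_fun [set: lineT * lineT] p -> cmeas [set: lineT * lineT] (fun z => f (p z)).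
  by move=> [a b] mp; split; [apply: (measurableT_comp a mp)|apply: (measurableT_comp b mp)].
have cW : continuous (W n).
  move=> s; apply: cvgM; first exact: cvg_cst.
  apply: cvgV; first by rewrite gt_eqF.
  apply: cvgD; first exact: cvg_cst.
  exact: exprn_continuous.
have W0 s : 0 <= W n s by rewrite divr_ge0 ?mulr_ge0 // ltW.
have Wle s : W n s <= 2 / eps n.
  rewrite /W ler_pdivrMr //.
  have -> : 2 / eps n * (eps n ^+ 2 + s ^+ 2) = 2 * eps n + 2 / eps n * s ^+ 2 by field; rewrite gt_eqF.
  by rewrite lerDl mulr_ge0 ?sqr_ge0 // divr_ge0 // ltW.
have /cintegrable_cmeas : cintegrable mu setT (fun t => cint mu setT (fun s => h t * ((cconj (h s)) * (W n (k * (t - s)))%:C))).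
  apply: (@cintegrable_cint _ _ _ _ _ mu mu (fun t => cabs (h t)) (fun s => 2 / eps n * cabs (h s)) _ _
    (fun z => h z.1 * ((cconj (h z.2)) * (W n (k * (z.1 - z.2)))%:C))) => //.
  - by have := integrableZl measurableT (2 / eps n) iabs; apply: eq_integrable.
  - apply: cmeasM; first exact: mc.
    apply: cmeasM; first by apply: cmeasJ; exact: mc.
    apply: cmeasC; apply: (measurableT_comp (continuous_measurable_fun cW)).
    by apply: measurable_funM => //; exact: measurable_funB.
  - move=> t s /=; rewrite !cabsM cabsJ cabsC ler_wpM2l ?cabs_ge0 // mulrC.
    by rewrite ler_wpM2r ?cabs_ge0 // ger0_norm.
rewrite (_ : (fun t => cint _ _ _) = (fun t => h t * Phi n t)) //.
apply/funext => t; rewrite cintZ //.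
apply: (@cintegrable_leT _ _ (fun s => 2 / eps n * cabs (h s))).
- apply: cmeasM; first exact: cmeasJ.
  apply: cmeasC; apply: (measurableT_comp (continuous_measurable_fun cW)).
  by apply: measurable_funM => //; exact: measurable_funB.
- by have := integrableZl measurableT (2 / eps n) iabs; apply: eq_integrable.
- by move=> s; rewrite !cabsM cabsJ cabsC mulrC ler_wpM2r ?cabs_ge0 // ger0_norm.
Qed.

(** Both sides are limits of the integral of [|fourier|^2 * w n]: directly on the left, and through
    [step1] and the approximate identity [W n] on the right. *)
Lemma plancherel :
  (\int[mu]_u (cabs (fourier u) ^+ 2)%:E = (2 * pi / k)%:E * \int[mu]_t (cabs (h t) ^+ 2)%:E)%E.
Proof.
have mf : cmeas [set: lineT] fourier by apply: ccont_cmeasT; exact: ccont_fourier.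
have mf2 : measurable_fun [set: lineT] (fun u => cabs (fourier u) ^+ 2) by exact: measurable_sqr_cabs.
have ih2 : mu.-integrable setT (EFin \o (fun t => cabs (h t) ^+ 2)).
  have := integrableZl measurableT M iabs; apply: le_integrable => //.
    by apply/measurable_EFinP; exact: measurable_sqr_cabs.
  move=> t _; rewrite /= lee_fin ger0_norm ?sqr_ge0 // ger0_norm ?mulr_ge0 ?cabs_ge0 //.
  by rewrite expr2 ler_wpM2r ?cabs_ge0.
have iwf n : mu.-integrable setT (EFin \o (fun u => cabs (fourier u) ^+ 2 * w n u)).
  have := integrableZl measurableT ((2 * A) ^+ 2) (integrable_expRN (eps0 n)); apply: le_integrable => //.
    by apply/measurable_EFinP; apply: measurable_funM.
  move=> u _; have pos : 0 <= cabs (fourier u) ^+ 2 * w n u by rewrite mulr_ge0 ?sqr_ge0 ?expR_ge0.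
  rewrite /= lee_fin (ger0_norm pos) (le_trans _ (ler_norm _)) //.
  by rewrite ler_wpM2r ?expR_ge0 // ler_pXn2r ?nnegrE ?cabs_ge0 ?mulr_ge0 // cabs_fourier.
have lim2 : (\int[mu]_u (cabs (fourier u) ^+ 2 * w n u)%:E)%E @[n --> \oo] --> ((2 * pi / k)%:E * \int[mu]_t (cabs (h t) ^+ 2)%:E)%E.
  have e n : (\int[mu]_u (cabs (fourier u) ^+ 2 * w n u)%:E)%E = (Re (cint mu setT (fun t => h t * Phi n t)))%:E.
    rewrite -step1 Re_cint /Rintegral fineK.
      apply: eq_integral => u _; congr EFin.
      by rewrite -mulrA mulJc -CM mulrC.
    have := integrable_fin_num measurableT (iwf n).
    congr (_ \is a fin_num); apply: eq_integral => u _; congr EFin.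
    by rewrite -mulrA mulJc -CM mulrC.
  under eq_fun do rewrite e.
  rewrite -(fineK (integrable_fin_num measurableT ih2)) -EFinM.
  apply: cvg_EFin; first exact: nearW.
  have [] : ccvg \oo (fun n => cint mu setT (fun t => h t * Phi n t)) (cint mu setT (fun t => h t * ((2 * pi / k)%:C * (cconj (h t))))).
    apply: (proj2 (@cint_dctT _ _ _ (fun t => cabs (h t) * B) _ _ _ _)) => //.
    - by move=> t; apply: ccvgM; [exact: ccvg_cst|exact: cvg_Phi].
    - by have := integrableZr measurableT B iabs; apply: eq_integrable.
    - by move=> n t; rewrite cabsM ler_wpM2l ?cabs_ge0.
  rewrite (_ : Re (cint mu setT (fun t => h t * ((2 * pi / k)%:C * (cconj (h t))))) = 2 * pi / k * fine (\int[mu]_t (cabs (h t) ^+ 2)%:E)) //.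
  rewrite Re_cint -RintegralZl //; apply: eq_Rintegral => t _.
  by rewrite mulrCA mulcJ -CM.
(* The weights increase to [1], so monotone convergence applies in the extended reals, without
   knowing beforehand that the limit is finite. *)
have lim1 : (\int[mu]_u (cabs (fourier u) ^+ 2 * w n u)%:E)%E @[n --> \oo] --> (\int[mu]_u (cabs (fourier u) ^+ 2)%:E)%E.
  rewrite [X in _ --> X](_ : _ = \int[mu]_u (limn (fun n => (cabs (fourier u) ^+ 2 * w n u)%:E)))%E.
    apply: cvg_monotone_convergence => //.
    - by move=> n; apply/measurable_EFinP; apply: measurable_funM.
    - by move=> n u _; rewrite lee_fin mulr_ge0 ?sqr_ge0 ?expR_ge0.
    - move=> u _ m n mn; rewrite lee_fin ler_wpM2l ?sqr_ge0 // ler_expR !mulNr lerN2.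
      by rewrite ler_wpM2r // lef_pV2 ?posrE ?ltr0n // ler_nat.
  apply: eq_integral => u _; apply/esym/cvg_lim => //; apply: cvg_EFin; first exact: nearW.
  rewrite -[X in _ --> X]mulr1; apply: cvgM; first exact: cvg_cst.
  rewrite -expR0; apply: (@cvg_comp _ _ _ (fun n => - eps n * `|u|) expR _ (nbhs (0:R))); last exact: continuous_expR.
  rewrite -(mul0r `|u|) -oppr0; apply: cvgM; last exact: cvg_cst.
  by apply: cvgN; exact: cvg_harmonic.
by rewrite -(cvg_lim _ lim1) // (cvg_lim _ lim2).
Qed.

End Plancherel.

(** * Gauss products and 1/Gamma *)

Section GaussProduct.
Variable R : realType.
Local Notation Re := (@complex.Re R).
Local Notation Im := (@complex.Im R).
Implicit Types (z w : R[i]).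

(** The mean value theorem is applied to the two components, each with its own intermediate point;
    hence the factor [2]. *)
Lemma cmvt (F f : R -> R[i]) (K : R) : (forall s, cderiv F s (f s)) ->
  (forall s, 0 <= s <= 1 -> cabs (f s) <= K) -> cabs (F 1 - F 0) <= 2 * K.
Proof.
move=> dF fK.
have key (p : R[i] -> R) : (forall z, `|p z| <= cabs z) -> (forall z w, p (z - w) = p z - p w) ->
    (forall s : R, is_derive s 1 (fun t => p (F t)) (p (f s))) -> `|p (F 1 - F 0)| <= K.
  move=> pc pB dp.
  have [|c c01 h] := @MVT_segment R (fun t => p (F t)) (fun s => p (f s)) 0 1 ler01 (fun s _ => dp s).
    by apply: continuous_subspaceT => x; apply/differentiable_continuous/derivable1_diffP; case: (dp x).
  by rewrite pB h subr0 mulr1 (le_trans (pc _)) // fK.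
rewrite (le_trans (le_cabs_ReIm _)) // mulr_natl mulr2n lerD //; apply: key.
- exact: le_Re_cabs.
- exact: ReB.
- by move=> s; case: (dF s).
- exact: le_Im_cabs.
- exact: ImB.
- by move=> s; case: (dF s).
Qed.

Lemma cabs_cexp_le w (s : R) : 0 <= s <= 1 -> cabs (cexp (w * s%:C)) <= expR (cabs w).
Proof.
move=> /andP[s0 s1]; rewrite cabs_cexp ler_expR !cE /= mulr0 subr0.
rewrite (le_trans (ler_norm _)) // normrM (ger0_norm s0).
by rewrite (le_trans (ler_piMr _ s1)) // le_Re_cabs.
Qed.

Lemma cexp_sub1 w : cabs (cexp w - 1) <= 2 * (cabs w * expR (cabs w)).
Proof.
have := @cmvt (fun s => cexp (w * s%:C)) (fun s => w * cexp (w * s%:C)) (cabs w * expR (cabs w)).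
rewrite mulr1 mulr0 cexp0; apply; first by move=> s; exact: cderiv_cexpM.
by move=> s s01; rewrite cabsM ler_wpM2l ?cabs_ge0 // cabs_cexp_le.
Qed.

(** The derivative of [cexp (w s) - w s] is [w (cexp (w s) - 1)], which [cexp_sub1] bounds; the [4]
    is [2 * 2]. *)
Lemma cexp_sub1Dx w : cabs (cexp w - 1 - w) <= 4 * (cabs w ^+ 2 * expR (cabs w)).
Proof.
have -> : 4 * (cabs w ^+ 2 * expR (cabs w)) = 2 * (2 * (cabs w ^+ 2 * expR (cabs w))) :> R by ring.
have := @cmvt (fun s => cexp (w * s%:C) - w * s%:C) (fun s => w * cexp (w * s%:C) - w) (2 * (cabs w ^+ 2 * expR (cabs w))).
rewrite mulr1 mulr0 cexp0 subr0 addrAC; apply.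
  move=> s; apply: cderivD; first exact: cderiv_cexpM.
  have := cderivM (cderiv_cst (- w) s) (cderiv_id s); rewrite mul0r add0r mulr1.
  by under eq_fun do rewrite mulNr.
move=> s s01; rewrite -[X in _ - X]mulr1 -mulrBr cabsM.
have [s0 s1] := andP s01.
have h : cabs (w * s%:C) <= cabs w by rewrite cabsM cabsC ger0_norm // ler_piMr // cabs_ge0.
rewrite expr2 -mulrA mulrCA ler_wpM2l ?cabs_ge0 // (le_trans (cexp_sub1 _)) // ler_wpM2l //.
by rewrite ler_pM ?cabs_ge0 ?expR_ge0 // ler_expR.
Qed.

Definition gauss n z : R[i] := n`!%:R * cpow n%:R z / \prod_(0 <= k < n.+1) (z + k%:R).
(** The reciprocals of Gauss's products are entire and converge locally uniformly to [1 / Gamma], so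
    the estimates need not avoid poles. *)
Definition rgauss n z : R[i] := (\prod_(0 <= k < n.+1) (z + k%:R)) / (n`!%:R * cpow n%:R z).
(** The quotient of consecutive reciprocal products, [(1 + z / (n + 1)) * (n / (n + 1))^z = 1 + O(1
    / n^2)]. *)
Definition ugauss n z : R[i] := (1 + z / n.+1%:R) * cexp (z * (ln (n%:R : R) - ln (n.+1%:R : R))%:C).

Lemma rgaussV n z : (rgauss n z)^-1 = gauss n z.
Proof. by rewrite /rgauss invfM invrK mulrC. Qed.

Lemma natc_neq0 n : n.+1%:R != 0 :> R[i].
Proof. by rewrite pnatr_eq0. Qed.
Lemma factc_neq0 n : (n`!)%:R != 0 :> R[i].
Proof. by rewrite pnatr_eq0 -lt0n fact_gt0. Qed.

Lemma rgaussS n z : rgauss n.+1 z = rgauss n z * ugauss n z.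
Proof.
rewrite /rgauss /ugauss big_nat_recr //= factS natrM.
have -> : cpow n.+1%:R z = cpow n%:R z / cexp (z * (ln (n%:R : R) - ln (n.+1%:R : R))%:C).
  rewrite /cpow -cexpN -cexpD; congr cexp.
  by apply: ceqP; rewrite !cE /=; ring.
have h1 := natc_neq0 n; have h2 := factc_neq0 n.
have h3 : cpow n%:R z != 0 by exact: cexp_neq0.
have h4 := cexp_neq0 (z * (ln (n%:R : R) - ln (n.+1%:R : R))%:C).
move: h1 h2 h3 h4; set a := n.+1%:R; set f := (n`!)%:R; set c := cpow _ _; set e := cexp _.
set P := \prod_(0 <= i < _) _ => h1 h2 h3 h4.
clearbody a f c e P; field; rewrite h1 h2 h3 h4 //.
Qed.

Lemma ln_ratio n : (0 < n)%N ->
  `|ln (n%:R : R) - ln (n.+1%:R : R) + n.+1%:R^-1| <= 2 * n.+1%:R^-1 ^+ 2.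
Proof.
move=> n0.
have nR : 0 < n%:R :> R by rewrite ltr0n.
have mR : 0 < n.+1%:R :> R by rewrite ltr0n.
set y : R := n.+1%:R^-1.
have y0 : 0 < y by rewrite invr_gt0.
(* This uses [0 < n]; with [y <= 1/2] one has [y / (1 - y) <= y + 2 y^2]. *)
have y2 : y <= 2^-1 by rewrite lef_pV2 ?posrE // ler_nat.
have e1 : ln (n%:R : R) - ln (n.+1%:R : R) = ln (1 - y).
  by rewrite -ln_div ?posrE //; congr ln; rewrite /y -natr1; field; rewrite natr1 pnatr_eq0.
have h1 : ln (1 - y) <= - y by apply: le_ln1Dx; rewrite ltrN2; lra.
have h2 : - ln (1 - y) <= y / (1 - y).
  rewrite -lnV ?posrE; last lra.
  rewrite [X in ln X](_ : _ = 1 + y / (1 - y)); last by field; lra.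
  by apply: le_ln1Dx; apply: (@lt_le_trans _ _ 0); [lra|apply: divr_ge0; lra].
have h3 : y / (1 - y) <= y + 2 * y ^+ 2.
  rewrite ler_pdivrMr; last lra.
  have : 0 <= y ^+ 2 * (1 - 2 * y) by apply: mulr_ge0; [exact: sqr_ge0|lra].
  lra.
by rewrite e1 ler_norml; apply/andP; split; lra.
Qed.

(** The constant of [ugauss_sub1], where [ugauss] is factored as [p * q]: the first summand bounds
    [(p - 1) * q] and the second bounds [q - 1]. *)
Definition ucst (A : R) : R :=
  ((1 + A) * (4 * expR A) + 1) * A ^+ 2 * expR A + 2 * (2 * A * expR A).
Lemma ucst_ge0 A : 0 <= A -> 0 <= ucst A.
Proof.
move=> A0; have e := expR_ge0 A.
by rewrite addr_ge0 // ?mulr_ge0 // ?addr_ge0 ?mulr_ge0 ?addr_ge0 // exprn_ge0.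
Qed.

(** With [y = 1 / (n + 1)] the first-order terms cancel: [(1 + z y) exp (- z y) = 1 + O(y^2)], and
    the remaining exponent is [z d] with [d = O(y^2)]. *)
Lemma ugauss_sub1 A n z : (0 < n)%N -> cabs z <= A ->
  cabs (ugauss n z - 1) <= ucst A * n.+1%:R^-1 ^+ 2.
Proof.
move=> n0 zA; have A0 : 0 <= A := le_trans (cabs_ge0 _) zA.
set y : R := n.+1%:R^-1.
have y0 : 0 <= y by rewrite invr_ge0.
have y1 : y <= 2^-1 by rewrite lef_pV2 ?posrE // ler_nat.
pose d := ln (n%:R : R) - ln (n.+1%:R : R) + y.
have dy : `|d| <= 2 * y ^+ 2 by exact: ln_ratio.
pose zy := z * y%:C.
have zyE : z / n.+1%:R = zy by rewrite /zy complex_nat; congr (_ * _); rewrite -fmorphV.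
pose p := (1 + zy) * cexp (- zy); pose q := cexp (z * d%:C).
have -> : ugauss n z = p * q.
  rewrite /ugauss zyE /p /q -mulrA -cexpD; congr (_ * cexp _).
  by rewrite /zy /d; apply: ceqP; rewrite !cE /=; ring.
have zy_le : cabs zy <= A * y by rewrite cabsM cabsC ger0_norm // ler_wpM2r.
have zy_leA : cabs zy <= A by rewrite (le_trans zy_le) // ler_piMr //; lra.
have p1 : cabs (p - 1) <= ((1 + A) * (4 * expR A) + 1) * (A ^+ 2 * y ^+ 2).
  have -> : p - 1 = (1 + zy) * (cexp (- zy) - 1 - (- zy)) - zy ^+ 2 by rewrite /p; ring.
  have sq : cabs zy ^+ 2 <= A ^+ 2 * y ^+ 2.
    by rewrite -exprMn ler_pXn2r ?nnegrE ?cabs_ge0 ?mulr_ge0.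
  rewrite (le_trans (cabsB _ _)) // [X in _ <= X]mulrDl mul1r lerD //; last by rewrite expr2 cabsM -expr2.
  rewrite cabsM -mulrA ler_pM ?cabs_ge0 //.
    by rewrite (le_trans (cabsD _ _)) // cabs1 lerD2l.
  rewrite (le_trans (cexp_sub1Dx _)) // cabsN -[X in _ <= X]mulrA ler_wpM2l // [X in _ <= X]mulrC.
  by rewrite ler_pM ?expR_ge0 ?sqr_ge0 // ler_expR.
have zd : cabs (z * d%:C) <= 2 * A * y ^+ 2.
  by rewrite cabsM cabsC [2 * A]mulrC -mulrA ler_pM ?cabs_ge0.
have y2 : 2 * y ^+ 2 <= 1.
  have : 0 <= (2^-1 - y) * (2^-1 + y) by apply: mulr_ge0; lra.
  by rewrite (_ : (2^-1 - y) * (2^-1 + y) = 4^-1 - y ^+ 2); [lra|field].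
have zdA : cabs (z * d%:C) <= A.
  by rewrite (le_trans zd) // mulrAC ler_piMl.
have q1 : cabs (q - 1) <= 2 * (2 * A * y ^+ 2 * expR A).
  rewrite (le_trans (cexp_sub1 _)) // ler_wpM2l // ler_pM ?cabs_ge0 ?expR_ge0 //.
  by rewrite ler_expR.
have qA : cabs q <= expR A.
  rewrite cabs_cexp ler_expR (le_trans (ler_norm _)) // (le_trans (le_Re_cabs _)) //.
have -> : p * q - 1 = (p - 1) * q + (q - 1) by ring.
rewrite (le_trans (cabsD _ _)) //.
have -> : ucst A * y ^+ 2 = ((1 + A) * (4 * expR A) + 1) * (A ^+ 2 * y ^+ 2) * expR A + 2 * (2 * A * y ^+ 2 * expR A).
  by rewrite /ucst; ring.
by rewrite lerD // cabsM ler_pM ?cabs_ge0.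
Qed.

(** A telescoping majorant of [1 / (n + 1)^2], which turns the sums in the following inductions into
    closed forms. *)
Lemma inv_sqr_le n : (0 < n)%N -> n.+1%:R^-1 ^+ 2 <= n%:R^-1 - n.+1%:R^-1 :> R.
Proof.
move=> n0; have nR : 0 < n%:R :> R by rewrite ltr0n.
have h : n%:R + 1 != 0 :> R by rewrite natr1 pnatr_eq0.
rewrite -natr1 -subr_ge0 (_ : _ - _ = (n%:R)^-1 * (n%:R + 1)^-1 ^+ 2).
  by rewrite mulr_ge0 ?invr_ge0 ?sqr_ge0 // ltW.
by field; rewrite h gt_eqF.
Qed.

(** Each new factor is at most [1 + x <= exp x] with [x] telescoping, so the product is bounded
    uniformly in [n] and on the disc of radius [A]. *)
Lemma rgauss_le A n z : cabs z <= A -> (0 < n)%N ->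
  cabs (rgauss n z) <= A * (A + 1) * expR (ucst A * (1 - n%:R^-1)).
Proof.
move=> zA; have A0 : 0 <= A := le_trans (cabs_ge0 _) zA.
case: n => // n _; elim: n => [|n ih].
  (* At [n = 1] the value is [z (z + 1)], because [1! * 1^z = 1]. *)
  rewrite invr1 subrr mulr0 expR0 mulr1 /rgauss /= !big_nat_recr //= big_nil mul1r addr0.
  have -> : (1`!)%:R * cpow 1 z = 1 :> R[i] by rewrite /cpow ln1 mul0r cexp0 mulr1.
  rewrite divr1 cabsM ler_pM ?cabs_ge0 // (le_trans (cabsD _ _)) // cabs1 lerD2r //.
rewrite rgaussS cabsM.
have u1 : cabs (ugauss n.+1 z) <= expR (ucst A * (n.+1%:R^-1 - n.+2%:R^-1)).
  rewrite -[ugauss _ _](subrK 1) (le_trans (cabsD _ _)) // cabs1 addrC.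
  rewrite (le_trans _ (expR_ge1Dx _)) // lerD2l (le_trans (@ugauss_sub1 A _ _ _ zA)) //.
  by rewrite ler_wpM2l ?ucst_ge0 // inv_sqr_le.
have -> : ucst A * (1 - n.+2%:R^-1) = ucst A * (1 - n.+1%:R^-1) + ucst A * (n.+1%:R^-1 - n.+2%:R^-1) by ring.
by rewrite expRD mulrA ler_pM ?cabs_ge0.
Qed.

(** The uniform bound of [rgauss_le] times the constant of [ugauss_sub1]. *)
Definition kcst A := A * (A + 1) * expR (ucst A) * ucst A.
Lemma kcst_ge0 A : 0 <= A -> 0 <= kcst A.
Proof. by move=> A0; rewrite /kcst mulr_ge0 ?ucst_ge0 // mulr_ge0 ?expR_ge0 // mulr_ge0 // addr_ge0. Qed.

Lemma rgauss_succ A n z : cabs z <= A -> (0 < n)%N ->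
  cabs (rgauss n.+1 z - rgauss n z) <= kcst A * (n%:R^-1 - n.+1%:R^-1).
Proof.
move=> zA n0; have A0 : 0 <= A := le_trans (cabs_ge0 _) zA.
rewrite rgaussS -[X in _ - X]mulr1 -mulrBr cabsM /kcst -[X in _ <= X]mulrA ler_pM ?cabs_ge0 //.
  rewrite (le_trans (rgauss_le zA n0)) // ler_wpM2l ?mulr_ge0 ?addr_ge0 // ler_expR.
  by rewrite ler_piMr ?ucst_ge0 // gerBl invr_ge0.
by rewrite (le_trans (@ugauss_sub1 A _ _ n0 zA)) // ler_wpM2l ?ucst_ge0 // inv_sqr_le.
Qed.

Lemma rgauss_cauchy A n m z : cabs z <= A -> (0 < n)%N -> (n <= m)%N ->
  cabs (rgauss m z - rgauss n z) <= kcst A * (n%:R^-1 - m%:R^-1).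
Proof.
move=> zA n0; elim: m => [|m ih].
  by rewrite leqn0 => /eqP nn; rewrite nn in n0.
rewrite leq_eqVlt => /predU1P[<-|nm]; first by rewrite !subrr mulr0 cabs0.
have -> : rgauss m.+1 z - rgauss n z = (rgauss m.+1 z - rgauss m z) + (rgauss m z - rgauss n z) by ring.
rewrite (le_trans (cabsD _ _)) //.
have -> : kcst A * (n%:R^-1 - m.+1%:R^-1) = kcst A * (m%:R^-1 - m.+1%:R^-1) + kcst A * (n%:R^-1 - m%:R^-1) by ring.
by rewrite lerD ?ih // rgauss_succ // (leq_trans n0).
Qed.

(** This is [1 / Gamma]. *)
Definition rgamma z : R[i] := climit (fun n => rgauss n z).

(** The increments of each component are at most [K (1 / n - 1 / (n + 1))], so adding [K / n] makes
    the sequence nonincreasing; it is bounded below, hence converges. *)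
Lemma cvg_rgauss z : ccvg \oo (fun n => rgauss n z) (rgamma z).
Proof.
have key (p : R[i] -> R) : (forall z, `|p z| <= cabs z) -> (forall z w, p (z - w) = p z - p w) ->
    p (rgauss n z) @[n --> \oo] --> lim (p (rgauss n z) @[n --> \oo]).
  move=> pc pB; pose A := cabs z; pose K := kcst A.
  have A0 : 0 <= A by exact: cabs_ge0.
  have K0 : 0 <= K by exact: kcst_ge0.
  pose v n := p (rgauss n.+1 z) + K * n.+1%:R^-1.
  have cv : cvgn v.
    apply: nonincreasing_is_cvgn.
      apply/nonincreasing_seqP => n; rewrite /v.
      have := @rgauss_succ A n.+1 z (lexx _) isT; rewrite -/K => h.
      have := le_trans (pc _) h; rewrite pB mulrBr => /ler_normlP[_].
      by set a := K * _; set b := K * _; lra.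
    exists (- (A * (A + 1) * expR (ucst A))) => _ [n _ <-].
    have := @rgauss_le A n.+1 z (lexx _) isT => h.
    have := le_trans (pc _) h => /ler_normlP[h' _].
    have h2 : A * (A + 1) * expR (ucst A * (1 - n.+1%:R^-1)) <= A * (A + 1) * expR (ucst A).
      rewrite ler_wpM2l ?mulr_ge0 ?addr_ge0 // ler_expR.
      by rewrite ler_piMr ?ucst_ge0 // gerBl invr_ge0.
    have : 0 <= K * n.+1%:R^-1 by rewrite mulr_ge0 ?invr_ge0.
    rewrite /v => h3; rewrite -lerN2 opprK opprD.
    by rewrite (le_trans _ h2) // (le_trans _ h') // gerDl oppr_le0.
  have cp : cvgn (fun n => p (rgauss n z)).
    have : (fun n => p (rgauss n.+1 z)) @ \oo --> lim (v @ \oo) - K * 0.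
      have -> : (fun n => p (rgauss n.+1 z)) = (fun n => v n - K * n.+1%:R^-1).
        by apply/funext => n; rewrite /v addrK.
      apply: cvgB => //; apply: cvgM; [exact: cvg_cst|exact: cvg_harmonic].
    rewrite (cvg_shiftS (fun n => p (rgauss n z))); exact: cvgP.
  exact: cp.
by split; apply: key; [exact: le_Re_cabs|exact: ReB|exact: le_Im_cabs|exact: ImB].
Qed.

(** Let [m] tend to infinity in [rgauss_cauchy]. The rate is uniform on the disc, which later gives
    continuity and lower bounds on compact sets. *)
Lemma rgamma_sub A n z : cabs z <= A -> (0 < n)%N ->
  cabs (rgamma z - rgauss n z) <= kcst A * n%:R^-1.
Proof.
move=> zA n0; have A0 : 0 <= A := le_trans (cabs_ge0 _) zA.
have h : cabs (rgauss m z - rgauss n z) @[m --> \oo] --> cabs (rgamma z - rgauss n z).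
  by apply: cvg_cabs; apply: ccvgB; [exact: cvg_rgauss|exact: ccvg_cst].
rewrite -(cvg_lim _ h) //; apply: limr_le; first by apply: cvgP h.
near=> m; rewrite (le_trans (@rgauss_cauchy A n m z zA n0 _)) //.
  by near: m; exact: nbhs_infty_ge.
by rewrite ler_wpM2l ?kcst_ge0 // gerBl invr_ge0.
Unshelve. all: by end_near. Qed.

Lemma rgauss_neq0 n z : (forall k : nat, z + k%:R != 0) -> rgauss n z != 0.
Proof.
move=> z0; rewrite /rgauss mulf_neq0 //.
  by rewrite prodf_seq_neq0; apply/allP => k _; rewrite z0.
by rewrite invr_neq0 // mulf_neq0 ?factc_neq0 // cexp_neq0.
Qed.

(** From an index [N] with [C / N <= 1/2] on, the factors [ugauss] deviate from [1] by a total of at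
    most [1/2], so the product keeps at least half of the nonzero modulus of [rgauss N z]. *)
Lemma rgamma_neq0 z : (forall k : nat, z + k%:R != 0) -> rgamma z != 0.
Proof.
move=> z0; pose A := cabs z; pose C := ucst A.
have A0 : 0 <= A by exact: cabs_ge0.
have C0 : 0 <= C by exact: ucst_ge0.
pose N := (Num.truncn (2 * C)).+1.
have N0 : 0 < N%:R :> R by rewrite ltr0n.
have CN : C * N%:R^-1 <= 2^-1.
  by rewrite ler_pdivrMr // ler_pdivlMl //; apply/ltW/truncnS_gt.
have gN : 0 < cabs (rgauss N z) by rewrite cabs_gt0 // rgauss_neq0.
(* The inductive step is [(1 - x) (1 - a) >= 1 - (x + a)], with the accumulated deviation [x] and
   the new one [a] both telescoping. *)
have lb m : (N <= m)%N -> cabs (rgauss N z) * (1 - C * (N%:R^-1 - m%:R^-1)) <= cabs (rgauss m z).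
  elim: m => [|m ih]; first by rewrite leqn0.
  rewrite leq_eqVlt => /predU1P[<-|]; first by rewrite subrr mulr0 subr0 mulr1.
  rewrite ltnS => Nm; have {}ih := ih Nm.
  have m0 : (0 < m)%N by exact: leq_trans Nm.
  have u1 : 1 - C * (m%:R^-1 - m.+1%:R^-1) <= cabs (ugauss m z).
    have h1 := @ugauss_sub1 A m z m0 (lexx _).
    have h2 : C * m.+1%:R^-1 ^+ 2 <= C * (m%:R^-1 - m.+1%:R^-1) by rewrite ler_wpM2l ?inv_sqr_le.
    have := lerB_cabs 1 (ugauss m z - 1); rewrite subrKC cabs1 => h3.
    have := le_trans h1 h2; set b := C * _; lra.
  set x := C * (N%:R^-1 - m%:R^-1) in ih *; set a := C * (m%:R^-1 - m.+1%:R^-1) in u1 *.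
  have a0 : 0 <= a.
    by rewrite mulr_ge0 // subr_ge0 lef_pV2 ?posrE ?ltr0n // ler_nat.
  have x0 : 0 <= x.
    by rewrite mulr_ge0 // subr_ge0 lef_pV2 ?posrE ?ltr0n // ler_nat.
  have ax : x + a <= 2^-1.
    have -> : x + a = C * N%:R^-1 - C * m.+1%:R^-1 by rewrite /x /a; ring.
    by rewrite (le_trans _ CN) // gerBl mulr_ge0 ?invr_ge0.
  have -> : C * (N%:R^-1 - m.+1%:R^-1) = x + a by rewrite /x /a; ring.
  rewrite rgaussS cabsM.
  have p1 : 0 <= cabs (rgauss N z) * (1 - x) by apply: mulr_ge0; [exact: ltW|lra].
  have p2 : 0 <= 1 - a by lra.
  apply: le_trans (ler_pM p1 p2 ih u1).
  rewrite -mulrA ler_pM2l //; have : 0 <= x * a by exact: mulr_ge0.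
  lra.
apply/eqP => e0.
have h := cvg_cabs (cvg_rgauss z); rewrite e0 cabs0 in h.
have : cabs (rgauss N z) / 2 <= 0.
  have {}h : cabs (rgauss n z) @[n --> \oo] --> 0 by exact: h.
  rewrite -(cvg_lim _ h) //; apply: limr_ge; first by apply: cvgP h.
  near=> m; have Nm : (N <= m)%N by near: m; exact: nbhs_infty_ge.
  rewrite (le_trans _ (lb m Nm)) // ler_pM2l //.
  have : 0 <= C * m%:R^-1 by rewrite mulr_ge0 ?invr_ge0.
  rewrite mulrBr; lra.
lra.
Unshelve. all: by end_near. Qed.

Lemma rgamma_pole (k : nat) : rgamma (- k%:R) = 0.
Proof.
have h : ccvg \oo (fun n => rgauss n (- k%:R)) 0.
  have e : \forall n \near \oo, rgauss n (- k%:R) = 0.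
    near=> n; rewrite /rgauss (bigD1_seq k _ (iota_uniq _ _)) /=.
    - by rewrite addNr !mul0r.
    - rewrite -[_ :: _]/(iota 0 n.+1) mem_iota /= add0n ltnS; near: n; exact: nbhs_infty_ge.
  by split; apply: cvg_near_cst; apply: filterS e => n ->.
by rewrite /rgamma (ccvg_lim h).
Unshelve. all: by end_near. Qed.

(** At a pole both sides are [0]: the sequence defining [cGamma] is eventually a division by [0],
    and on the right the inverse of [0] is [0]. *)
Lemma cGammaE z : cGamma z = (rgamma z)^-1.
Proof.
rewrite /cGamma; have [[k zk]|z0] := pselect (exists k : nat, z = - k%:R).
  rewrite zk rgamma_pole invr0; apply: ccvg_lim.
  have e : \forall n \near \oo, gauss n (- k%:R) = 0.
    near=> n; rewrite /gauss (bigD1_seq k _ (iota_uniq _ _)) /=.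
    - by rewrite addNr !mul0r invr0 mulr0.
    - rewrite -[_ :: _]/(iota 0 n.+1) mem_iota /= add0n ltnS; near: n; exact: nbhs_infty_ge.
  by split; apply: cvg_near_cst; apply: filterS e => n; rewrite /gauss => ->.
apply: ccvg_lim; under [X in ccvg _ X _]eq_fun do rewrite -/(gauss _ _) -rgaussV.
apply: ccvgV; last exact: cvg_rgauss.
apply: rgamma_neq0 => k; apply: contra_notN z0 => /eqP h.
by exists k; apply/eqP; rewrite -addr_eq0 h.
Unshelve. all: by end_near. Qed.

Lemma ccvg_rgauss (T : Type) (F : set_system T) {FF : Filter F} n (f : T -> R[i]) l :
  ccvg F f l -> ccvg F (fun x => rgauss n (f x)) (rgauss n l).
Proof.
move=> h; apply: ccvgM.
  apply: (@ccvg_prod _ _ _ _ (fun k x => f x + k%:R) (fun k => l + k%:R)) => k.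
  by apply: ccvgD => //; exact: ccvg_cst.
apply: ccvgV; first by rewrite mulf_neq0 ?factc_neq0 // cexp_neq0.
apply: ccvgM; first exact: ccvg_cst.
by apply: ccvg_cexp; apply: ccvgM => //; exact: ccvg_cst.
Qed.

(** On the disc of radius [cabs l + 1] a fixed [rgauss N] is uniformly close to [rgamma], and
    [rgauss N] is continuous. *)
Lemma ccvg_rgamma (T : Type) (F : set_system T) {FF : Filter F} (f : T -> R[i]) l :
  ccvg F f l -> ccvg F (fun x => rgamma (f x)) (rgamma l).
Proof.
move=> h; apply: ccvg_cabs0; apply/cvgrPdist_lt => e e0.
pose A := cabs l + 1; have A0 : 0 <= kcst A by rewrite kcst_ge0 // addr_ge0 // cabs_ge0.
have hA : \forall x \near F, cabs (f x) <= A.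
  have /cvgrPdist_lt/(_ 1 ltr01) : cabs (f x) @[x --> F] --> cabs l by exact: cvg_cabs.
  apply: filterS => x.
  by rewrite ltr_distlC => /andP[_ /ltW].
(* Chosen so that [rgamma_sub] errs by at most [e / 4] at each of the two points. *)
pose N := (Num.truncn (4 * kcst A / e)).+1.
have N0 : 0 < N%:R :> R by rewrite ltr0n.
have KN : kcst A * N%:R^-1 <= e / 4.
  rewrite ler_pdivrMr // mulrAC ler_pdivlMr // mulrC -ler_pdivrMl // mulrC.
  rewrite (_ : e^-1 * (kcst A * 4) = 4 * kcst A / e); last by ring.
  by apply/ltW; exact: truncnS_gt.
have hN : \forall x \near F, cabs (rgauss N (f x) - rgauss N l) < e / 4.
  have h1 : ccvg F (fun x => rgauss N (f x) - rgauss N l) 0.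
    by rewrite -(subrr (rgauss N l)); apply: ccvgB; [exact: ccvg_rgauss|exact: ccvg_cst].
  have /cvgrPdist_lt/(_ (e / 4)) : cabs (rgauss N (f x) - rgauss N l) @[x --> F] --> (0 : R).
    by rewrite -(@cabs0 R); exact: cvg_cabs.
  rewrite divr_gt0 // => /(_ isT); apply: filterS => x.
  by rewrite sub0r normrN ger0_norm ?cabs_ge0.
near=> x; rewrite sub0r normrN ger0_norm ?cabs_ge0 //.
have fA : cabs (f x) <= A by near: x.
have lA : cabs l <= A by rewrite lerDl.
have h1 := @rgamma_sub A N (f x) fA isT.
have h2 := @rgamma_sub A N l lA isT.
have h3 : cabs (rgauss N (f x) - rgauss N l) < e / 4 by near: x.
have -> : rgamma (f x) - rgamma l = (rgamma (f x) - rgauss N (f x)) + ((rgauss N (f x) - rgauss N l) - (rgamma l - rgauss N l)) by ring.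
have h4 := cabsD (rgamma (f x) - rgauss N (f x)) ((rgauss N (f x) - rgauss N l) - (rgamma l - rgauss N l)).
have h5 := cabsB (rgauss N (f x) - rgauss N l) (rgamma l - rgauss N l).
lra.
Unshelve. all: by end_near. Qed.

End GaussProduct.

(** * L^2 of the half-line *)

Section L2Basics.
Variable R : realType.
Local Notation Re := (@complex.Re R).
Local Notation Im := (@complex.Im R).
Local Notation mu := (@lebesgue_measure R).
Local Notation lineT := (measurableTypeR R).
Local Notation D := (@Rplus R).
Implicit Types (f g : R -> R[i]).

Lemma measurable_Rplus : measurable (D : set lineT).
Proof.
have -> : D = `]0, +oo[%classic by apply/seteqP; split => x; rewrite /Rplus /= in_itv /= andbT.
exact: measurable_itv.
Qed.
Let mD := measurable_Rplus.

Lemma L2normsqE f : L2normsq f = (\int[mu]_(x in D) (cabs (f x) ^+ 2)%:E)%E.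
Proof. by apply: eq_integral => x _; rewrite sqr_cabs. Qed.

(** The squared norm as a real number. For [f] outside [L2] with infinite norm it takes the default
    value [0], so it is informative only together with [L2 f]. *)
Definition n2 f : R := \int[mu]_(x in D) cabs (f x) ^+ 2.

Lemma L2P f : L2 f <-> cmeas (D : set lineT) f /\ mu.-integrable D (fun x => (cabs (f x) ^+ 2)%:E).
Proof.
split=> [[a b c]|[[a b] /integrableP[c e]]].
  split; first by [].
  apply/integrableP; split; first by apply/measurable_EFinP; apply: measurable_sqr_cabs.
  move: c; rewrite L2normsqE; apply: le_lt_trans; rewrite le_eqVlt; apply/orP; left; apply/eqP.
  by apply: eq_integral => x _ /=; rewrite ger0_norm // sqr_ge0.
split=> //; move: e; rewrite L2normsqE; apply: le_lt_trans; rewrite le_eqVlt; apply/orP; left; apply/eqP.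
by apply: eq_integral => x _ /=; rewrite ger0_norm // sqr_ge0.
Qed.

Lemma L2normsq_n2 f : L2 f -> L2normsq f = (n2 f)%:E.
Proof.
move=> /L2P[_ i]; rewrite L2normsqE /n2 /Rintegral fineK //.
exact: integrable_fin_num.
Qed.
Lemma n2_ge0 f : 0 <= n2 f.
Proof. by apply: Rintegral_ge0 => x _; exact: sqr_ge0. Qed.

Lemma sqr_cabsD (z w : R[i]) : cabs (z + w) ^+ 2 <= 2 * cabs z ^+ 2 + 2 * cabs w ^+ 2.
Proof.
have h := cabsD z w.
apply: le_trans (_ : (cabs z + cabs w) ^+ 2 <= _).
  by rewrite ler_pXn2r ?nnegrE ?addr_ge0 ?cabs_ge0.
have := sqr_ge0 (cabs z - cabs w); rewrite sqrrB sqrrD; lra.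
Qed.

Lemma L2D f g : L2 f -> L2 g -> L2 (fun x => f x + g x).
Proof.
move=> /L2P[mf jf] /L2P[mg jg]; apply/L2P; split; first exact: cmeasD.
have := integrableD mD (integrableZl mD 2 jf) (integrableZl mD 2 jg).
apply: le_integrable => //.
  by apply/measurable_EFinP; apply: measurable_sqr_cabs; exact: cmeasD.
move=> x _ /=; rewrite lee_fin ger0_norm ?sqr_ge0 // (le_trans (sqr_cabsD _ _)) //.
exact: ler_norm.
Qed.
Lemma L2Z (a : R[i]) f : L2 f -> L2 (fun x => a * f x).
Proof.
move=> /L2P[mf jf]; apply/L2P; split; first by apply: cmeasM => //; exact: cmeas_cst.
have := integrableZl mD (cabs a ^+ 2) jf; apply: eq_integrable => // x _.
by rewrite cabsM exprMn EFinM.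
Qed.
Lemma eq_L2 f g : (forall x, D x -> f x = g x) -> L2 f -> L2 g.
Proof.
move=> fg [a b c]; split.
- by apply: eq_measurable_fun a => x /set_mem /fg ->.
- by apply: eq_measurable_fun b => x /set_mem /fg ->.
- by rewrite (_ : L2normsq g = L2normsq f) //; apply: eq_integral => x /set_mem /fg ->.
Qed.
Lemma L2N f : L2 f -> L2 (fun x => - f x).
Proof. by move=> /(L2Z (-1)); apply: eq_L2 => x _; rewrite mulN1r. Qed.
Lemma L2B f g : L2 f -> L2 g -> L2 (fun x => f x - g x).
Proof. by move=> lf lg; apply: L2D => //; exact: L2N. Qed.
Lemma L2J f : L2 f -> L2 (fun x => cconj (f x)).
Proof.
move=> /L2P[mf jf]; apply/L2P; split; first exact: cmeasJ.
by under eq_fun do rewrite cabsJ.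
Qed.
Lemma n2D f g : L2 f -> L2 g -> n2 (fun x => f x + g x) <= 2 * n2 f + 2 * n2 g.
Proof.
move=> lf lg; have /L2P[_ jfg] := L2D lf lg.
case/L2P: lf => mf jf; case/L2P: lg => mg jg.
rewrite /n2 -!RintegralZl // -RintegralD //; last 2 first.
- by rewrite /comp; under eq_fun do rewrite EFinM; exact: integrableZl.
- by rewrite /comp; under eq_fun do rewrite EFinM; exact: integrableZl.
apply: le_Rintegral => //.
  by rewrite /comp; under eq_fun do rewrite EFinD !EFinM; apply: integrableD => //; exact: integrableZl.
by move=> x _; exact: sqr_cabsD.
Qed.
Lemma n2Z (a : R[i]) f : L2 f -> n2 (fun x => a * f x) = cabs a ^+ 2 * n2 f.
Proof.
move=> /L2P[mf jf]; rewrite /n2 -RintegralZl //; apply: eq_Rintegral => x _.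
by rewrite cabsM exprMn.
Qed.
Lemma n2N f : n2 (fun x => - f x) = n2 f.
Proof. by apply: eq_Rintegral => x _; rewrite cabsN. Qed.
Lemma n2J f : n2 (fun x => cconj (f x)) = n2 f.
Proof. by apply: eq_Rintegral => x _; rewrite cabsJ. Qed.
Lemma eq_n2 f g : (forall x, D x -> f x = g x) -> n2 f = n2 g.
Proof. by move=> fg; apply: eq_Rintegral => x /set_mem /fg ->. Qed.
Lemma n2_distC f g : n2 (fun x => f x - g x) = n2 (fun x => g x - f x).
Proof. by apply: eq_Rintegral => x _; rewrite cabs_distC. Qed.
Lemma n2_tri f g h : L2 f -> L2 g -> L2 h ->
  n2 (fun x => f x - h x) <= 2 * n2 (fun x => f x - g x) + 2 * n2 (fun x => g x - h x).
Proof.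
move=> lf lg lh; apply: le_trans (n2D (L2B lf lg) (L2B lg lh)).
by rewrite le_eqVlt; apply/orP; left; apply/eqP; apply: eq_n2 => x _; rewrite addrA subrK.
Qed.

Lemma aeeq_n2 f g : L2 f -> L2 g -> aeeq f g <-> n2 (fun x => f x - g x) = 0.
Proof.
move=> lf lg; have /L2P[mfg jfg] := L2B lf lg.
have mE : measurable_fun (D : set lineT) (fun x => (cabs (f x - g x) ^+ 2)%:E).
  by apply/measurable_EFinP; apply: measurable_sqr_cabs.
have h := ae_eq_integral_abs mu mD mE.
have e : (\int[mu]_(x in D) `|(cabs (f x - g x) ^+ 2)%:E| = (n2 (fun x => f x - g x))%:E)%E.
  rewrite -L2normsq_n2 ?L2normsqE; last exact: L2B.
  by apply: eq_integral => x _ /=; rewrite ger0_norm ?sqr_ge0.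
split=> [fg|n0].
  have : ae_eq mu D (fun x => (cabs (f x - g x) ^+ 2)%:E) (cst 0%E).
    move: fg; rewrite /aeeq => -[N [mN N0 NS]]; exists N; split=> // x /= nx; apply: NS => /= fg; apply: nx => Dx.
    by rewrite fg // subrr cabs0 expr0n.
  by move=> /h; rewrite e => -[].
have : (\int[mu]_(x in D) `|(cabs (f x - g x) ^+ 2)%:E| = 0)%E by rewrite e n0.
move=> /h [N [mN N0 NS]]; exists N; split=> // x /= nx; apply: NS => /= H; apply: nx => Dx; have [] := H Dx => /eqP.
by rewrite sqrf_eq0 => /eqP /cabs_eq0 /eqP; rewrite subr_eq0 => /eqP.
Qed.

Lemma L2_mul f g : L2 f -> L2 g -> cintegrable mu D (fun x => f x * g x).
Proof.
move=> /L2P[mf jf] /L2P[mg jg].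
apply: (@cintegrable_le _ _ lineT mu D _ (fun x => cabs (f x) ^+ 2 + cabs (g x) ^+ 2)) => //.
- exact: cmeasM.
- by rewrite /comp; under eq_fun do rewrite EFinD; exact: integrableD.
- move=> x _; rewrite cabsM; have := sqr_ge0 (cabs (f x) - cabs (g x)).
  have := mulr_ge0 (cabs_ge0 (f x)) (cabs_ge0 (g x)); rewrite sqrrB; lra.
Qed.

Lemma L2dotE f g : L2dot f g = cint mu D (fun x => f x * cconj (g x)).
Proof. by []. Qed.

(** Polarisation: isometry and convergence of inner products are thereby reduced to statements about
    [n2]. *)
Lemma Re_L2dot f g : L2 f -> L2 g ->
  Re (L2dot f g) = (n2 (fun x => f x + g x) - n2 f - n2 g) / 2.
Proof.
move=> lf lg; have /L2P[mfg jfg] := L2D lf lg.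
have [jre _] := L2_mul lf (L2J lg).
case/L2P: lf => mf jf; case/L2P: lg => mg jg.
rewrite L2dotE Re_cint.
have -> : n2 (fun x => f x + g x) = n2 f + (n2 g + 2 * \int[mu]_(x in D) Re (f x * cconj (g x))).
  have j2 : mu.-integrable D (EFin \o (fun x => 2 * Re (f x * cconj (g x)))).
    by rewrite /comp; under eq_fun do rewrite EFinM; exact: integrableZl.
  have j3 : mu.-integrable D (EFin \o (fun x => cabs (g x) ^+ 2 + 2 * Re (f x * cconj (g x)))).
    by rewrite /comp; under eq_fun do rewrite EFinD; exact: integrableD.
  rewrite /n2 -RintegralZl // -RintegralD // -RintegralD //.
  by apply: eq_Rintegral => x _; rewrite !sqr_cabs !cE; ring.
by field.
Qed.

Lemma Im_L2dot f g : L2 f -> L2 g ->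
  Im (L2dot f g) = Re (L2dot f (fun x => (0 +i* 1) * g x)).
Proof.
move=> lf lg; rewrite !L2dotE Re_cint Im_cint; apply: eq_Rintegral => x _.
by rewrite !cE /=; ring.
Qed.

(** Instead of square roots and Minkowski's inequality, the proof uses [|a + b|^2 <= (1 + s) |a|^2 +
    (1 + 1/s) |b|^2] with a small [s]. *)
Lemma n2_lim (u : nat -> R -> R[i]) f : (forall n, L2 (u n)) -> L2 f ->
  n2 (fun x => u n x - f x) @[n --> \oo] --> 0 -> n2 (u n) @[n --> \oo] --> n2 f.
Proof.
move=> lu lf uf.
have tri (s : R) (a b : R -> R[i]) : 0 < s -> L2 a -> L2 b ->
   n2 (fun x => a x + b x) <= (1 + s) * n2 a + (1 + s^-1) * n2 b.
  move=> s0 la lb; have /L2P[_ jab] := L2D la lb.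
  case/L2P: la => ma ja; case/L2P: lb => mb jb.
  rewrite /n2 -!RintegralZl // -RintegralD //; last 2 first.
  - by rewrite /comp; under eq_fun do rewrite EFinM; exact: integrableZl.
  - by rewrite /comp; under eq_fun do rewrite EFinM; exact: integrableZl.
  apply: le_Rintegral => //.
    by rewrite /comp; under eq_fun do rewrite EFinD !EFinM; apply: integrableD => //; exact: integrableZl.
  move=> x _; have h := cabsD (a x) (b x).
  apply: le_trans (_ : (cabs (a x) + cabs (b x)) ^+ 2 <= _).
    by rewrite ler_pXn2r ?nnegrE ?addr_ge0 ?cabs_ge0.
  (* The cross term is controlled by [(s |a| - |b|)^2 / s >= 0]. *)
  have := mulr_ge0 (ltW (divr_gt0 ltr01 s0)) (sqr_ge0 (s * cabs (a x) - cabs (b x))).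
  rewrite (_ : 1 / s * _ = s * cabs (a x) ^+ 2 - 2 * (cabs (a x) * cabs (b x)) + s^-1 * cabs (b x) ^+ 2).
    by rewrite sqrrD; lra.
  by field; rewrite gt_eqF.
have A0 := n2_ge0 f.
apply/cvgrPdist_le => e e0.
(* This gives [s <= 1] and [s * (n2 f + e) <= e / 4]. *)
pose s := e / (4 * (n2 f + e) + 4).
have s0 : 0 < s by rewrite divr_gt0 // ltr_wpDl // mulr_ge0 // addr_ge0 // ltW.
have sf : s * (n2 f + e) <= e / 4.
  have : s * (4 * (n2 f + e) + 4) = e by rewrite /s mulfVK // gt_eqF // ltr_wpDl // mulr_ge0 // addr_ge0 // ltW.
  by rewrite mulrDr mulrCA; lra.
have c0 : 0 < 1 + s^-1 by rewrite addr_gt0 // invr_gt0.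
have d0 : 0 < e / 4 / (1 + s^-1) by rewrite !divr_gt0.
have s1 : s <= 1.
  have d1 : 0 < 4 * (n2 f + e) + 4 by rewrite ltr_wpDl // mulr_ge0 // addr_ge0 // ltW.
  by rewrite /s ler_pdivrMr // mul1r; lra.
move/cvgrPdist_le : uf => /(_ _ d0); apply: filterS => n.
rewrite sub0r normrN ger0_norm ?n2_ge0 // ler_pdivlMr // mulrC => un.
have h1 := tri s (fun x => u n x - f x) f s0.
have t1 := tri s f (fun x => u n x - f x) s0 lf (L2B (lu n) lf).
have t2 := tri s (u n) (fun x => f x - u n x) s0 (lu n) (L2B lf (lu n)).
rewrite (eq_n2 (g := u n)) in t1; last by move=> x _; rewrite addrC subrK.
rewrite (eq_n2 (f := fun x => u n x + _) (g := f)) in t2; last by move=> x _; rewrite addrC subrK.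
rewrite n2_distC in t2.
have B0 := n2_ge0 (u n).
set d := n2 (fun x => u n x - f x) in un t1 t2.
(* The upper estimate comes first, because the reverse inequality [t2] contains the term
   [s * n2 (u n)]. *)
have b1 : n2 (u n) <= n2 f + e / 2 by nra.
have b2 : s * n2 (u n) <= e / 4 by rewrite (le_trans _ sf) // ler_pM2l //; lra.
by rewrite ler_distl; apply/andP; split; lra.
Qed.

End L2Basics.

(** * Completeness of the space of square-integrable functions *)

Section RieszFischer.
Variable R : realType.
Local Notation Re := (@complex.Re R).
Local Notation Im := (@complex.Im R).
Local Notation mu := (@lebesgue_measure R).
Local Notation lineT := (measurableTypeR R).
Local Notation D := (@Rplus R).
Implicit Types (f g : R -> R[i]).
Let mD := @measurable_Rplus R.

Lemma Rintegral_cst0 (B : set R) : \int[mu]_(x in B) (0 : R) = 0.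
Proof. by rewrite /Rintegral integral0. Qed.

Lemma ccvg_cauchy (u : nat -> R[i]) :
  (forall e, 0 < e -> exists N, forall n, (N <= n)%N -> cabs (u n - u N) < e) ->
  ccvg \oo u (climit u).
Proof.
move=> h.
have key (p : R[i] -> R) : (forall z, `|p z| <= cabs z) -> (forall z w, p (z - w) = p z - p w) ->
    p (u n) @[n --> \oo] --> lim (p (u n) @[n --> \oo]).
  move=> pc pB; have : cvgn (fun n => p (u n)); last by [].
  apply/cauchy_cvgP/cauchy_exP => e e0; have [N hN] := h e e0.
  exists (p (u N)); exists N => // n /= Nn.
  by rewrite /ball /= -pB (le_lt_trans (pc _)) // cabs_distC hN.
by split; apply: key; [exact: le_Re_cabs|exact: ReB|exact: le_Im_cabs|exact: ImB].
Qed.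

Lemma n2_dct (f_ : nat -> R -> R[i]) f (g : R -> R) : (forall n, cmeas (D : set lineT) (f_ n)) ->
  cmeas (D : set lineT) f -> (forall x, D x -> ccvg \oo (f_ ^~ x) (f x)) ->
  mu.-integrable D (EFin \o g) ->
  (forall n x, D x -> cabs (f_ n x - f x) ^+ 2 <= g x) ->
  n2 (fun x => f_ n x - f x) @[n --> \oo] --> 0.
Proof.
move=> mf_ mf cf ig fg.
have [||_ []] := @cint_dct _ _ lineT mu D (fun n x => (cabs (f_ n x - f x) ^+ 2)%:C) (fun=> 0) g mD
  (fun n => cmeasC (measurable_sqr_cabs (cmeasB (mf_ n) mf))) _ ig _.
- move=> x Dx; apply: (@ccvgC _ _ _ _ _ 0); rewrite (_ : 0 = cabs (f x - f x) ^+ 2); last by rewrite subrr cabs0 expr0n.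
  by apply: cvg_sqr_cabs; apply: ccvgB; [exact: cf|exact: ccvg_cst].
- by move=> n x Dx; rewrite cabsC ger0_norm ?sqr_ge0 // fg.
under eq_fun do rewrite Re_cint /=.
by rewrite Re_cint /= Rintegral_cst0.
Qed.

(* [S = sum_j 2^j |g_(j+1) - g_j|^2] is integrable and dominates
   [2^k |g_m - g_k|^2 / 2] for all [m >= k]. *)
Lemma L2_complete (g : nat -> R -> R[i]) (C : R) : (forall n, L2 (g n)) ->
  (forall n, n2 (fun x => g n.+1 x - g n x) <= C * (4 ^+ n)^-1) ->
  exists2 G, L2 G & n2 (fun x => g n x - G x) @[n --> \oo] --> 0.
Proof.
move=> lg gC.
pose d n x := g n.+1 x - g n x.
have ld n : L2 (d n) by exact: L2B.
have md n : measurable_fun (D : set lineT) (fun x => cabs (d n x) ^+ 2).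
  by apply: measurable_sqr_cabs; case/L2P: (ld n).
pose S n x := \sum_(0 <= j < n) 2 ^+ j * cabs (d j x) ^+ 2.
have SS n x : S n.+1 x = S n x + 2 ^+ n * cabs (d n x) ^+ 2 by rewrite /S big_nat_recr.
have t0 n x : 0 <= 2 ^+ n * cabs (d n x) ^+ 2 by rewrite mulr_ge0 ?sqr_ge0 ?exprn_ge0.
have S0 n x : 0 <= S n x by apply: sumr_ge0.
have Smono x : {homo (fun n => (S n x)%:E) : n m / (n <= m)%N >-> (n <= m)%E}.
  by apply/nondecreasing_seqP => n; rewrite lee_fin SS lerDl.
pose s x := limn (fun n => (S n x)%:E).
have scvg x : (S n x)%:E @[n --> \oo] --> s x by exact: ereal_nondecreasing_is_cvgn.
have Ss n x : ((S n x)%:E <= s x)%E.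
  by rewrite /s (cvg_lim _ (ereal_nondecreasing_cvgn (Smono x))) //; apply: ereal_sup_ubound; exists n.
have s0 x : (0 <= s x)%E by rewrite (le_trans _ (Ss 0%N x)) // lee_fin.
have mS n : measurable_fun (D : set lineT) (fun x => (S n x)%:E).
  apply/measurable_EFinP; elim: n => [|n ih].
    by rewrite /S; under eq_fun do rewrite big_nil; exact: measurable_cst.
  rewrite (_ : S n.+1 = fun x => S n x + 2 ^+ n * cabs (d n x) ^+ 2); last by apply/funext => x; exact: SS.
  apply: measurable_funD => //.
  by apply: measurable_funM => //; exact: measurable_cst.
have ms : measurable_fun (D : set lineT) s.
  by apply: (emeasurable_fun_cvg (fun n x => (S n x)%:E)) => // x _; exact: scvg.
have C0 : 0 <= C by have := gC 0%N; rewrite expr0 invr1 mulr1; exact/le_trans/n2_ge0.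
(* The bound is [C] times the partial sum of [2^j / 4^j], which equals [2 - 2 / 2^n]. *)
have iS n : mu.-integrable D (EFin \o S n) /\ \int[mu]_(x in D) S n x <= C * (2 - 2 * (2 ^+ n)^-1).
  elim: n => [|n [i1 i2]].
    rewrite (_ : S 0%N = fun=> 0); last by apply/funext => x; rewrite /S big_nil.
    by split; [exact: integrable0|rewrite Rintegral_cst0 expr0 invr1 mulr1 subrr mulr0].
  have i3 : mu.-integrable D (EFin \o (fun x => 2 ^+ n * cabs (d n x) ^+ 2)).
    by rewrite /comp; under eq_fun do rewrite EFinM; apply: integrableZl => //; case/L2P: (ld n).
  split.
    by rewrite /comp; under eq_fun do rewrite SS EFinD; exact: integrableD.
  under eq_Rintegral do rewrite SS.
  rewrite RintegralD // RintegralZl //; last by case/L2P: (ld n).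
  apply: le_trans (lerD i2 (ler_wpM2l (exprn_ge0 n (ler0n _ 2)) (gC n))) _.
  have p0 : (2 : R) ^+ n != 0 by rewrite expf_neq0.
  rewrite (_ : (4 : R) = 2 * 2); last by ring.
  rewrite exprMn exprS le_eqVlt; apply/orP; left; apply/eqP; field.
  by rewrite p0.
have is_ : (\int[mu]_(x in D) s x <= (2 * C)%:E)%E.
  rewrite (monotone_convergence mu mD mS) //; last by move=> n x _; rewrite lee_fin.
  apply: lime_le.
    apply: ereal_nondecreasing_is_cvgn => n m nm; apply: ge0_le_integral => //; try by move=> x _; rewrite lee_fin.
    by move=> x _; exact: Smono.
  apply: nearW => n; have [i1 i2] := iS n.
  rewrite -[X in (X <= _)%E]fineK; last exact: integrable_fin_num.
  rewrite lee_fin (le_trans i2) // mulrBr mulrC lerBlDr lerDl mulr_ge0 // mulr_ge0 // invr_ge0 exprn_ge0 //.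
(* The factor [2] lost at each use of [sqr_cabsD] is absorbed by the weights [2^j] in [S]. *)
have tel n : forall k x, cabs (g (k + n)%N x - g k x) ^+ 2 <= 2 * (2 ^+ k)^-1 * (S (k + n)%N x - S k x).
  elim: n => [|n ih] k x; first by rewrite addn0 !subrr cabs0 expr0n mulr0.
  have := ih k.+1 x; rewrite addSnnS => h.
  rewrite -[X in cabs X](subrKA (g k.+1 x)) (le_trans (sqr_cabsD _ _)) //.
  apply: le_trans (lerD (ler_wpM2l (ler0n _ 2) h) (lexx _)) _.
  rewrite SS exprS -/(d k x) le_eqVlt; apply/orP; left; apply/eqP; field.
  by rewrite expf_neq0.
have tel' k m x : (k <= m)%N -> cabs (g m x - g k x) ^+ 2 <= 2 * (2 ^+ k)^-1 * S m x.
  move=> km; have := tel (m - k)%N k x; rewrite subnKC // => h; rewrite (le_trans h) //.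
  by rewrite ler_wpM2l ?mulr_ge0 ?invr_ge0 ?exprn_ge0 // lerBlDr lerDl.
pose E := D `&` [set x | s x \is a fin_num].
have mE : measurable (E : set lineT) by apply: emeasurable_fin_num.
(* Cutting off to the set where [s] is finite makes the sequence converge at every point; elsewhere
   it is constantly [0]. *)
pose h n x := g n x * (\1_E x : R)%:C.
pose G x := climit (h ^~ x).
have hG x : ccvg \oo (h ^~ x) (G x).
  apply: ccvg_cauchy => e e0.
  have [xE|xE] := boolP (x \in E); last first.
    by exists 0%N => n _; rewrite /h indicE (negbTE xE) !mulr0 subrr cabs0.
  have /set_mem[_ /= sf] := xE.
  have [N hN] : exists N, 2 * (2 ^+ N)^-1 * fine (s x) < e ^+ 2.
    have c : 2 * (2 ^- n) * fine (s x) @[n --> \oo] --> 2 * 0 * fine (s x).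
      apply: cvgM; last exact: cvg_cst.
      apply: cvgM; first exact: cvg_cst.
      under eq_fun do rewrite -exprVn.
      by apply: cvg_expr; rewrite ger0_norm ?invr_ge0 // invf_lt1 // ltr1n.
    rewrite mulr0 mul0r in c.
    have e2 : 0 < e ^+ 2 by rewrite exprn_gt0.
    have [N _ hN] : \forall n \near \oo, 2 * (2 ^- n) * fine (s x) < e ^+ 2 by exact: cvgr_lt c _ e2.
    by exists N; apply: hN => /=.
  exists N => n Nn; rewrite /h indicE xE !mulr1.
  rewrite -(@ltr_pXn2r _ 2) ?nnegrE ?cabs_ge0 ?ltW //.
  apply: le_lt_trans (tel' _ _ _ Nn) (le_lt_trans _ hN).
  by rewrite ler_wpM2l ?mulr_ge0 ?invr_ge0 ?exprn_ge0 // -lee_fin fineK.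
have mh n : cmeas (D : set lineT) (h n).
  by apply: cmeasM; [case/L2P: (lg n)|exact: cmeas_indic].
have mG : cmeas (D : set lineT) G by apply: (cmeas_cvg mh) => x _; exact: hG.
have bnd k x : D x -> ((cabs (g k x - G x) ^+ 2)%:E <= (2 * (2 ^+ k)^-1)%:E * s x)%E.
  move=> Dx; have p0 : 0 < 2 * (2 ^+ k)^-1 :> R by rewrite mulr_gt0 ?invr_gt0 ?exprn_gt0.
  have [sf|] := boolP (s x \is a fin_num); last first.
    by rewrite ge0_fin_numE // -leNgt leye_eq => /eqP ->; rewrite gt0_muley ?lte_fin // leey.
  have xE : x \in E by apply/mem_set.
  have c : cabs (h n x - g k x) ^+ 2 @[n --> \oo] --> cabs (G x - g k x) ^+ 2.
    by apply: cvg_sqr_cabs; apply: ccvgB; [exact: hG|exact: ccvg_cst].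
  rewrite -(fineK sf) -EFinM lee_fin cabs_distC -(cvg_lim _ c) //; apply: limr_le; first exact: cvgP c.
  near=> n; rewrite /h indicE xE mulr1.
  apply: le_trans (tel' k n x _) _; first by near: n; exact: nbhs_infty_ge.
  by rewrite ler_wpM2l ?mulr_ge0 ?invr_ge0 ?exprn_ge0 // -lee_fin fineK.
have mgG k : cmeas (D : set lineT) (fun x => g k x - G x) by apply: cmeasB => //; case/L2P: (lg k).
have nb k : (L2normsq (fun x => (g k x - G x)%R) <= (2 * (2 ^+ k)^-1 * (2 * C))%:E)%E.
  rewrite L2normsqE.
  apply: (@le_trans _ _ (\int[mu]_(x in D) ((2 * (2 ^+ k)^-1)%:E * s x)))%E.
    apply: ge0_le_integral => //.
    - by move=> x _; rewrite lee_fin sqr_ge0.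
    - by apply/measurable_EFinP; exact: measurable_sqr_cabs.
    - by apply: measurable_funeM.
    - by move=> x; exact: bnd.
  have p0 : (0 <= (2 * (2 ^+ k)^-1 : R)%:E)%E by rewrite lee_fin mulr_ge0 ?invr_ge0 ?exprn_ge0.
  by rewrite ge0_integralZl // [in X in (_ <= X)%E]EFinM lee_wpmul2l.
have lgG k : L2 (fun x => g k x - G x).
  by have [a b] := mgG k; split=> //; rewrite (le_lt_trans (nb k)) // ltry.
exists G.
  have := L2B (lg 0%N) (lgG 0%N); apply: eq_L2 => x _; by rewrite opprB addrC subrK.
have c : 2 * (2 ^- n) * (2 * C) @[n --> \oo] --> 2 * 0 * (2 * C).
  apply: cvgM; last exact: cvg_cst.
  apply: cvgM; first exact: cvg_cst.
  under eq_fun do rewrite -exprVn.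
  by apply: cvg_expr; rewrite ger0_norm ?invr_ge0 // invf_lt1 // ltr1n.
rewrite mulr0 mul0r in c.
apply: (squeeze_cvgr _ (cvg_cst 0) c); apply: nearW => n; rewrite n2_ge0 /=.
by rewrite -lee_fin -L2normsq_n2.
Unshelve. all: by end_near. Qed.

End RieszFischer.

(** * Smooth functions *)

Section Smooth.
Variable R : realType.
Implicit Types (f g : R -> R) (p : {poly R}).

(** A coinduction principle: a class of differentiable functions that is stable under derivation
    consists of smooth functions. It replaces explicit formulas for n-th derivatives. *)
Lemma smooth_coind (P : (R -> R) -> Prop) :
  (forall f, P f -> (forall t, derivable f t 1) /\ P (derive1 f)) ->
  forall f, P f -> smooth f.
Proof.
move=> h f Pf n; suff: P (derive1n n f) by case/h.
by elim: n => [|n ih]; rewrite ?derive1n0 // derive1nS; case/h: ih.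
Qed.

Lemma smooth_derivable f t : smooth f -> derivable f t 1.
Proof. by move=> /(_ 0%N t). Qed.
Lemma smooth_derive1 f : smooth f -> smooth (derive1 f).
Proof. by move=> h n t; rewrite -derive1Sn. Qed.
Lemma smooth_is_derive f (t : R) : smooth f -> is_derive t 1 f (derive1 f t).
Proof. by move=> /smooth_derivable h; rewrite derive1E; apply: derivableP. Qed.

Lemma derive1_eq f (df : R -> R) : (forall t : R, is_derive t 1 f (df t)) -> derive1 f = df.
Proof. by move=> h; apply/funext => t; rewrite derive1E; apply: derive_val. Qed.

Lemma smooth_cst (c : R) : smooth (fun=> c).
Proof.
apply: (@smooth_coind (fun f => exists c, f = fun=> c)); last by exists c.
move=> _ [{}c ->]; split; first by move=> t; exact: derivable_cst.
by exists 0; apply: derive1_eq => t; exact: is_derive_cst.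
Qed.
Lemma smooth_continuous f : smooth f -> continuous f.
Proof. by move=> h x; apply/differentiable_continuous/derivable1_diffP; exact: smooth_derivable. Qed.

Lemma smoothD f g : smooth f -> smooth g -> smooth (fun x => f x + g x).
Proof.
move=> sf sg; pose P (h : R -> R) := exists u v, [/\ smooth u, smooth v & h = fun x => u x + v x].
apply: (@smooth_coind P); last by exists f, g.
move=> _ [u [v [su sv ->]]]; split; first by move=> t; apply: derivableD; exact: smooth_derivable.
exists (derive1 u), (derive1 v); split; [exact: smooth_derive1|exact: smooth_derive1|].
by apply: derive1_eq => t; apply: is_deriveD; exact: smooth_is_derive.
Qed.

Lemma smoothZ (c : R) f : smooth f -> smooth (fun x => c * f x).
Proof.
move=> sf; pose P (h : R -> R) := exists2 u, smooth u & h = fun x => c * u x.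
apply: (@smooth_coind P); last by exists f.
move=> _ [u su ->]; split; first by move=> t; apply: derivableM => //; exact: smooth_derivable.
exists (derive1 u); first exact: smooth_derive1.
apply: derive1_eq => t; have h := smooth_is_derive t su.
exact: (is_deriveZ c h).
Qed.
(** By the Leibniz rule the derivative of a product is a sum of two products, so [smooth_coind]
    needs a class closed under sums. *)
Inductive prod_sum : (R -> R) -> Prop :=
| ps_mul u v : smooth u -> smooth v -> prod_sum (fun x => u x * v x)
| ps_add u v : prod_sum u -> prod_sum v -> prod_sum (fun x => u x + v x).

Lemma smoothM f g : smooth f -> smooth g -> smooth (fun x => f x * g x).
Proof.
move=> sf sg; apply: (@smooth_coind prod_sum); last exact: ps_mul.
move=> h; suff: prod_sum h -> exists2 dh, prod_sum dh & forall t : R, is_derive t 1 h (dh t).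
  move=> k /k[dh pd dhE]; split; first by move=> t; have := dhE t => ?; exact: ex_derive.
  by rewrite (derive1_eq dhE).
elim=> [u v su sv|u v _ [du pu du'] _ [dv pv dv']].
  exists (fun x => u x * derive1 v x + derive1 u x * v x).
    by apply: ps_add; apply: ps_mul; [exact: su|exact: smooth_derive1|exact: smooth_derive1|exact: sv].
  move=> t; have h1 := smooth_is_derive t su; have h2 := smooth_is_derive t sv.
  by apply: is_derive_eq; rewrite /GRing.scale /= [_ * v t]mulrC.
by exists (fun x => du x + dv x); [exact: ps_add|move=> t; exact: is_deriveD].
Qed.

(* [p(1/x) exp(-1/x)] for [x > 0], extended by [0]. *)
Definition flat p (x : R) : R := if 0 < x then p.[x^-1] * expR (- x^-1) else 0.

(** Termwise, [u^i <= i! * exp u] for [u >= 0]. *)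
Lemma horner_le_expR p : exists2 C, 0 <= C & forall u : R, 0 <= u -> `|p.[u]| <= C * expR u.
Proof.
exists (\sum_(i < size p) `|p`_i| * (i`!)%:R); first by apply: sumr_ge0 => i _; rewrite mulr_ge0.
move=> u u0; rewrite horner_coef (le_trans (ler_norm_sum _ _ _)) // mulr_suml.
apply: ler_sum => i _; rewrite normrM normrX (ger0_norm u0) -mulrA ler_wpM2l //.
case: (nat_of_ord i) => [|k].
  by rewrite expr0 mul1r -expR0 ler_expR.
have := expR_ge1Dxn k u0 => h.
have f0 : 0 < (k.+1)`!%:R :> R by rewrite ltr0n fact_gt0.
rewrite mulrC -ler_pdivrMr // (le_trans _ h) // lerDr //.
Qed.

(** Apply [horner_le_expR] to [p * 'X^2] at [1/x]. Quadratic smallness at [0] yields the derivative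
    [0] there. *)
Lemma flat_le p : exists2 C, 0 <= C & forall x, `|flat p x| <= C * x ^+ 2.
Proof.
have [C C0 h] := horner_le_expR (p * 'X^2); exists C => // x.
rewrite /flat; case: ifPn => x0; last by rewrite normr0 mulr_ge0 // sqr_ge0.
have := h x^-1; rewrite invr_ge0 => /(_ (ltW x0)); rewrite hornerM hornerXn normrM => k.
rewrite normrM [X in _ * X]ger0_norm ?expR_ge0 // expRN ler_pdivrMr ?expR_gt0 //.
rewrite mulrAC -ler_pdivrMr ?exprn_gt0 // (le_trans _ k) // exprVn.
by rewrite ler_wpM2l // [X in _ <= X]ger0_norm // invr_ge0 exprn_ge0 // ltW.
Qed.

(** By the chain rule the derivative of [p(1/x) exp (- 1/x)] is
    [(p - p')(1/x) * x^(-2) * exp (- 1/x)], so the functions [flat p] are stable under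
    derivation. *)
Definition dflat p : {poly R} := 'X^2 * (p - p^`()).

Lemma is_derive0_sqr f (C : R) : f 0 = 0 -> (forall x, `|f x| <= C * x ^+ 2) -> is_derive (0 : R) (1:R) f 0.
Proof.
move=> f0 fC.
have c : h^-1 *: (f (h *: 1 + 0) - f 0) @[h --> 0^'] --> (0 : R).
  have C0 : 0 <= C by have := fC 1; rewrite expr1n mulr1; exact/le_trans.
  apply/cvgr0Pnorm_le => e e0.
  near=> h; rewrite f0 subr0 addr0 /GRing.scale /= mulr1 normrM.
  have h0 : h != 0 by near: h; exact: nbhs_dnbhs_neq.
  have h1 : `|h| <= e / (C + 1).
    near: h; apply: dnbhs0_le; rewrite divr_gt0 // ltr_wpDl //.
  rewrite normfV ler_pdivrMl ?normr_gt0 // (le_trans (fC h)) //.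
  rewrite -real_normK ?num_real // expr2 mulrA mulrC ler_wpM2l //.
  rewrite (le_trans (ler_wpM2l C0 h1)) // mulrCA ger_pMr // ler_pdivrMr ?ltr_wpDl //; lra.
have d : derivable f 0 1 by apply/cvg_ex; exists 0.
by apply: DeriveDef => //; rewrite /derive; apply: cvg_lim.
Unshelve. all: by end_near. Qed.

Lemma is_derive_flat p (x : R) : is_derive x 1 (flat p) (flat (dflat p) x).
Proof.
have [x0|x0|->] := ltrgt0P x; last first.
- have [C _ h] := flat_le p; rewrite {2}/flat ltxx; apply: (is_derive0_sqr _ h).
  by rewrite /flat ltxx.
- rewrite /flat [0 < x]ltNge (ltW x0) /=.
  apply: (@near_eq_is_derive _ _ _ (fun=> 0)).
    near=> y; rewrite ifF //; apply/negbTE; rewrite -leNgt ltW //; near: y; exact: lt_nbhsl.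
- rewrite /flat x0 /=.
  apply: (@near_eq_is_derive R R R (fun y : R => p.[y^-1] * expR (- y^-1))).
    near=> y; rewrite ifT //; near: y; exact: lt_nbhsr.
  have xn : x != 0 by rewrite gt_eqF.
  have h1 : is_derive x 1 (fun y : R => y^-1) (- (x ^- 2)).
    by have := @is_deriveV R id x 1 1 xn (is_derive_id _ _); rewrite /GRing.scale /= mulr1.
  have h2 : is_derive x 1 (fun y : R => p.[y^-1]) (p^`().[x^-1] * - (x ^- 2)).
    apply: (is_derive_eq (is_derive1_comp (is_derive_poly p x^-1) h1)).
    by [].
  have h3 : is_derive x 1 (fun y : R => expR (- y^-1)) (expR (- x^-1) * x ^- 2).
    have h4 : is_derive x 1 (fun y : R => - y^-1) (x ^- 2).
      by apply: is_derive_eq; rewrite opprK.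
    exact: (@is_derive1_comp _ expR (fun y : R => - y^-1) x _ _ (is_derive_expR (- x^-1)) h4).
  apply: is_derive_eq; rewrite /GRing.scale /= /dflat hornerM hornerXn hornerD hornerN exprVn; ring.
Unshelve. all: by end_near. Qed.

Lemma smooth_flat_affine p a b : smooth (fun x => flat p (a * x + b)).
Proof.
pose P (h : R -> R) := exists q, h = fun x => flat q (a * x + b).
apply: (@smooth_coind P); last by exists p.
move=> _ [q ->].
have h (t : R) : is_derive t 1 (fun x => flat q (a * x + b)) (flat (a *: dflat q) (a * t + b)).
  have h1 : is_derive t 1 (fun x => a * x + b) a.
    by apply: is_derive_eq; rewrite /GRing.scale /= addr0 mulr1.
  have k := @is_derive1_comp _ (flat q) (fun x => a * x + b) t _ _ (is_derive_flat q (a * t + b)) h1.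
  apply: (is_derive_eq k).
  by rewrite /GRing.scale /= /flat; case: ifP => _; rewrite ?mul0r // hornerZ; ring.
split; first by move=> t; have := h t => ?; exact: ex_derive.
by exists (a *: dflat q); exact: derive1_eq.
Qed.

End Smooth.

(** * Density of the test functions *)

Import HBNNSimple.
Section TestFunctions.
Variable R : realType.
Local Notation Re := (@complex.Re R).
Local Notation Im := (@complex.Im R).
Local Notation mu := (@lebesgue_measure R).
Local Notation lineT := (measurableTypeR R).
Local Notation D := (@Rplus R).
Implicit Types (f g p q : R -> R[i]).
Let mD := @measurable_Rplus R.

Lemma test_support p : test_function p ->
  exists a c : R, [/\ 0 < a, a < c & forall x, x \notin `[a, c] -> p x = 0].
Proof.
move=> [_ _ [a a0 [c h]]]; exists a, (Num.max (a + 1) c); split=> //.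
  by rewrite lt_max ltrDl ltr01.
move=> x; rewrite in_itv /= le_max => xn; apply: h; rewrite in_itv /=.
by apply: contra xn => /andP[-> ->]; rewrite orbT.
Qed.

Lemma test_ccont p : test_function p -> ccont p.
Proof. by move=> [a b _] x; split; apply: smooth_continuous. Qed.

Lemma test_bounded p : test_function p -> exists M, forall x, cabs (p x) <= M.
Proof.
move=> tp; have [a [c [a0 ac p0]]] := test_support tp.
have cf : continuous (fun x => cabs (p x)) by move=> x; apply: cvg_cabs; exact: test_ccont.
have [t _ h] := EVT_max (ltW ac) (continuous_subspaceT cf).
exists (cabs (p t)) => x; have [/h //|/p0 ->] := boolP (x \in `[a, c]).
by rewrite cabs0 cabs_ge0.
Qed.

Lemma test_cmeas (A : set lineT) p : measurable A -> test_function p -> cmeas A p.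
Proof. by move=> mA tp; apply: ccont_cmeas => //; exact: test_ccont. Qed.

Lemma integrable_cst_indic (A : set lineT) (a c M : R) : measurable A ->
  mu.-integrable A (EFin \o (fun x => M * (\1_(`[a, c]%classic) x : R))).
Proof.
move=> mA; rewrite /comp; under eq_fun do rewrite EFinM.
apply: integrableZl => //; apply: (@integrableS _ lineT _ mu setT) => //.
exact: (integrable_indic_itv a c true false).
Qed.

Lemma test_L2 p : test_function p -> L2 p.
Proof.
move=> tp; have [a [c [a0 ac p0]]] := test_support tp.
have [M pM] := test_bounded tp.
apply/L2P; split; first exact: test_cmeas.
apply: (le_integrable mD _ _ (integrable_cst_indic a c (M ^+ 2) mD)).
  by apply/measurable_EFinP; apply: measurable_sqr_cabs; exact: test_cmeas.
move=> x _ /=; rewrite lee_fin indicE !ger0_norm; [|by rewrite mulr_ge0 ?sqr_ge0|exact: sqr_ge0].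
have [xE|xE] := boolP (x \in `[a, c]).
  by rewrite mem_set //= mulr1 ler_pXn2r ?nnegrE ?cabs_ge0 // (le_trans (cabs_ge0 _) (pM x)).
by rewrite p0 // cabs0 expr0n /= mulr_ge0 // sqr_ge0.
Qed.

Lemma test_lin (a : R[i]) p q : test_function p -> test_function q ->
  test_function (fun x => a * p x + q x).
Proof.
move=> tp tq; have [u [v [u0 uv p0]]] := test_support tp.
have [u' [v' [u0' uv' q0]]] := test_support tq.
case: tp => p1 p2 _; case: tq => q1 q2 _; split.
- under eq_fun do rewrite !cE -mulNr.
  by apply: smoothD q1; apply: smoothD; exact: smoothZ.
- under eq_fun do rewrite !cE.
  by apply: smoothD q2; apply: smoothD; exact: smoothZ.
exists (Num.min u u'); first by rewrite lt_min u0.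
exists (Num.max v v') => x; rewrite in_itv /= ge_min le_max => xn.
rewrite p0 ?q0 ?mulr0 ?addr0 // in_itv /=; apply: contra xn => /andP[-> ->]; by rewrite ?orbT.
Qed.
Lemma test0 : test_function (fun=> 0 : R[i]).
Proof.
split; try exact: smooth_cst.
by exists 1 => //; exists 1.
Qed.
Definition dtest p x : R[i] := derive1 (fun x => Re (p x)) x +i* derive1 (fun x => Im (p x)) x.
Lemma test_cderiv p x : test_function p -> cderiv p x (dtest p x).
Proof. by move=> [a b _]; split; [exact: (smooth_is_derive x a)|exact: (smooth_is_derive x b)]. Qed.
Lemma test_dtest p : test_function p -> test_function (dtest p).
Proof.
move=> tp; have [u [v [u0 uv p0]]] := test_support tp.
have [a b _] := tp; split; [exact: (smooth_derive1 a)|exact: (smooth_derive1 b)|].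
exists u => //; exists v => x xn.
have h : \forall y \near x, p y = 0.
  move: xn; rewrite in_itv /= negb_and -!ltNge => /orP[xu|vx]; near=> y; apply: p0; rewrite in_itv /= negb_and -!ltNge.
    by apply/orP; left; near: y; exact: lt_nbhsl.
  by apply/orP; right; near: y; exact: lt_nbhsr.
by rewrite /dtest !derive1E; apply: ceqP; rewrite /= -[RHS](@derive_cst _ _ _ (0:R) x 1);
  apply: near_eq_derive; apply: filterS h => y ->.
Unshelve. all: by end_near. Qed.

(** A smooth function supported in [[a, b]]; as [k] grows, both exponents tend to [0] at each
    interior point, so it tends to the indicator of []a, b[]. *)
Definition bump (k a b x : R) : R[i] :=
  (flat 1 (k * x + - (k * a)) * flat 1 (- k * x + k * b))%:C.

Lemma bumpE k a b x : 0 < k ->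
  bump k a b x = (if a < x < b then expR (- (k * (x - a))^-1) * expR (- (k * (b - x))^-1) else 0)%:C.
Proof.
move=> k0; rewrite /bump (_ : k * x + - (k * a) = k * (x - a)); last by ring.
rewrite (_ : - k * x + k * b = k * (b - x)); last by ring.
rewrite /flat !pmulr_rgt0 // !subr_gt0 !hornerC !mul1r.
by case: (a < x); case: (x < b); rewrite ?mul0r ?mulr0.
Qed.
Lemma test_bump k a b : 0 < k -> 0 < a -> test_function (bump k a b).
Proof.
move=> k0 a0; split.
- by apply: smoothM; exact: smooth_flat_affine.
- exact: smooth_cst.
exists a => //; exists b => x xn; rewrite bumpE // ifF //; apply/negbTE.
by apply: contra xn => /andP[u v]; rewrite in_itv /= !ltW.
Qed.

(** The closure of the test functions. The following lemmas enlarge it from bumps to intervals,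
    measurable sets, simple functions and finally all of [L2]. *)
Definition approx f := L2 f /\ forall e, 0 < e -> exists2 p, test_function p & n2 (fun x => p x - f x) <= e.

Lemma approx_test p : test_function p -> approx p.
Proof.
move=> tp; split; first exact: test_L2.
move=> e e0; exists p => //; rewrite (eq_n2 (g := fun=> 0)); last by move=> x _; rewrite subrr.
rewrite /n2; under eq_Rintegral do rewrite cabs0 expr0n /=.
by rewrite Rintegral_cst0 ltW.
Qed.

Lemma approx_lin (a : R[i]) f g : approx f -> approx g -> approx (fun x => a * f x + g x).
Proof.
move=> [lf hf] [lg hg]; split; first by apply: L2D => //; exact: L2Z.
move=> e e0; pose s := e / (4 * (cabs a ^+ 2 + 1)).
have c0 : 0 < cabs a ^+ 2 + 1 by rewrite ltr_wpDl // sqr_ge0.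
have [|p tp pf] := hf s; first by rewrite divr_gt0 // mulr_gt0.
have [|q tq qg] := hg (e / 4); first by rewrite divr_gt0.
exists (fun x => a * p x + q x); first exact: test_lin.
have lp := L2B (test_L2 tp) lf; have lq := L2B (test_L2 tq) lg.
have := n2D (L2Z a lp) lq; rewrite n2Z //.
rewrite (eq_n2 (g := fun x => a * p x + q x - (a * f x + g x))); last by move=> x _; ring.
move=> h; apply: (le_trans h).
have k : cabs a ^+ 2 * n2 (fun x => p x - f x) <= e / 4.
  apply: le_trans (ler_wpM2l (sqr_ge0 _) pf) _.
  rewrite /s invfM mulrA [e / 4]lock mulrA -lock -mulrA mulrC [X in X <= _](_ : _ = e / 4 * (cabs a ^+ 2 / (cabs a ^+ 2 + 1))); last by ring.
  by rewrite ger_pMr ?divr_gt0 // ler_pdivrMr // mul1r lerDl.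
lra.
Qed.

Lemma approx_cst0 : approx (fun=> 0).
Proof. by apply: approx_test; exact: test0. Qed.
Lemma approxZ (a : R[i]) f : approx f -> approx (fun x => a * f x).
Proof.
move=> /(@approx_lin a) /(_ approx_cst0); congr approx; apply/funext => x; exact: addr0.
Qed.
Lemma approxD f g : approx f -> approx g -> approx (fun x => f x + g x).
Proof. by move=> /(@approx_lin 1) h /h; congr approx; apply/funext => x; rewrite mul1r. Qed.
Lemma approxB f g : approx f -> approx g -> approx (fun x => f x - g x).
Proof. by move=> hf /(approxZ (-1)) /(approxD hf); congr approx; apply/funext => x; rewrite mulN1r. Qed.

Lemma eq_approx f g : (forall x, D x -> f x = g x) -> approx f -> approx g.
Proof.
move=> fg [lf hf]; split; first exact: eq_L2 lf.
move=> e /hf[p tp h]; exists p => //; rewrite (le_trans _ h) // le_eqVlt; apply/orP; left; apply/eqP.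
by apply: eq_n2 => x /fg ->.
Qed.

(** Dominated pointwise limits are limits in norm, since [|u_n - f|^2 <= 4 g], and the closure is
    closed under those. *)
Lemma approx_dct (u : nat -> R -> R[i]) f (g : R -> R) : (forall n, approx (u n)) ->
  cmeas (D : set lineT) f -> (forall x, D x -> ccvg \oo (u ^~ x) (f x)) ->
  mu.-integrable D (EFin \o g) -> (forall n x, D x -> cabs (u n x) ^+ 2 <= g x) -> approx f.
Proof.
move=> au mf uf ig ug.
have fg x : D x -> cabs (f x) ^+ 2 <= g x.
  move=> Dx; have c : cabs (u n x) ^+ 2 @[n --> \oo] --> cabs (f x) ^+ 2 by apply: cvg_sqr_cabs; exact: uf.
  by rewrite -(cvg_lim _ c) //; apply: limr_le; [exact: cvgP c|apply: nearW => n; exact: ug].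
have lf : L2 f.
  apply/L2P; split=> //; apply: (le_integrable mD _ _ ig).
    by apply/measurable_EFinP; exact: measurable_sqr_cabs.
  by move=> x Dx /=; rewrite lee_fin ger0_norm ?sqr_ge0 // (le_trans (fg x Dx)) // ler_norm.
have mu_ n : cmeas (D : set lineT) (u n) by have [/L2P[]] := au n.
have c : n2 (fun x => u n x - f x) @[n --> \oo] --> 0.
  apply: (@n2_dct _ u f (fun x => 4 * g x)) => //.
    by rewrite /comp; under eq_fun do rewrite EFinM; exact: integrableZl.
  move=> n {}x Dx; have := sqr_cabsD (u n x) (- f x); rewrite cabsN.
  by have := fg x Dx; have := ug n x Dx; lra.
split=> // e e0.
have e4 : 0 < e / 4 by rewrite divr_gt0.
have [N _ hN] : \forall n \near \oo, n2 (fun x => u n x - f x) < e / 4 by exact: cvgr_lt c _ e4.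
have [lN hu] := au N; have [p tp hp] := hu _ e4.
exists p => //; have := n2_tri (test_L2 tp) lN lf; have := hN N (leqnn _); lra.
Qed.

Definition ind (A : set R) (x : R) : R[i] := (\1_A x : R)%:C.

Lemma indT A x : A x -> ind A x = 1.
Proof. by move=> Ax; rewrite /ind indicE mem_set. Qed.
Lemma indF A x : ~ A x -> ind A x = 0.
Proof. by move=> Ax; rewrite /ind indicE memNset. Qed.

Lemma approx_itv (a b : R) : 0 < a -> approx (ind `]a, b[%classic).
Proof.
move=> a0; have [ba|ab] := leP b a.
  apply: eq_approx approx_cst0 => x _; rewrite /ind set_itv_ge ?indic0 // -leNgt bnd_simp //.
apply: (@approx_dct (fun n => bump n.+1%:R a b) _ (fun x => 1 * (\1_(`[a, b]%classic) x : R))).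
- by move=> n; apply: approx_test; exact: test_bump.
- by apply: cmeas_indic; exact: measurable_itv.
- move=> x _; rewrite /ind indicE; have [xE|xE] := boolP (a < x < b); last first.
    rewrite memNset; last by rewrite /= in_itv /= (negbTE xE).
    by under eq_fun do rewrite bumpE // (negbTE xE); exact: ccvg_cst.
  rewrite mem_set; last by rewrite /= in_itv.
  under eq_fun do rewrite bumpE // xE.
  have key (y : R) : 0 < y -> expR (- (n.+1%:R * y)^-1) @[n --> \oo] --> (1 : R).
    move=> y0; rewrite -[X in _ --> X](@expR0 R).
    apply: (@cvg_comp _ _ _ (fun n : nat => - (n.+1%:R * y)^-1) expR _ (nbhs (0 : R))); last exact: continuous_expR.
    have : - (n.+1%:R^-1 * y^-1) @[n --> \oo] --> - (0 * y^-1 : R).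
      by apply: cvgN; apply: cvgM; [exact: cvg_harmonic|exact: cvg_cst].
    by rewrite mul0r oppr0; under eq_fun do rewrite -invfM.
  move/andP: xE => [ax xb]; apply: ccvgC; rewrite -[X in _ --> X]mulr1.
  by apply: cvgM; apply: key; rewrite subr_gt0.
- exact: integrable_cst_indic.
- move=> n x _; rewrite bumpE // indicE; case: ifP => [/andP[ax xb]|_]; last first.
    by rewrite cabs0 expr0n mul1r.
  rewrite mem_set ?mulr1 /=; last by rewrite in_itv /= !ltW.
  rewrite cabsC ger0_norm ?mulr_ge0 ?expR_ge0 // -[X in _ <= X](expr1n _ 2) ler_pXn2r ?nnegrE ?mulr_ge0 ?expR_ge0 //.
  have key (y : R) : 0 <= y -> expR (- (n.+1%:R * y)^-1) <= 1.
    by move=> y0; rewrite -[X in _ <= X]expR0 ler_expR oppr_le0 invr_ge0 mulr_ge0.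
  by rewrite -[X in _ <= X]mulr1 ler_pM ?expR_ge0 // key // subr_ge0 ltW.
Qed.

(** These windows have finite length and stay away from [0], so their measurable subsets have
    indicators in [L2] and [approx_itv] applies to them. *)
Let I_ (n : nat) : set R := `]n.+1%:R^-1, n.+1%:R[%classic.
Let mI n : measurable (I_ n : set lineT). Proof. exact: measurable_itv. Qed.
Let inv_gt0 n : (0 : R) < n.+1%:R^-1. Proof. by rewrite invr_gt0. Qed.
Let integrable_I n : mu.-integrable D (EFin \o (\1_(I_ n) : R -> R)).
Proof.
apply: (le_integrable mD _ _ (integrable_cst_indic n.+1%:R^-1 n.+1%:R 1 mD)).
  by apply/measurable_EFinP; apply: measurable_funTS; exact: measurable_indic.
move=> x _ /=; rewrite mul1r lee_fin !ger0_norm ?indicE // ler_nat.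
have [/set_mem xI|//] := boolP (x \in I_ n); rewrite mem_set //.
by move: xI; rewrite /I_ /= !in_itv /= => /andP[u v]; rewrite !ltW.
Qed.

(** Dynkin induction from the rays []x, +oo[], which are stable under intersection; complements and
    unions are taken inside the window. *)
Lemma approx_measurable n (A : set lineT) : measurable A -> approx (ind (A `&` I_ n)).
Proof.
move=> mA.
have hm := RGenOInfty.measurableE R.
apply: (@dynkin_induction _ lineT (@RGenOInfty.G R) [set A | approx (ind (A `&` I_ n))] hm); last first.
- by move: mA; rewrite hm.
- move=> F mF tF PF /=.
  (* Partial unions: by disjointness each is the previous one plus one new indicator, and the
     indicator of the window dominates them all. *)
  pose U m := ind ((\bigcup_(k < m) F k) `&` I_ n).
  have UT m k x : (k < m)%N -> F k x -> I_ n x -> U m x = 1.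
    by move=> km Fx Ix; apply: indT; split=> //; exists k.
  have UF m x : ~ I_ n x -> U m x = 0 by move=> Ix; apply: indF => -[].
  have aU m : approx (U m).
    elim: m => [|m ih].
      by apply: eq_approx approx_cst0 => x _; rewrite /U indF // => -[[k]].
    apply: eq_approx (approxD ih (PF m)) => x _.
    have [Ix|Ix] := pselect (I_ n x); last first.
      by rewrite !UF // indF ?addr0 // => -[].
    have [Fx|Fx] := pselect (F m x).
      rewrite (UT m.+1 m) // [ind _ _]indT // [U m x]indF ?add0r // => -[[k /= km xk] _].
      have := tF k m I I (ex_intro _ x (conj xk Fx)) => km'.
      by rewrite km' ltnn in km.
    rewrite [ind _ _]indF ?addr0; last by case.
    have [[k km Fk]|nk] := pselect (exists2 k, (k < m)%N & F k x).
      by rewrite (UT m k) // (UT m.+1 k) // ltnS ltnW.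
    rewrite [U m x]indF; last by move=> [[k /= km Fk] _]; apply: nk; exists k.
    rewrite [U m.+1 x]indF // => -[[k /=]]; rewrite ltnS leq_eqVlt => /predU1P[->//|km Fk _].
    by apply: nk; exists k.
  apply: (@approx_dct U _ (\1_(I_ n))) => //.
  - by apply: cmeas_indic; apply: (@measurableI _ lineT); [exact: bigcupT_measurable|exact: mI].
  - move=> x _; have [Ix|Ix] := pselect (I_ n x); last first.
      by under eq_fun do rewrite UF //; rewrite indF; [exact: ccvg_cst|case].
    have [[k Fk]|nk] := pselect (exists k, F k x).
      rewrite indT; last by split=> //; exists k.
      have h : \forall m \near \oo, U m x = 1.
        by near=> m; apply: (UT m k) => //; near: m; exact: nbhs_infty_gt.
      by split; apply: cvg_near_cst; apply: filterS h => m ->.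
    rewrite indF; last by move=> [[k _ Fk] _]; apply: nk; exists k.
    rewrite (_ : U^~ x = fun=> 0); first exact: ccvg_cst.
    by apply/funext => m; apply: indF => -[[k _ Fk] _]; apply: nk; exists k.
  - move=> m x _; have [Ix|Ix] := pselect (I_ n x); last by rewrite UF // cabs0 expr0n indicE.
    rewrite [X in _ <= X]indicE mem_set // /U /ind cabsC indicE ger0_norm //.
    by case: (_ \in _) => /=; rewrite ?expr1n ?expr0n.
- move=> A0 mA0 /= PA; apply: eq_approx (approxB (approx_itv n.+1%:R (inv_gt0 n)) PA) => x _.
  have [Ix|Ix] := pselect (I_ n x); last first.
    by rewrite !indF ?subrr // => -[].
  have [Ax|Ax] := pselect (A0 x).
    by rewrite (@indT _ x) // (@indT _ x) // subrr indF // => -[].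
  by rewrite (@indT _ x) // (@indF _ x) ?subr0 ?indT // => -[].
- move=> _ [x ->] /=.
  apply: eq_approx (@approx_itv (Num.max x n.+1%:R^-1) n.+1%:R _) => [y _|]; last by rewrite lt_max inv_gt0 orbT.
  congr (ind _ _); apply/seteqP; split => z /=; rewrite /I_ /= !in_itv /= gt_max andbT.
    by move=> /andP[/andP[-> ->] ->].
  by move=> [-> /andP[-> ->]].
- by rewrite /= setTI; exact: approx_itv.
- move=> _ _ [x ->] [y ->]; exists (Num.max x y); apply/seteqP; split=> z /=; rewrite !in_itv /= !andbT gt_max; first by move=> [-> ->].
  by move/andP.
Unshelve. all: by end_near. Qed.

(** Simple functions increase to [r]. Each is cut off to the window [I_ n], which makes it a finite
    combination of the indicators just treated, and [r^2] dominates the squares. *)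
Lemma approx_nonneg (r : R -> R) : measurable_fun (D : set lineT) r ->
  mu.-integrable D (EFin \o (fun x => r x ^+ 2)) -> (forall x, D x -> 0 <= r x) ->
  approx (fun x => (r x)%:C).
Proof.
move=> mr ir r0.
have mr' : measurable_fun (D : set lineT) (EFin \o r) by apply/measurable_EFinP.
pose g : {nnsfun lineT >-> R}^nat := nnsfun_approx mD mr'.
have r0' x : D x -> (0 <= (EFin \o r) x)%E by move=> Dx; rewrite lee_fin r0.
have cg x : D x -> g n x @[n --> \oo] --> r x.
  by move=> Dx; have /fine_cvg := cvg_nnsfun_approx mD mr' r0' Dx.
have gr n x : D x -> g n x <= r x.
  move=> Dx; have c := cg x Dx; rewrite -(cvg_lim _ c) //.
  apply: (@nondecreasing_cvgn_le _ (fun n => g n x)); last exact: cvgP c.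
  by move=> i j ij; have /lefP := nd_nnsfun_approx mD mr' ij.
apply: (@approx_dct (fun n x => (g n x)%:C * ind (I_ n) x) _ (fun x => r x ^+ 2)) => //.
- move=> n.
  apply: eq_approx (_ : approx (fun x => \sum_(y <- finmap.enum_fset (fset_set (range (g n)))) y%:C * ind (g n @^-1` [set y] `&` I_ n) x)) => [x Dx|].
    rewrite fimfunE fsbig_finite //=.
    rewrite rmorph_sum /= mulr_suml; apply: eq_bigr => y _.
    by rewrite CM -mulrA /ind indicI /= CM.
  elim: (finmap.enum_fset _) => [|y s ih].
    by apply: eq_approx approx_cst0 => x _; rewrite big_nil.
  apply: eq_approx (approx_lin y%:C (approx_measurable n (measurable_sfunP (g n) (measurable_set1 y))) ih) => x _.
  by rewrite big_cons.
- move=> x Dx; rewrite -[X in ccvg _ _ X]mulr1; apply: ccvgM; first by apply: ccvgC; exact: cg.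
  have h : \forall n \near \oo, ind (I_ n) x = 1.
    near=> n; apply: indT; rewrite /I_ /= in_itv /=; apply/andP; split.
      rewrite invf_plt ?posrE //; apply: (@lt_trans _ _ n%:R); last by rewrite ltr_nat.
      by near: n; exact: nbhs_infty_gtr.
    apply: (@lt_trans _ _ n%:R); last by rewrite ltr_nat.
    by near: n; exact: nbhs_infty_gtr.
  by split; apply: cvg_near_cst; apply: filterS h => m ->.
- move=> n x Dx; rewrite cabsM /ind !cabsC !ger0_norm ?indicE //.
  have g0 : 0 <= g n x by exact: fun_ge0.
  have := gr n x Dx => gx.
  case: (_ \in _) => /=; last by rewrite mulr0 expr0n sqr_ge0.
  by rewrite mulr1 ler_pXn2r ?nnegrE // (le_trans g0).
Unshelve. all: by end_near. Qed.

Lemma approx_real (r : R -> R) : measurable_fun (D : set lineT) r ->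
  mu.-integrable D (EFin \o (fun x => r x ^+ 2)) -> approx (fun x => (r x)%:C).
Proof.
move=> mr ir.
have h (s : R -> R) : measurable_fun (D : set lineT) s -> (forall x, s x ^+ 2 = r x ^+ 2) ->
    approx (fun x => (Num.max (s x) 0)%:C).
  move=> ms sr; apply: approx_nonneg.
  - exact: measurable_maxr.
  - apply: (le_integrable mD _ _ ir).
      by apply/measurable_EFinP; apply: measurable_funX; exact: measurable_maxr.
    move=> x _ /=; rewrite lee_fin !ger0_norm ?sqr_ge0 // -sr.
    by rewrite maxEle; case: ifP => _; rewrite ?expr0n ?sqr_ge0.
  - by move=> x _; rewrite le_max lexx orbT.
have a1 := h r mr (fun=> erefl).
have a2 := h (fun x => - r x) (measurable_funN mr) (fun x => sqrrN (r x)).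
apply: eq_approx (approxB a1 a2) => x _; rewrite -rmorphB /=; congr (_ %:C).
by case: (leP (r x) 0) => rx; case: (leP (- r x) 0) => nrx; lra.
Qed.

Lemma approx_L2 f : L2 f -> approx f.
Proof.
move=> lf; have /L2P[[m1 m2] i] := lf.
have key (p : R[i] -> R) : (forall z, `|p z| <= cabs z) -> measurable_fun (D : set lineT) (fun x => p (f x)) ->
    approx (fun x => (p (f x))%:C).
  move=> pc mp; apply: approx_real => //; apply: (le_integrable mD _ _ i).
    by apply/measurable_EFinP; exact: measurable_funX.
  move=> x _ /=; rewrite lee_fin !ger0_norm ?sqr_ge0 // -[X in X <= _]real_normK ?num_real //.
  by rewrite ler_pXn2r ?nnegrE ?cabs_ge0.
apply: eq_approx (approx_lin (0 +i* 1) (key _ (@le_Im_cabs R) m2) (key _ (@le_Re_cabs R) m1)) => x _.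
by apply: ceqP; rewrite !cE /=; ring.
Qed.

(** The geometric rate is the one that [L2_complete] requires. *)
Lemma test_dense f : L2 f -> exists2 p : nat -> R -> R[i], (forall n, test_function (p n)) &
  forall n, n2 (fun x => p n x - f x) <= (4 ^+ n)^-1.
Proof.
move=> /approx_L2[_ h].
have k n : exists p, test_function p /\ n2 (fun x => p x - f x) <= (4 ^+ n)^-1.
  by have [|p] := h (4 ^+ n)^-1; [rewrite invr_gt0 exprn_gt0|exists p].
have [p hp] := choice k.
by exists p => n; case: (hp n).
Qed.

End TestFunctions.

(** * Unitary extension of a symmetric isometry *)

Section Extension.
Variable R : realType.
Local Notation Re := (@complex.Re R).
Local Notation Im := (@complex.Im R).
Local Notation mu := (@lebesgue_measure R).
Local Notation lineT := (measurableTypeR R).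
Local Notation D := (@Rplus R).
Implicit Types (f g p q G H : R -> R[i]).
Let mD := @measurable_Rplus R.

Lemma Im_L2dot_polar f g : L2 f -> L2 g ->
  Im (L2dot f g) = (n2 (fun x => (0 +i* 1) * g x + f x) - n2 f - n2 g) / 2.
Proof.
move=> lf lg; rewrite Im_L2dot // Re_L2dot //; last exact: L2Z.
rewrite n2Z // sqr_cabs /= expr0n expr1n add0r mul1r.
by rewrite (eq_n2 (g := fun x => (0 +i* 1) * g x + f x)) // => x _; rewrite addrC.
Qed.

Lemma Re_L2dot_polar f g : L2 f -> L2 g ->
  Re (L2dot f g) = (n2 (fun x => 1 * g x + f x) - n2 f - n2 g) / 2.
Proof.
move=> lf lg; rewrite Re_L2dot //.
by rewrite (eq_n2 (g := fun x => 1 * g x + f x)) // => x _; rewrite mul1r addrC.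
Qed.

Lemma n2_sub0 f : n2 (fun x => f x - f x) = 0.
Proof.
rewrite /n2; under eq_Rintegral do rewrite subrr cabs0 expr0n /=.
exact: Rintegral_cst0.
Qed.

Definition L2_to (u : nat -> R -> R[i]) f := n2 (fun x => u n x - f x) @[n --> \oo] --> 0.

Lemma L2_to_lin (a : R[i]) (u v : nat -> R -> R[i]) f g :
  (forall n, L2 (u n)) -> (forall n, L2 (v n)) -> L2 f -> L2 g ->
  L2_to u f -> L2_to v g -> L2_to (fun n x => a * u n x + v n x) (fun x => a * f x + g x).
Proof.
move=> lu lv lf lg uf vg.
have c : 2 * (cabs a ^+ 2 * n2 (fun x => u n x - f x)) + 2 * n2 (fun x => v n x - g x) @[n --> \oo] -->
    2 * (cabs a ^+ 2 * 0) + 2 * 0.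
  by apply: cvgD; do ?[apply: cvgM; first exact: cvg_cst].
rewrite !mulr0 addr0 in c; apply: (squeeze_cvgr _ (cvg_cst 0) c); apply: nearW => n; rewrite n2_ge0 /=.
rewrite -n2Z; last exact: L2B.
apply: le_trans (n2D (L2Z a (L2B (lu n) lf)) (L2B (lv n) lg)).
by rewrite le_eqVlt; apply/orP; left; apply/eqP; apply: eq_n2 => x _; ring.
Qed.

Lemma L2dot_lim (u v : nat -> R -> R[i]) f g :
  (forall n, L2 (u n)) -> (forall n, L2 (v n)) -> L2 f -> L2 g ->
  L2_to u f -> L2_to v g -> ccvg \oo (fun n => L2dot (u n) (v n)) (L2dot f g).
Proof.
move=> lu lv lf lg uf vg.
have key (a : R[i]) : (n2 (fun x => a * v n x + u n x) - n2 (u n) - n2 (v n)) / 2 @[n --> \oo] -->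
    (n2 (fun x => a * g x + f x) - n2 f - n2 g) / 2.
  apply: cvgM; last exact: cvg_cst.
  apply: cvgB; last by apply: n2_lim.
  apply: cvgB; last by apply: n2_lim.
  apply: n2_lim; [by move=> n; apply: L2D => //; exact: L2Z|by apply: L2D => //; exact: L2Z|].
  exact: L2_to_lin.
split; first by rewrite Re_L2dot_polar //; under eq_fun do rewrite Re_L2dot_polar //; exact: key.
by rewrite Im_L2dot_polar //; under eq_fun do rewrite Im_L2dot_polar //; exact: key.
Qed.

Variable T : (R -> R[i]) -> (R -> R[i]).
Hypothesis T_L2 : forall p, test_function p -> L2 (T p).
Hypothesis T_norm : forall p, test_function p -> n2 (T p) = n2 p.
Hypothesis T_lin : forall (a : R[i]) p q x, test_function p -> test_function q -> 0 < x ->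
  T (fun x => a * p x + q x) x = a * T p x + T q x.
Hypothesis T_sym : forall p q, test_function p -> test_function q ->
  L2dot (T p) (fun x => cconj (q x)) = L2dot p (fun x => cconj (T q x)).

(** The pair [(f, G)] lies in the closure of the graph of [T]. The properties of the extension are
    proved for this relation, so they hold for whichever representative is chosen later. *)
Definition ext_rel f G := L2 G /\
  exists p : nat -> R -> R[i], [/\ forall n, test_function (p n), L2_to p f & L2_to (T \o p) G].

Lemma ext_rel_ex f : L2 f -> exists G, ext_rel f G.
Proof.
move=> lf; have [p tp pf] := test_dense lf.
have lp n : L2 (p n) by exact: test_L2.
(* The constant: [2 / 4^(n+1) + 2 / 4^n <= 4 / 4^n]. *)
have [|n|G lG TG] := @L2_complete R (T \o p) 4.
- by move=> n; exact: T_L2.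
- have -> : n2 (fun x => (T \o p) n.+1 x - (T \o p) n x) = n2 (fun x => -1 * p n x + p n.+1 x).
    rewrite -[RHS](T_norm (test_lin (-1) (tp n) (tp n.+1))).
    by apply: eq_n2 => x Dx; rewrite /= T_lin // mulN1r addrC.
  rewrite (eq_n2 (g := fun x => p n.+1 x - p n x)); last by move=> x _; rewrite mulN1r addrC.
  apply: le_trans (n2_tri (lp n.+1) lf (lp n)) _.
  have := pf n.+1; have := pf n; rewrite (n2_distC f (p n)).
  have : (4 ^+ n.+1)^-1 <= (4 ^+ n)^-1 :> R.
    by rewrite lef_pV2 ?posrE ?exprn_gt0 // exprS ler_peMl ?exprn_ge0 // ler1n.
  set a := n2 _; set b := n2 _; lra.
exists G; split=> //; exists p; split=> //.
have c : (4 ^+ n)^-1 @[n --> \oo] --> (0 : R).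
  under eq_fun do rewrite -exprVn.
  by apply: cvg_expr; rewrite ger0_norm ?invr_ge0 // invf_lt1 // ltr1n.
by apply: (squeeze_cvgr _ (cvg_cst 0) c); apply: nearW => n; rewrite n2_ge0 /=.
Qed.

Lemma ext_rel_norm f G : L2 f -> ext_rel f G -> n2 G = n2 f.
Proof.
move=> lf [lG [p [tp pf pG]]].
have a := n2_lim (fun n => test_L2 (tp n)) lf pf.
have b := n2_lim (fun n => T_L2 (tp n)) lG pG.
have e : (fun n => n2 ((T \o p) n)) = (fun n => n2 (p n)) by apply/funext => n; exact: T_norm.
by rewrite e in b; rewrite -[LHS](cvg_lim _ b) // -[RHS](cvg_lim _ a).
Qed.

Lemma ext_rel_lin (a : R[i]) f g G H : L2 f -> L2 g -> ext_rel f G -> ext_rel g H ->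
  ext_rel (fun x => a * f x + g x) (fun x => a * G x + H x).
Proof.
move=> lf lg [lG [p [tp pf pG]]] [lH [q [tq qg qH]]].
split; first by apply: L2D => //; exact: L2Z.
exists (fun n x => a * p n x + q n x); split; first by move=> n; exact: test_lin.
  by apply: L2_to_lin => // n; exact: test_L2.
have := @L2_to_lin a _ _ _ _ (fun n => T_L2 (tp n)) (fun n => T_L2 (tq n)) lG lH pG qH.
rewrite /L2_to; under eq_fun => n.
  rewrite (eq_n2 (g := fun x => T (fun x => a * p n x + q n x) x - (a * G x + H x))); last by move=> x Dx; rewrite T_lin.
  over.
by [].
Qed.

(** Linearity and [ext_rel_norm] applied to the difference. This contains uniqueness up to a null
    set, continuity, and compatibility with almost everywhere equality. *)
Lemma ext_rel_sub f g G H : L2 f -> L2 g -> ext_rel f G -> ext_rel g H ->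
  n2 (fun x => G x - H x) = n2 (fun x => f x - g x).
Proof.
move=> lf lg rf rg; have := ext_rel_norm (L2D (L2Z (-1) lg) lf) (ext_rel_lin (-1) lg lf rg rf).
rewrite (eq_n2 (g := fun x => G x - H x)); last by move=> x _; rewrite mulN1r addrC.
by rewrite [RHS](eq_n2 (g := fun x => f x - g x)) // => x _; rewrite mulN1r addrC.
Qed.

Lemma ext_rel_sym f g G H : L2 f -> L2 g -> ext_rel f G -> ext_rel g H ->
  L2dot G (fun x => cconj (g x)) = L2dot f (fun x => cconj (H x)).
Proof.
move=> lf lg [lG [p [tp pf pG]]] [lH [q [tq qg qH]]].
have toJ (u : nat -> R -> R[i]) h : L2_to u h -> L2_to (fun n x => cconj (u n x)) (fun x => cconj (h x)).
  rewrite /L2_to => c; have -> // : (fun n => n2 (fun x => cconj (u n x) - cconj (h x))) = (fun n => n2 (fun x => u n x - h x)).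
  apply/funext => n; rewrite -[RHS]n2J; apply: eq_n2 => x _.
  by rewrite -mulN1r -[in RHS]mulN1r cJD cJM; congr (_ + _ * _); apply: ceqP; rewrite !cE ?oppr0.
have a := L2dot_lim (fun n => T_L2 (tp n)) (fun n => L2J (test_L2 (tq n))) lG (L2J lg) pG (toJ _ _ qg).
have b := L2dot_lim (fun n => test_L2 (tp n)) (fun n => L2J (T_L2 (tq n))) lf (L2J lH) pf (toJ _ _ qH).
rewrite -(ccvg_lim a) -(ccvg_lim b); congr climit; apply/funext => n; exact: T_sym.
Qed.

Lemma n2B f g : L2 f -> L2 g -> n2 (fun x => f x - g x) = n2 f + n2 g - 2 * Re (L2dot f g).
Proof.
move=> lf lg; have := Re_L2dot lf (L2N lg); rewrite n2N.
rewrite (_ : Re (L2dot f (fun x => - g x)) = - Re (L2dot f g)); first by lra.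
rewrite !L2dotE -ReN -(cintN mD (L2_mul lf (L2J lg))); congr Re; apply: eq_cint => x _.
by apply: ceqP; rewrite !cE; ring.
Qed.

Lemma L2_extension_unitary : exists S, L2_extension T S /\ L2_unitary S.
Proof.
(* The choice must be total; outside [L2] the function itself serves as a dummy value. *)
have k f : exists G, L2 f -> ext_rel f G.
  have [lf|nf] := pselect (L2 f); last by exists f.
  by have [G] := ext_rel_ex lf; exists G.
have [S hS] := choice k.
have lS f : L2 f -> L2 (S f) by move=> /hS[].
have isoB f g : L2 f -> L2 g -> n2 (fun x => S f x - S g x) = n2 (fun x => f x - g x).
  by move=> lf lg; apply: ext_rel_sub => //; exact: hS.
have isoL (a : R[i]) f g : L2 f -> L2 g -> n2 (fun x => a * S f x + S g x) = n2 (fun x => a * f x + g x).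
  move=> lf lg; apply: ext_rel_norm; first by apply: L2D => //; exact: L2Z.
  by apply: ext_rel_lin => //; exact: hS.
have iso f : L2 f -> n2 (S f) = n2 f by move=> lf; apply: ext_rel_norm => //; exact: hS.
have opS : L2_operator S.
  split=> [//|f g lf lg /(aeeq_n2 lf lg) fg].
  by apply/aeeq_n2; [exact: lS|exact: lS|rewrite isoB].
exists S; split; split=> //.
- move=> u f lu lf; suff -> : (fun n => L2normsq (S (u n) \- S f)) = (fun n => L2normsq (u n \- f)) by [].
  apply/funext => n; by rewrite !L2normsq_n2 ?isoB //; [exact: L2B|apply: L2B; exact: lS].
- move=> f tf; have lf := test_L2 tf.
  apply/aeeq_n2; [exact: lS|exact: T_L2|].
  rewrite (@ext_rel_sub f f) //; last 2 first.
  + exact: hS.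
  + split; first exact: T_L2.
    exists (fun=> f); split=> //; rewrite /L2_to.
      have -> : (fun n : nat => n2 (fun x => f x - f x)) = fun=> 0; last exact: cvg_cst.
      by apply/funext => n; exact: n2_sub0.
    have -> : (fun n : nat => n2 (fun x => (T \o (fun=> f)) n x - T f x)) = fun=> 0; last exact: cvg_cst.
    by apply/funext => n; exact: n2_sub0.
  exact: n2_sub0.
- move=> a f g lf lg; have lfg : L2 (fun x => a * f x + g x) by apply: L2D => //; exact: L2Z.
  apply/aeeq_n2; [exact: lS|by apply: L2D; [apply: L2Z; exact: lS|exact: lS]|].
  rewrite (@ext_rel_sub (fun x => a * f x + g x) (fun x => a * f x + g x)) //.
  + exact: n2_sub0.
  + exact: hS.
  + by apply: ext_rel_lin => //; exact: hS.
- move=> f g lf lg; apply: ceqP.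
    by rewrite !Re_L2dot_polar ?isoL ?iso //; exact: lS.
  by rewrite !Im_L2dot_polar ?isoL ?iso //; exact: lS.
- move=> g lg; pose g' x := cconj (g x); have lg' : L2 g' by exact: L2J.
  pose f x := cconj (S g' x); have lf : L2 f by apply: L2J; exact: lS.
  exists f => //; apply/aeeq_n2; [exact: lS|exact: lg|].
  have nf : n2 f = n2 g by rewrite n2J iso // n2J.
  (* By symmetry [<S f, g> = <f, f>], and [S f], [f], [g] have equal norms, so the squared distance
     is [|g|^2 + |g|^2 - 2 |g|^2 = 0]. *)
  rewrite n2B //; last exact: lS.
  have -> : L2dot (S f) g = L2dot f f.
    rewrite -[RHS](ext_rel_sym lf lg' (hS _ lf) (hS _ lg')).
    by congr L2dot; apply/funext => x; rewrite /g' cJK.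
  have -> : Re (L2dot f f) = n2 f.
    rewrite L2dotE Re_cint; apply: eq_Rintegral => x _; by rewrite mulcJ.
  by rewrite iso // nf; lra.
Qed.

End Extension.

(** * Mellin multipliers *)

Section MellinOperator.
Variable R : realType.
Local Notation Re := (@complex.Re R).
Local Notation Im := (@complex.Im R).
Local Notation mu := (@lebesgue_measure R).
Local Notation lineT := (measurableTypeR R).
Local Notation D := (@Rplus R).
Implicit Types (p q : R -> R[i]).
Let mD := @measurable_Rplus R.

Lemma test_bound_exp p : test_function p -> exists N M : R, [/\ 0 <= N, 0 <= M,
  forall x, x \notin `[expR (- N), expR N] -> p x = 0 & forall x, cabs (p x) <= M].
Proof.
move=> tp; have [a [c [a0 ac p0]]] := test_support tp; have [M pM] := test_bounded tp.
exists (Num.max `|ln a| `|ln c|), M; split; [by rewrite le_max normr_ge0|exact: le_trans (cabs_ge0 _) (pM 0)| |exact: pM].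
move=> x xn; apply: p0; apply: contra xn; rewrite !in_itv /= => /andP[ax xc].
have c0 : 0 < c by exact: lt_trans ac.
apply/andP; split.
  apply: le_trans ax; rewrite -[X in _ <= X](lnK a0) ler_expR lerNl.
  by rewrite le_max -normrN ler_norm.
by apply: le_trans xc _; rewrite -[X in X <= _](lnK c0) ler_expR le_max ler_norm orbT.
Qed.

Lemma cmeas_cont_Rplus (F : R -> R[i]) : (forall x : R, 0 < x -> ccvg (nbhs x) F (F x)) -> cmeas (D : set lineT) F.
Proof.
have DE : D = `]0, +oo[%classic by apply/seteqP; split => x; rewrite /Rplus /= in_itv /= andbT.
move=> cF; rewrite DE; split; apply: open_continuous_measurable_fun; try exact: interval_open.
  by move=> x /set_mem /=; rewrite in_itv /= andbT => /cF[].
by move=> x /set_mem /=; rewrite in_itv /= andbT => /cF[].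
Qed.

(** With [y = exp u], its integral over the line is the integral of [p(y) y^(a - 1) dy], the Mellin
    transform at [a]. *)
Definition logpull p (a : R[i]) (u : R) : R[i] := p (expR u) * cexp (a * u%:C).
Definition mellin p (a : R[i]) : R[i] := cint mu setT (logpull p a).

Lemma ccont_comp_expR (F : R -> R[i]) : ccont F -> ccont (fun u => F (expR u)).
Proof.
move=> cF u; have [a b] := cF (expR u).
by split; [apply: (cvg_comp _ _ _ a)|apply: (cvg_comp _ _ _ b)]; exact: continuous_expR.
Qed.
Lemma ccont_logpull p a : test_function p -> ccont (logpull p a).
Proof.
move=> tp u; apply: ccvgM; last exact: ccont_cexpM.
by apply: ccont_comp_expR; exact: test_ccont.
Qed.
Lemma logpull_le p : test_function p -> forall r : R, exists N M : R, [/\ 0 <= N, 0 <= M &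
  forall t u, cabs (logpull p (r +i* t) u) <= M * \1_(`[- N, N]%classic) u].
Proof.
move=> tp r; have [N [M [N0 M0 p0 pM]]] := test_bound_exp tp.
exists N, (M * expR (`|r| * N)); split=> //; first by rewrite mulr_ge0 ?expR_ge0.
move=> t u; rewrite indicE /logpull; have [un|un] := boolP (u \in `[- N, N]); last first.
  rewrite memNset ?mulr0; last by move/negP: un.
  by rewrite p0 ?mul0r ?cabs0 //; move: un; rewrite !in_itv /= !ler_expR.
rewrite mem_set // mulr1 cabsM ler_pM ?cabs_ge0 // cabs_cexp ler_expR !cE /= mulr0 subr0.
move: un; rewrite in_itv /= -ler_norml => un.
by rewrite (le_trans (ler_norm _)) // normrM ler_wpM2l.
Qed.
Let integrable_ind (N M : R) : mu.-integrable setT (EFin \o (fun x => M * (\1_(`[- N, N]%classic) x : R))).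
Proof. by apply: integrable_cst_indic. Qed.

Lemma cintegrable_logpull p a : test_function p -> cintegrable mu setT (logpull p a).
Proof.
case: a => r t tp; have [N [M [N0 M0 h]]] := logpull_le tp r.
apply: (cintegrable_leT _ (integrable_ind N M)); last exact: h.
by apply: ccont_cmeasT; exact: ccont_logpull.
Qed.
Lemma mellin_bound p (r : R) : test_function p ->
  exists2 C, 0 <= C & forall t, cabs (mellin p (r +i* t)) <= C.
Proof.
move=> tp; have [N [M [N0 M0 h]]] := logpull_le tp r.
exists (2 * \int[mu]_x (M * (\1_(`[- N, N]%classic) x : R))).
  by rewrite mulr_ge0 //; apply: Rintegral_ge0 => x _; rewrite mulr_ge0.
move=> t; apply: cint_leT (integrable_ind N M) (h t).
by apply: ccont_cmeasT; exact: ccont_logpull.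
Qed.

(** The integrands of the two terms add up to the derivative of [logpull p a], which has compact
    support. *)
Lemma mellin_ibp p a : test_function p -> a * mellin p a = - mellin (dtest p) (a + 1).
Proof.
move=> tp; have td := test_dtest tp.
have [N [M [N0 M0 p0 pM]]] := test_bound_exp tp.
(* Enlarging the window by [1] makes [p] vanish near every point outside, hence [dtest p] too, and
   makes [logpull p a] vanish at both endpoints. *)
have NN : - (N + 1) <= N + 1 by rewrite -subr_ge0; lra.
apply/eqP; rewrite -subr_eq0 opprK /mellin -cintZ //; last exact: cintegrable_logpull.
rewrite -cintD //; [|by apply: cintegrableZ => //; exact: cintegrable_logpull|exact: cintegrable_logpull].
have dp0 x : x \notin `[expR (- (N + 1)), expR (N + 1)] -> dtest p x = 0 /\ p x = 0.
  move=> xn; have [a' [c' [_ _ _]]] := test_support td.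
  have h : \forall y \near x, p y = 0.
    move: xn; rewrite in_itv /= negb_and -!ltNge => /orP[xu|vx]; near=> y; apply: p0; rewrite in_itv /= negb_and -!ltNge.
      apply/orP; left; apply: (@lt_trans _ _ (expR (- (N + 1)))); last by rewrite ltr_expR ltrN2; lra.
      by near: y; exact: lt_nbhsl.
    apply/orP; right; apply: (@lt_trans _ _ (expR (N + 1))); first by rewrite ltr_expR; lra.
    by near: y; exact: lt_nbhsr.
  split; last by exact: nbhs_singleton h.
  by rewrite /dtest !derive1E; apply: ceqP; rewrite /= -[RHS](@derive_cst _ _ _ (0:R) x 1);
    apply: near_eq_derive; apply: filterS h => y ->.
set F := fun u : R => _.
have FE u : F u = p (expR u) * (a * cexp (a * u%:C)) + (dtest p (expR u) * (expR u)%:C) * cexp (a * u%:C).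
  by rewrite /F /logpull mulrDl mul1r cexpD cexpC; ring.
have F0 u : u \notin `[- (N + 1), N + 1] -> F u = 0.
  move=> un; have [|u1 u2] := dp0 (expR u); first by move: un; rewrite !in_itv /= !ler_expR.
  by rewrite FE u1 u2 !mul0r addr0.
have -> : cint mu setT F = cint mu `[- (N + 1), N + 1] F.
  rewrite [RHS]cint_mkcond; apply: eq_cint => u _; rewrite indicE.
  have [h|h] := boolP (u \in `[- (N + 1), N + 1]); first by rewrite mem_set ?mulr1.
  by rewrite F0 // mul0r.
have cF : ccont F.
  move=> u; apply: ccvgD; last exact: ccont_logpull.
  by apply: ccvgM; [exact: ccvg_cst|exact: ccont_logpull].
rewrite (@cint_ftc _ (logpull p a)) //.
  have e (u : R) : p (expR u) = 0 -> logpull p a u = 0 by move=> h; rewrite /logpull h mul0r.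
  rewrite !e ?subrr // p0 // in_itv /= !ler_expR negb_and -!ltNge; apply/orP; [left|right]; lra.
move=> u _; rewrite FE addrC; apply: cderivM; last exact: cderiv_cexpM.
have [d1 d2] := test_cderiv (expR u) tp.
have de : is_derive u 1 (@expR R) (expR u) by exact: is_derive_expR.
have k1 := @is_derive1_comp _ _ _ _ _ _ d1 de; have k2 := @is_derive1_comp _ _ _ _ _ _ d2 de.
split; rewrite !cE /=; [rewrite mulr0 subr0|rewrite mulr0 add0r]; [exact: k1|exact: k2].
Unshelve. all: by end_near. Qed.

(** Two integrations by parts express [a (a + 1) mellin p a] as the Mellin transform of the second
    derivative at [a + 2], which is bounded, and [|a| |a + 1| >= t^2]. *)
Lemma mellin_decay p (r : R) : test_function p ->
  exists2 C, 0 <= C & forall t, cabs (mellin p (r +i* t)) <= C * (1 + t ^+ 2)^-1.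
Proof.
move=> tp; have td := test_dtest tp; have tdd := test_dtest td.
have [C1 C10 h1] := mellin_bound r tp.
have [C2 C20 h2] := mellin_bound (r + 1 + 1) tdd.
exists (C1 + C2); first exact: addr_ge0.
move=> t; rewrite ler_pdivlMr ?ltr_wpDr ?sqr_ge0 // mulrDr mulr1 lerD //.
set a := r +i* t.
have e : a * (a + 1) * mellin p a = mellin (dtest (dtest p)) ((r + 1 + 1) +i* t).
  rewrite [a * (a + 1)]mulrC -mulrA (mellin_ibp a tp) mulrN (mellin_ibp (a + 1) td) opprK.
  by congr mellin; apply: ceqP; rewrite /a !cE /= ?addr0.
have := h2 t; rewrite -e !cabsM; apply: le_trans.
rewrite mulrC ler_wpM2r ?cabs_ge0 //.
have i1 : `|t| <= cabs a by have := le_Im_cabs a.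
have i2 : `|t| <= cabs (a + 1) by have := le_Im_cabs (a + 1); rewrite !cE /= addr0.
by rewrite -real_normK ?num_real // expr2 ler_pM.
Qed.

(** The shift by [1] is the Jacobian [exp u] of the substitution [y = exp u]. *)
Lemma cint_mellin p b : test_function p ->
  cint mu D (fun y => p y * cexp ((ln y)%:C * b)) = mellin p (b + 1).
Proof.
move=> tp; have [N [M [N0 M0 p0 pM]]] := test_bound_exp tp.
rewrite (cint_exp N0).
- by apply: eq_cintT => u; rewrite expRK /logpull mulrDl mul1r cexpD cexpC mulrA [b * _]mulrC.
- move=> x x0; apply: ccvgM; first exact: test_ccont.
  apply: ccvg_cexp; apply: ccvgM; last exact: ccvg_cst.
  by apply: ccvgC; exact: continuous_ln.
- by move=> x /p0 ->; rewrite mul0r.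
Qed.

Lemma mellin_lin (a : R[i]) p q s : test_function p -> test_function q ->
  mellin (fun x => a * p x + q x) s = a * mellin p s + mellin q s.
Proof.
move=> tp tq; have ip := cintegrable_logpull s tp; have iq := cintegrable_logpull s tq.
rewrite /mellin -cintZ // -cintD //; last exact: cintegrableZ.
by apply: eq_cintT => u; rewrite /logpull; ring.
Qed.

Variables (m : R -> R[i]) (k : R).
Hypotheses (cm : ccont m) (m1 : forall t, cabs (m t) = 1) (k0 : 0 < k).

(** The line [Re = 1/2] is where the Mellin transform is isometric for Lebesgue measure. The scale
    [k], later [1 / gamma], matches the exponent in [(x y)^(1 / gamma)]. *)
Definition mhat p (t : R) : R[i] := mellin p (2^-1 +i* (k * t)).
Lemma mhatE p t : mhat p t = fourier (logpull p (2^-1)%:C) k t.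
Proof.
apply: eq_cintT => u; rewrite /logpull /expi -mulrA -cexpD; congr (_ * cexp _).
by apply: ceqP; rewrite !cE /=; ring.
Qed.
Lemma ccont_mhat p : test_function p -> ccont (mhat p).
Proof.
move=> tp; have -> : mhat p = fourier (logpull p (2^-1)%:C) k by apply/funext => t; exact: mhatE.
by apply: ccont_fourier; exact: cintegrable_logpull.
Qed.
Lemma mhat_decay p : test_function p -> exists2 C, 0 <= C & forall t, cabs (m t * mhat p t) <= C * (1 + t ^+ 2)^-1.
Proof.
move=> tp; have [C C0 h] := mellin_decay 2^-1 tp.
have k2 : 0 < 1 + k^-1 ^+ 2 by rewrite ltr_wpDr ?sqr_ge0.
(* From [1 + t^2 <= (1 + k^(-2)) (1 + k^2 t^2)]. *)
exists (C * (1 + k^-1 ^+ 2)); first by rewrite mulr_ge0 // ltW.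
move=> t; rewrite cabsM m1 mul1r (le_trans (h _)) // -mulrA ler_wpM2l //.
rewrite ler_pdivlMr ?ltr_wpDr ?sqr_ge0 // mulrC ler_pdivrMr ?ltr_wpDr ?sqr_ge0 //.
have -> : (1 + k^-1 ^+ 2) * (1 + (k * t) ^+ 2) = 1 + t ^+ 2 + ((k * t) ^+ 2 + k^-1 ^+ 2).
  by field; rewrite gt_eqF.
by rewrite lerDl addr_ge0 ?sqr_ge0.
Qed.

Definition mmul p t : R[i] := m t * mhat p t.
Lemma ccont_mmul p : test_function p -> ccont (mmul p).
Proof. by move=> tp t; apply: ccvgM; [exact: cm|exact: ccont_mhat]. Qed.
Lemma cintegrable_mmul p : test_function p -> cintegrable mu setT (mmul p).
Proof.
move=> tp; have [C C0 h] := mhat_decay tp.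
apply: (cintegrable_leT _ _ h); first by apply: ccont_cmeasT; exact: ccont_mmul.
by rewrite /comp; under eq_fun do rewrite EFinM; apply: integrableZl => //; exact: integrable_oneDsqrV.
Qed.
Lemma mmul_bound p : test_function p -> exists C, forall t, cabs (mmul p t) <= C.
Proof.
move=> tp; have [C C0 h] := mhat_decay tp; exists C => t; rewrite (le_trans (h t)) // ler_piMr //.
by rewrite invf_le1 ?lerDl ?sqr_ge0 // ltr_wpDr ?sqr_ge0.
Qed.

(** If [g] has Mellin transform [m * mhat p] on the line, then inversion gives [g(1/x) / x] here:
    the sign of [i k t ln x] is opposite to the one in the inversion formula for [g(x)]. *)
Definition mellin_op p (x : R) : R[i] :=
  (k / (2 * pi) * expR (- (ln x / 2)))%:C * fourier (mmul p) k (ln x).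

Lemma ccvg_mellin_op p (x : R) : test_function p -> 0 < x -> ccvg (nbhs x) (mellin_op p) (mellin_op p x).
Proof.
move=> tp x0; have cl : ln y @[y --> x] --> ln x by exact: continuous_ln.
apply: ccvgM.
  apply: ccvgC; apply: cvgM; first exact: cvg_cst.
  apply: (@cvg_comp _ _ _ (fun y => - (ln y / 2)) expR _ (nbhs (- (ln x / 2)))); last exact: continuous_expR.
  by apply: cvgN; apply: cvgM => //; exact: cvg_cst.
have [a b] := ccont_fourier k (cintegrable_mmul tp) (ln x).
by split; [exact: (cvg_comp _ _ cl a)|exact: (cvg_comp _ _ cl b)].
Qed.

(** After [x = exp u] the Jacobian cancels the squared factor [x^(-1/2)]. Plancherel is used twice,
    out of [mmul p] and back into [p], and the constants [(k / 2 pi)^2 * (2 pi / k)^2] cancel. *)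
Lemma mellin_op_normsq p : test_function p -> L2normsq (mellin_op p) = L2normsq p.
Proof.
move=> tp; rewrite !L2normsqE.
rewrite (@ge0_integral_exp _ (fun x => cabs (mellin_op p x) ^+ 2)); last 2 first.
- by move=> x x0; apply: cvg_sqr_cabs; exact: ccvg_mellin_op.
- by move=> x _; exact: sqr_ge0.
rewrite [RHS](@ge0_integral_exp _ (fun x => cabs (p x) ^+ 2)); last 2 first.
- by move=> x x0; apply: cvg_sqr_cabs; exact: test_ccont.
- by move=> x _; exact: sqr_ge0.
have p0 := pi_gt0 R.
have c1 : 0 <= k / (2 * pi) by rewrite divr_ge0 ?mulr_ge0 // ltW.
have E1 (f : R -> R[i]) : measurable_fun [set: lineT] (fun x => (cabs (f x) ^+ 2)%:E) -> forall a : R, 0 <= a ->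
    (\int[mu]_x (a%:E * (cabs (f x) ^+ 2)%:E) = a%:E * \int[mu]_x (cabs (f x) ^+ 2)%:E)%E.
  move=> mf a a0; apply: (@ge0_integralZl_EFin _ lineT) => //.
  by move=> x _; rewrite lee_fin sqr_ge0.
have mE (f : R -> R[i]) : ccont f -> measurable_fun [set: lineT] (fun x => (cabs (f x) ^+ 2)%:E).
  by move=> cf; apply/measurable_EFinP; apply: measurable_sqr_cabs; exact: ccont_cmeasT.
transitivity (\int[mu]_u (((k / (2 * pi)) ^+ 2)%:E * (cabs (fourier (mmul p) k u) ^+ 2)%:E))%E.
  apply: eq_integral => u _; rewrite -EFinM; congr (_%:E).
  have c2 : 0 <= k / (2 * pi) * expR (- (u / 2)) by rewrite mulr_ge0 ?expR_ge0.
  rewrite /mellin_op expRK cabsM cabsC ger0_norm // !exprMn.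
  rewrite -[expR (- _) ^+ 2]expRM_natl (_ : expR u = expR (- (2%:R * - (u / 2)))); last by congr expR; field.
  have E0 : expR (2 * - (u / 2)) != 0 by rewrite gt_eqF ?expR_gt0.
  by rewrite expRN mulrAC mulfK.
rewrite E1 ?sqr_ge0 //; last by apply: mE; apply: ccont_fourier; exact: cintegrable_mmul.
have [B hB] := mmul_bound tp.
rewrite (plancherel (ccont_mmul tp) hB (cintegrable_mmul tp) k0).
have -> : (\int[mu]_t (cabs (mmul p t) ^+ 2)%:E = \int[mu]_t (cabs (fourier (logpull p (2^-1)%:C) k t) ^+ 2)%:E)%E.
  by apply: eq_integral => t _; rewrite /mmul cabsM m1 mul1r mhatE.
have [N [M [N0 M0 h]]] := logpull_le tp 2^-1.
have h' t : cabs (logpull p (2^-1)%:C t) <= M.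
  apply: le_trans (h 0 t) _; rewrite ler_piMr // indicE; by case: (_ \in _).
rewrite (plancherel (ccont_logpull _ tp) h' (cintegrable_logpull _ tp) k0).
have P1 : (k / (2 * pi)) ^+ 2 * (2 * pi / k) * (2 * pi / k) = 1.
  have P0 : pi != 0 :> R by rewrite gt_eqF.
  have K0 : k != 0 by rewrite gt_eqF.
  by move: (pi : R) P0 => c P0; field; rewrite K0 P0.
rewrite !muleA -!EFinM P1 mul1e.
apply: eq_integral => u _; congr (_%:E).
rewrite /logpull cabsM cabs_cexp exprMn -expRM_natl; congr (_ * expR _).
by rewrite !cE /=; field.
Qed.

Lemma mellin_op_L2 p : test_function p -> L2 (mellin_op p).
Proof.
move=> tp; have [a b] := cmeas_cont_Rplus (fun x x0 => ccvg_mellin_op tp x0).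
by split=> //; rewrite mellin_op_normsq //; case: (test_L2 tp).
Qed.

Lemma mellin_op_norm p : test_function p -> n2 (mellin_op p) = n2 p.
Proof.
move=> tp; have := mellin_op_normsq tp.
by rewrite !L2normsq_n2; [case|exact: test_L2|exact: mellin_op_L2].
Qed.

Lemma mellin_op_lin (a : R[i]) p q x : test_function p -> test_function q ->
  mellin_op (fun x => a * p x + q x) x = a * mellin_op p x + mellin_op q x.
Proof.
move=> tp tq; rewrite /mellin_op mulrCA -mulrDr; congr (_ * _).
have mi F : cintegrable mu setT F -> cintegrable mu setT (fun t => F t * expi (k * t * ln x)).
  move=> iF; apply: (cintegrable_leT _ (cintegrable_cabs measurableT iF)).
    apply: cmeasM; first exact: cintegrable_cmeas iF.
    by apply: cmeas_expi; apply: measurable_funM => //; exact: measurable_funM.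
  by move=> t; rewrite cabsM cabs_expi mulr1.
have ip := mi _ (cintegrable_mmul tp); have iq := mi _ (cintegrable_mmul tq).
rewrite /fourier -cintZ // -cintD //; last exact: cintegrableZ.
by apply: eq_cintT => u; rewrite /mmul /mhat mellin_lin //; ring.
Qed.

(** The right-hand side is symmetric in [p] and [q]. The pairing has no conjugate because both
    transforms are taken at the same [t]. *)
Lemma mellin_op_pair p q : test_function p -> test_function q ->
  cint mu D (fun x => mellin_op p x * q x) =
  (k / (2 * pi))%:C * cint mu setT (fun t => m t * mhat p t * mhat q t).
Proof.
move=> tp tq; have [N [M [N0 M0 q0 qM]]] := test_bound_exp tq.
rewrite (cint_exp N0); last 2 first.
- by move=> x x0; apply: ccvgM; [exact: ccvg_mellin_op|exact: test_ccont].
- by move=> x /q0 ->; rewrite mulr0.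
have iq := cintegrable_logpull (2^-1)%:C tq.
have ip := cintegrable_mmul tp.
have m1' : measurable_fun [set: lineT * lineT] fst by exact: measurable_fst.
have m2' : measurable_fun [set: lineT * lineT] snd by exact: measurable_snd.
have mc (f : R -> R[i]) (r : R * R -> R) : cmeas [set: lineT] f -> measurable_fun [set: lineT * lineT] r -> cmeas [set: lineT * lineT] (fun z => f (r z)).
  by move=> [u v] mr; split; [exact: (measurableT_comp u)|exact: (measurableT_comp v)].
pose F z := logpull q (2^-1)%:C z.1 * (mmul p z.2 * expi (k * z.2 * z.1)).
have mF : cmeas [set: lineT * lineT] F.
  apply: cmeasM; first by apply: mc => //; exact: cintegrable_cmeas iq.
  apply: cmeasM; first by apply: mc => //; exact: cintegrable_cmeas ip.
  by apply: cmeas_expi; apply: measurable_funM => //; exact: measurable_funM.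
have Fle u t : cabs (F (u, t)) <= cabs (logpull q (2^-1)%:C u) * cabs (mmul p t).
  by rewrite /F !cabsM cabs_expi mulr1.
have key := @cint_fubini _ _ _ lineT lineT mu mu (fun u => cabs (logpull q (2^-1)%:C u)) (fun t => cabs (mmul p t))
  (cintegrable_cabs measurableT iq) (cintegrable_cabs measurableT ip) F mF Fle.
have ic := @cintegrable_cint _ _ _ lineT lineT mu mu (fun u => cabs (logpull q (2^-1)%:C u)) (fun t => cabs (mmul p t))
  (cintegrable_cabs measurableT iq) (cintegrable_cabs measurableT ip) F mF Fle.
have iE (f : R -> R[i]) (g : R -> R -> R) : measurable_fun [set: lineT * lineT] (fun z => g z.1 z.2) -> cintegrable mu setT f ->
    forall u, cintegrable mu setT (fun t => f t * expi (g u t)).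
  move=> mg jf u; apply: (cintegrable_leT _ (cintegrable_cabs measurableT jf)).
    apply: cmeasM; first exact: cintegrable_cmeas jf.
    by apply: cmeas_expi; exact: (measurableT_comp mg (measurable_pair1 u)).
  by move=> t; rewrite cabsM cabs_expi mulr1.
have mg1 : measurable_fun [set: lineT * lineT] (fun z => k * z.2 * z.1).
  by apply: measurable_funM; [apply: measurable_funM; [exact: measurable_cst|exact: m2']|exact: m1'].
transitivity ((k / (2 * pi))%:C * cint mu setT (fun u => cint mu setT (fun t => F (u, t)))).
  rewrite -(@cintZ _ _ lineT mu setT _ _ measurableT ic); apply: eq_cintT => u.
  have hF : cint mu setT (fun t => F (u, t)) = logpull q (2^-1)%:C u * fourier (mmul p) k u :=
    @cintZ _ _ lineT mu setT _ (logpull q (2^-1)%:C u) measurableT (iE _ (fun u t => k * t * u) mg1 ip u).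
  rewrite [in RHS](hF : cint mu [set: lineT] _ = _) /mellin_op expRK CM.
  rewrite /logpull -[in (expR u)%:C]cexpC.
  (* The Jacobian [exp u] splits in two halves: one belongs to [logpull q (1/2)], the other cancels
     the factor [x^(-1/2)] of [mellin_op]. *)
  have -> : cexp u%:C = cexp ((2^-1)%:C * u%:C) * cexp (u / 2)%:C.
    have e : 2^-1 * u + u / 2 = u by field.
    rewrite -[in LHS]e rmorphD cexpD [X in cexp X * _]CM; reflexivity.
  rewrite -(cexpC (- (u / 2))).
  have h : cexp (u / 2)%:C * cexp (- (u / 2))%:C = 1 :> R[i].
    by rewrite -cexpD -rmorphD /= subrr cexp0.
  move: h; set A := fourier _ _ _; set B := cexp (_ * _); set C := cexp (u / 2)%:C; set E := cexp (- _)%:C.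
  move=> h; rewrite -[RHS]mulr1 -h; ring.
rewrite key; apply: (f_equal (fun z => (k / (2 * pi))%:C * z)); apply: eq_cintT => t.
transitivity (cint mu setT (fun u => mmul p t * (logpull q (2^-1)%:C u * expi (k * u * t)))).
  by apply: eq_cintT => u; rewrite /F /= [k * t * u]mulrAC; ring.
rewrite (@cintZ _ _ lineT mu setT _ _ measurableT (iE _ (fun t u => k * u * t) mg1 iq t)).
rewrite [mhat q t]mhatE /mmul /fourier; reflexivity.
Qed.

Lemma mellin_op_sym p q : test_function p -> test_function q ->
  L2dot (mellin_op p) (fun x => cconj (q x)) = L2dot p (fun x => cconj (mellin_op q x)).
Proof.
move=> tp tq; rewrite !L2dotE.
transitivity (cint mu D (fun x => mellin_op p x * q x)).
  by apply: eq_cint => x _; rewrite cJK.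
transitivity (cint mu D (fun x => mellin_op q x * p x)); last first.
  by apply: eq_cint => x _; rewrite cJK mulrC.
rewrite (mellin_op_pair tp tq) (mellin_op_pair tq tp).
by apply: (f_equal (fun z => (k / (2 * pi))%:C * z)); apply: eq_cintT => t; rewrite mulrAC.
Qed.

Lemma mellin_op_unitary : exists S, L2_extension mellin_op S /\ L2_unitary S.
Proof.
apply: L2_extension_unitary.
- exact: mellin_op_L2.
- exact: mellin_op_norm.
- by move=> a p q x tp tq _; exact: mellin_op_lin.
- exact: mellin_op_sym.
Qed.

End MellinOperator.

(** * Moving the contour *)

Lemma itv01_0 (R : realType) : 0 <= (0 : R) <= 1.
Proof. by rewrite lexx ler01. Qed.
Lemma itv01_1 (R : realType) : 0 <= (1 : R) <= 1.
Proof. by rewrite lexx ler01. Qed.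

Section ContourShift.
Variable R : realType.
Local Notation Re := (@complex.Re R).
Local Notation Im := (@complex.Im R).
Local Notation mu := (@lebesgue_measure R).
Local Notation lineT := (measurableTypeR R).

Lemma cmeasV d (T : measurableType d) (A : set T) (F : T -> R[i]) :
  cmeas A F -> cmeas A (fun x => (F x)^-1).
Proof.
(* The conjugate over the squared modulus; the real inverse is written as a power with exponent
   [-1], which is measurable and is [0] at [0]. *)
move=> mF; have e x : (F x)^-1 = cconj (F x) * ((cabs (F x) ^+ 2) `^ (-1))%:C.
  rewrite powR_inv1 ?sqr_ge0 // sqr_cabs; apply: ceqP; rewrite (ReV, ImV) !cE /=; ring.
have -> : (fun x => (F x)^-1) = (fun x => cconj (F x) * ((cabs (F x) ^+ 2) `^ (-1))%:C).
  by apply/funext => x; exact: e.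
apply: cmeasM; first exact: cmeasJ.
apply: cmeasC; apply: (measurableT_comp (measurable_powR (-1))).
exact: measurable_sqr_cabs.
Qed.

(* [F'] plays the role of the complex derivative of [F], tested along curves
   that pass through [U]. *)
Definition nice (U : set R[i]) (F F' : R[i] -> R[i]) : Prop := [/\
  forall (z : R -> R[i]) x w, U (z x) -> cderiv z x w -> cderiv (fun t => F (z t)) x (F' (z x) * w),
  forall (z : R -> R[i]) x, U (z x) -> ccvg (nbhs x) z (z x) ->
    ccvg (nbhs x) (fun t => F (z t)) (F (z x)) /\ ccvg (nbhs x) (fun t => F' (z t)) (F' (z x)),
  forall z : lineT * lineT -> R[i], cmeas setT z ->
    cmeas setT (fun x => F (z x)) /\ cmeas setT (fun x => F' (z x)) &
  forall B, exists M, forall s, U s -> cabs s <= B -> cabs (F s) <= M /\ cabs (F' s) <= M].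

Section Closure.
Variable U : set R[i].

Lemma nice_cst (a : R[i]) : nice U (fun=> a) (fun=> 0).
Proof.
split.
- by move=> z x w _ _; rewrite mul0r; exact: cderiv_cst.
- by move=> z x _ _; split; exact: ccvg_cst.
- by move=> z _; split; exact: cmeas_cst.
- by move=> B; exists (cabs a) => s _ _; rewrite cabs0 cabs_ge0.
Qed.

Lemma nice_affine (a b : R[i]) : nice U (fun s => a * s + b) (fun=> a).
Proof.
split.
- move=> z x w _ dz.
  have := cderivD (cderivM (cderiv_cst a x) dz) (cderiv_cst b x).
  by rewrite mul0r add0r addr0.
- move=> z x _ cz; split; last exact: ccvg_cst.
  by apply: ccvgD; [apply: ccvgM => //; exact: ccvg_cst|exact: ccvg_cst].
- move=> z mz; split; last exact: cmeas_cst.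
  by apply: cmeasD; [apply: cmeasM => //; exact: cmeas_cst|exact: cmeas_cst].
- move=> B; exists (cabs a * B + cabs b + cabs a) => s _ sB; split.
    by rewrite (le_trans (cabsD _ _)) // cabsM ler_wpDr ?cabs_ge0 // lerD2r ler_wpM2l ?cabs_ge0.
  have B0 : 0 <= B := le_trans (cabs_ge0 _) sB.
  by rewrite lerDr addr_ge0 ?mulr_ge0 ?cabs_ge0.
Qed.

Lemma niceM F F' G G' : nice U F F' -> nice U G G' ->
  nice U (fun s => F s * G s) (fun s => F' s * G s + F s * G' s).
Proof.
move=> [dF cF mF bF] [dG cG mG bG]; split.
- move=> z x w Uz dz; have := cderivM (dF _ _ _ Uz dz) (dG _ _ _ Uz dz).
  by congr cderiv; rewrite mulrDl; ring.
- move=> z x Uz cz; have [f1 f2] := cF _ _ Uz cz; have [g1 g2] := cG _ _ Uz cz.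
  by split; [exact: ccvgM|apply: ccvgD; exact: ccvgM].
- move=> z mz; have [f1 f2] := mF _ mz; have [g1 g2] := mG _ mz.
  by split; [exact: cmeasM|apply: cmeasD; exact: cmeasM].
- move=> B; have [M hM] := bF B; have [N hN] := bG B.
  exists (M * N + M * N) => s Us sB; have [f1 f2] := hM s Us sB; have [g1 g2] := hN s Us sB.
  have MN : 0 <= M * N by rewrite mulr_ge0 // (le_trans (cabs_ge0 _) f1, le_trans (cabs_ge0 _) g1).
  split; first by rewrite cabsM ler_wpDr // ler_pM ?cabs_ge0.
  by rewrite (le_trans (cabsD _ _)) // !cabsM lerD // ler_pM ?cabs_ge0.
Qed.

Lemma nice_cexp F F' : nice U F F' -> nice U (fun s => cexp (F s)) (fun s => F' s * cexp (F s)).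
Proof.
move=> [dF cF mF bF]; split.
- move=> z x w Uz dz; have := cderiv_cexp (dF _ _ _ Uz dz).
  by congr cderiv; rewrite mulrAC.
- move=> z x Uz cz; have [f1 f2] := cF _ _ Uz cz.
  by split; [exact: ccvg_cexp|apply: ccvgM => //; exact: ccvg_cexp].
- move=> z mz; have [f1 f2] := mF _ mz.
  by split; [exact: cmeas_cexp|apply: cmeasM => //; exact: cmeas_cexp].
- move=> B; have [M hM] := bF B; exists (expR M + M * expR M) => s Us sB.
  have [f1 f2] := hM s Us sB; have M0 : 0 <= M := le_trans (cabs_ge0 _) f1.
  have h : cabs (cexp (F s)) <= expR M.
    by rewrite cabs_cexp ler_expR (le_trans _ f1) // (le_trans (ler_norm _)) // le_Re_cabs.
  split; first by rewrite ler_wpDr // mulr_ge0 ?expR_ge0.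
  by rewrite cabsM ler_wpDl ?expR_ge0 // ler_pM ?cabs_ge0.
Qed.

Lemma niceV (d : R) F F' : 0 < d -> (forall s, U s -> d <= cabs (F s)) -> nice U F F' ->
  nice U (fun s => (F s)^-1) (fun s => - F' s * (F s)^-1 ^+ 2).
Proof.
move=> d0 dU [dF cF mF bF].
have F0 s : U s -> F s != 0.
  by move=> /dU h; apply/eqP => e; move: h; rewrite e cabs0 leNgt d0.
split.
- move=> z x w Uz dz; have := cderivV (F0 _ Uz) (dF _ _ _ Uz dz).
  by congr cderiv; ring.
- move=> z x Uz cz; have [f1 f2] := cF _ _ Uz cz.
  have v : ccvg (nbhs x) (fun t => (F (z t))^-1) (F (z x))^-1 by exact: ccvgV (F0 _ Uz) f1.
  split; first exact: v.
  apply: ccvgM; first exact: ccvgN.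
  exact: (ccvgM v v).
- move=> z mz; have [f1 f2] := mF _ mz; have v := cmeasV f1.
  split=> //; apply: cmeasM; first exact: cmeasN.
  by under eq_fun do rewrite expr2; exact: cmeasM.
- move=> B; have [M hM] := bF B; exists (d^-1 + M * d^-1 ^+ 2) => s Us sB.
  have [f1 f2] := hM s Us sB; have M0 : 0 <= M := le_trans (cabs_ge0 _) f1.
  have h : cabs (F s)^-1 <= d^-1.
    by rewrite cabsV lef_pV2 ?posrE ?dU //; exact: lt_le_trans (dU _ Us).
  have dv : 0 <= d^-1 by rewrite invr_ge0 ltW.
  split; first by rewrite ler_wpDr // mulr_ge0 ?sqr_ge0.
  rewrite cabsM cabsN ler_wpDl // ler_pM ?cabs_ge0 // !expr2 cabsM ler_pM ?cabs_ge0 //.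
Qed.

Lemma nice_prod (F : nat -> R[i] -> R[i]) n : (forall k : nat, exists F', nice U (F k) F') ->
  exists F', nice U (fun s => \prod_(0 <= k < n) F k s) F'.
Proof.
move=> h; elim: n => [|n [G hG]].
  exists (fun=> 0); have := nice_cst 1; congr nice; apply/funext => s; by rewrite big_nil.
have [H hH] := h n; exists (fun s => G s * F n s + (\prod_(0 <= k < n) F k s) * H s).
have := niceM hG hH; congr nice; apply/funext => s; by rewrite big_nat_recr.
Qed.

End Closure.

Variables (U : set R[i]) (E E' : R[i] -> R[i]) (psi : R -> R) (g : R -> R) (K B : R).
Hypotheses (nE : nice U E E')
  (dpsi : forall t : R, is_derive t 1 psi (derive1 psi t)) (cdpsi : continuous (derive1 psi))
  (psiB : forall t, `|psi t| <= B) (dpsiB : forall t, `|derive1 psi t| <= B)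
  (Upsi : forall r t, 0 <= r <= 1 -> U (((1 - r) * psi t) +i* t))
  (Eg : forall r t, 0 <= r <= 1 -> cabs (E (((1 - r) * psi t) +i* t)) <= K * g t)
  (ig : mu.-integrable setT (EFin \o g))
  (gp : g n%:R @[n --> \oo] --> 0) (gn : g (- n%:R) @[n --> \oo] --> 0).

(** The linear homotopy from the given curve at [r = 0] to the imaginary axis at [r = 1]. *)
Let path r t : R[i] := ((1 - r) * psi t) +i* t.
Let speed r t : R[i] := ((1 - r) * derive1 psi t) +i* 1.
Let C r t : R[i] := E' (path r t) * (- (psi t)%:C) * speed r t + E (path r t) * - (derive1 psi t)%:C.

Let cpsi : continuous psi.
Proof. by move=> t; have := dpsi t => -[h _]; apply/differentiable_continuous/derivable1_diffP. Qed.

Let path_dr r t : cderiv (fun r => path r t) r (- (psi t)%:C).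
Proof.
split; rewrite !cE /=; last first.
  by rewrite oppr0; exact: is_derive_cst.
by apply: is_derive_eq; rewrite /GRing.scale /=; ring.
Qed.
Let speed_dr r t : cderiv (fun r => speed r t) r (- (derive1 psi t)%:C).
Proof.
split; rewrite !cE /=; last first.
  by rewrite oppr0; exact: is_derive_cst.
by apply: is_derive_eq; rewrite /GRing.scale /=; ring.
Qed.
Let path_dt r t : cderiv (path r) t (speed r t).
Proof.
have h := dpsi t.
split => /=; last exact: is_derive_id.
exact: (is_deriveZ (1 - r) h).
Qed.

(* Both sides of the homotopy identity d/dr (E(s) ds/dt) = d/dt (E(s) ds/dr) = C. *)
Let CE_r r t : 0 <= r <= 1 -> cderiv (fun r => E (path r t) * speed r t) r (C r t).
Proof.
move=> r01; have [dE _ _ _] := nE.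
exact: (cderivM (dE (fun r => path r t) r _ (Upsi t r01) (path_dr r t)) (speed_dr r t)).
Qed.
Let CE_t r t : 0 <= r <= 1 -> cderiv (fun t => E (path r t) * - (psi t)%:C) t (C r t).
Proof.
move=> r01; have [dE _ _ _] := nE.
have dp : cderiv (fun t => - (psi t)%:C) t (- (derive1 psi t)%:C).
  have := cderivM (cderiv_cst (-1) t) (cderivC (dpsi t)).
  by rewrite mul0r add0r mulN1r; congr cderiv; apply/funext => x; rewrite mulN1r.
have := cderivM (dE (path r) t _ (Upsi t r01) (path_dt r t)) dp.
by congr cderiv; rewrite /C; congr (_ + _); rewrite mulrAC.
Qed.

Let cC_r (r t : R) : 0 <= r <= 1 -> ccvg (nbhs r) (fun r => C r t) (C r t).
Proof.
move=> r01; have [_ cE _ _] := nE.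
have [c1 c2] := cE (fun r => path r t) r (Upsi t r01) (cderiv_ccvg (path_dr r t)).
apply: ccvgD; last by apply: ccvgM => //; exact: ccvg_cst.
apply: ccvgM; last exact: (cderiv_ccvg (speed_dr r t)).
by apply: ccvgM => //; exact: ccvg_cst.
Qed.
Let cspeed (r t : R) : ccvg (nbhs t) (speed r) (speed r t).
Proof.
split => /=; last exact: cvg_cst.
by apply: cvgM; [exact: cvg_cst|exact: cdpsi].
Qed.
Let cC_t (r t : R) : 0 <= r <= 1 -> ccvg (nbhs t) (C r) (C r t).
Proof.
move=> r01; have [_ cE _ _] := nE.
have [c1 c2] := cE (path r) t (Upsi t r01) (cderiv_ccvg (path_dt r t)).
apply: ccvgD.
  apply: ccvgM; last exact: cspeed.
  by apply: ccvgM => //; apply: ccvgN; apply: ccvgC; exact: cpsi.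
by apply: ccvgM => //; apply: ccvgN; apply: ccvgC; exact: cdpsi.
Qed.

Let B0 : 0 <= B. Proof. exact: le_trans (normr_ge0 _) (psiB 0). Qed.
Let sc_bound (r a b : R) : 0 <= r <= 1 -> `|a| <= B -> cabs (((1 - r) * a) +i* b) <= B + `|b|.
Proof.
move=> /andP[r0 r1] aB; rewrite (le_trans (le_cabs_ReIm _)) //= lerD2r normrM.
apply: le_trans aB; rewrite ler_piMl // ger0_norm ?subr_ge0 // lerBlDr lerDl //.
Qed.

Let mC : cmeas [set: lineT * lineT] (fun z => C z.1 z.2).
Proof.
have m1 : measurable_fun [set: lineT * lineT] fst by exact: measurable_fst.
have m2 : measurable_fun [set: lineT * lineT] snd by exact: measurable_snd.
have mpsi : measurable_fun [set: lineT * lineT] (fun z => psi z.2).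
  by apply: (measurableT_comp _ m2); exact: continuous_measurable_fun.
have mdpsi : measurable_fun [set: lineT * lineT] (fun z => derive1 psi z.2).
  by apply: (measurableT_comp _ m2); exact: continuous_measurable_fun.
have m1r : measurable_fun [set: lineT * lineT] (fun z => 1 - z.1).
  by apply: measurable_funB; [exact: measurable_cst|exact: m1].
have mpath : cmeas [set: lineT * lineT] (fun z => path z.1 z.2).
  by split => /=; [exact: measurable_funM|exact: m2].
have mspeed : cmeas [set: lineT * lineT] (fun z => speed z.1 z.2).
  by split => /=; [exact: measurable_funM|exact: measurable_cst].
have [_ _ mE _] := nE; have [e1 e2] := mE _ mpath.
apply: cmeasD; last by apply: cmeasM => //; apply: cmeasN; exact: cmeasC.
by apply: cmeasM mspeed; apply: cmeasM => //; apply: cmeasN; exact: cmeasC.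
Qed.

Let C_bound (N : R) : 0 <= N -> exists2 M, 0 <= M & forall r t, 0 <= r <= 1 -> `|t| <= N -> cabs (C r t) <= M.
Proof.
move=> N0; have [_ _ _ bE] := nE; have [M hM] := bE (B + N).
have rt r t : 0 <= r <= 1 -> `|t| <= N -> cabs (path r t) <= B + N.
  by move=> r01 tN; rewrite (le_trans (sc_bound _ r01 (psiB t))) // lerD2l.
have M0 : 0 <= M.
  have r0 := itv01_0 R.
  have t0 : `|0 : R| <= N by rewrite normr0.
  have [h _] := hM _ (Upsi 0 r0) (rt _ _ r0 t0).
  exact: le_trans (cabs_ge0 _) h.
exists (M * B * (B + 1) + M * B).
  by rewrite !(addr_ge0, mulr_ge0).
move=> r t r01 tN; have [h1 h2] := hM _ (Upsi t r01) (rt _ _ r01 tN).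
rewrite (le_trans (cabsD _ _)) // !cabsM !cabsN !cabsC lerD //; last by rewrite ler_pM ?cabs_ge0.
rewrite ler_pM ?mulr_ge0 ?cabs_ge0 //; first by rewrite ler_pM ?cabs_ge0.
by have := sc_bound 1 r01 (dpsiB t); rewrite normr1.
Qed.

Let W r t := E (path r t) * speed r t.
Let P r t := E (path r t) * - (psi t)%:C.

Let ccont_W r : 0 <= r <= 1 -> ccont (W r).
Proof.
move=> r01 t; have [_ cE _ _] := nE.
have [c1 _] := cE (path r) t (Upsi t r01) (cderiv_ccvg (path_dt r t)).
by apply: ccvgM => //; exact: cspeed.
Qed.
Let iW r : 0 <= r <= 1 -> cintegrable mu setT (W r).
Proof.
move=> r01; apply: (@cintegrable_leT _ _ (fun t => K * (B + 1) * g t)).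
- by apply: ccont_cmeasT; exact: ccont_W.
- by rewrite /comp; under eq_fun do rewrite EFinM; exact: integrableZl.
move=> t; rewrite cabsM mulrAC ler_pM ?cabs_ge0 ?Eg //.
by have := sc_bound 1 r01 (dpsiB t); rewrite normr1.
Qed.

Let cint_cst0 (A : set R) : cint mu A (fun=> 0) = 0.
Proof. by apply: ceqP; rewrite ?Re_cint ?Im_cint /= Rintegral_cst0. Qed.

(** Both intervals are encoded by indicators, so that the dominated Fubini theorem on the whole
    plane applies. *)
Let window_fubini (N : R) : 0 <= N ->
  cint mu `[0, 1] (fun r => cint mu `[- N, N] (C r)) = cint mu `[- N, N] (fun t => cint mu `[0, 1] (C ^~ t)).
Proof.
move=> N0; have [M M0 CM] := C_bound N0.
pose F z := C z.1 z.2 * ((\1_(`[0, 1]%classic) z.1 : R)%:C * (\1_(`[- N, N]%classic) z.2 : R)%:C).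
have m1 : measurable_fun [set: lineT * lineT] fst by exact: measurable_fst.
have m2 : measurable_fun [set: lineT * lineT] snd by exact: measurable_snd.
have mi (a b : R) : measurable_fun [set: lineT] (\1_(`[a, b]%classic) : R -> R).
  by apply: measurable_indic; exact: measurable_itv.
have mF : cmeas [set: lineT * lineT] F.
  apply: cmeasM => //; apply: cmeasM; apply: cmeasC.
    exact: (measurableT_comp (mi 0 1) m1).
  exact: (measurableT_comp (mi (- N) N) m2).
have FM r t : cabs (F (r, t)) <= M * \1_(`[0, 1]%classic) r * (1 * \1_(`[- N, N]%classic) t).
  rewrite /F /= !cabsM !cabsC !indicE.
  have [/set_mem r01|_] := boolP (r \in `[0, 1]%classic); last by rewrite normr0 !(mulr0, mul0r).
  have [/set_mem tN|_] := boolP (t \in `[- N, N]%classic); last by rewrite normr0 !(mulr0, mul0r).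
  rewrite !normr1 !mulr1; apply: CM; first by move: r01; rewrite /= in_itv.
  by move: tN; rewrite /= in_itv /= ler_norml.
have key := @cint_fubini _ _ _ lineT lineT mu mu _ _ (integrable_cst_indic 0 1 M measurableT) (integrable_cst_indic (- N) N 1 measurableT) F mF FM.
transitivity (cint mu setT (fun r => cint mu setT (fun t => F (r, t)))); last rewrite key.
  rewrite cint_mkcond; apply: eq_cintT => r; rewrite indicE.
  have [/set_mem r01|rn] := boolP (r \in `[0, 1]%classic).
    rewrite mulr1 cint_mkcond; apply: eq_cintT => t; rewrite /F /= [\1_(`[0, 1]%classic) r]indicE (mem_set r01) mul1r; reflexivity.
  rewrite mulr0 -[LHS](cint_cst0 setT); apply: eq_cintT => t.
  by rewrite /F /= [\1_(`[0, 1]%classic) r]indicE (negbTE rn) mul0r mulr0.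
rewrite [RHS]cint_mkcond; apply: eq_cintT => t; rewrite indicE.
have [/set_mem tN|tn] := boolP (t \in `[- N, N]%classic).
  rewrite mulr1 [RHS]cint_mkcond; apply: eq_cintT => r; rewrite /F /= [\1_(`[- N, N]%classic) t]indicE (mem_set tN) mulr1; reflexivity.
rewrite mulr0 -[RHS](cint_cst0 setT); apply: eq_cintT => r.
by rewrite /F /= [\1_(`[- N, N]%classic) t]indicE (negbTE tn) !mulr0.
Qed.

(** Integrate [C] over the rectangle: first in [r] it gives the difference of the two line
    integrals, first in [t] it gives the two end segments, which [g] controls. *)
Let window_bound (N : R) : 0 <= N ->
  cabs (cint mu `[- N, N] (W 1) - cint mu `[- N, N] (W 0)) <= 2 * (K * g N * B + K * g (- N) * B).
Proof.
move=> N0; have NN : - N <= N by rewrite -subr_ge0 opprK addr_ge0.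
have r0 := itv01_0 R.
have r1 := itv01_1 R.
have iN r : 0 <= r <= 1 -> cintegrable mu `[- N, N] (W r).
  by move=> r01; apply: ccont_cintegrable_itv => t _; exact: ccont_W.
have mN : measurable (`[- N, N]%classic : set lineT) by exact: measurable_itv.
have m01 : measurable (`[0, 1]%classic : set lineT) by exact: measurable_itv.
have -> : cint mu `[- N, N] (W 1) - cint mu `[- N, N] (W 0) = cint mu `[- N, N] (fun t => W 1 t - W 0 t).
  by rewrite (@cintB _ _ lineT mu _ _ _ mN (iN 1 r1) (iN 0 r0)).
have -> : cint mu `[- N, N] (fun t => W 1 t - W 0 t) = cint mu `[- N, N] (fun t => cint mu `[0, 1] (C ^~ t)).
  apply: eq_cint => t _; rewrite (@cint_ftc _ (fun r => W r t)) //.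
    by move=> r; rewrite in_itv /= => r01; exact: CE_r.
  by move=> r; rewrite in_itv /= => r01; exact: cC_r.
rewrite -window_fubini //.
have -> : cint mu `[0, 1] (fun r => cint mu `[- N, N] (C r)) = cint mu `[0, 1] (fun r => P r N - P r (- N)).
  apply: eq_cint => r /=; rewrite in_itv /= => r01; rewrite (@cint_ftc _ (P r)) //.
    by move=> t _; exact: CE_t.
  by move=> t _; exact: cC_t.
have Pb r t : 0 <= r <= 1 -> cabs (P r t) <= K * g t * B.
  by move=> r01; rewrite /P cabsM cabsN cabsC ler_pM ?cabs_ge0 ?Eg.
have cP (r t : R) : 0 <= r <= 1 -> ccvg (nbhs r) (fun r => P r t) (P r t).
  move=> r01; have [_ cE _ _] := nE.
  have [c1 _] := cE (fun r => path r t) r (Upsi t r01) (cderiv_ccvg (path_dr r t)).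
  by apply: ccvgM => //; exact: ccvg_cst.
have iP : cintegrable mu `[0, 1] (fun r => P r N - P r (- N)).
  by apply: ccont_cintegrable_itv => r; rewrite in_itv /= => r01; apply: ccvgB; exact: cP.
apply: le_trans (@cint_le _ _ lineT mu `[0, 1]%classic _ (fun=> K * g N * B + K * g (- N) * B) m01 (cintegrable_cmeas iP) _ _) _.
- by have := @integrable_cst_indic R `[0, 1]%classic 0 1 (K * g N * B + K * g (- N) * B) m01;
    apply: eq_integrable => // r r01; rewrite /= indicE r01 mulr1.
- move=> r /=; rewrite in_itv /= => r01.
  by rewrite (le_trans (cabsB _ _)) // lerD // Pb.
rewrite ler_wpM2l // Rintegral_cst //= lebesgue_measure_itv /= lte01 oppr0 adde0 /= mulr1 //.
Qed.

(** The end segments vanish as the window grows, since [g] tends to [0] along the integers in both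
    directions, while the window integrals converge to the full ones. *)
Lemma contour_shift :
  cint mu setT (fun t => E (psi t +i* t) * (derive1 psi t +i* 1)) =
  cint mu setT (fun t => E (0 +i* t) * (0 +i* 1)).
Proof.
have r0 := itv01_0 R.
have r1 := itv01_1 R.
transitivity (cint mu setT (W 0)).
  by apply: eq_cintT => t; rewrite /W /path /speed subr0 !mul1r.
transitivity (cint mu setT (W 1)); last first.
  by apply: eq_cintT => t; rewrite /W /path /speed subrr !mul0r.
have c0 := cvg_cint_window (iW r0); have c1 := cvg_cint_window (iW r1).
have c : ccvg \oo (fun n : nat => cint mu `[- n%:R, n%:R] (W 1) - cint mu `[- n%:R, n%:R] (W 0)) (cint mu setT (W 1) - cint mu setT (W 0)).
  exact: ccvgB c1 c0.
have z : ccvg \oo (fun n : nat => cint mu `[- n%:R, n%:R] (W 1) - cint mu `[- n%:R, n%:R] (W 0)) 0.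
  apply: ccvg_cabs0.
  have h : 2 * (K * g n%:R * B + K * g (- n%:R) * B) @[n --> \oo] --> 2 * (K * 0 * B + K * 0 * B).
    apply: cvgM; first exact: cvg_cst.
    by apply: cvgD; apply: cvgM; [apply: cvgM; [exact: cvg_cst|]|exact: cvg_cst|apply: cvgM; [exact: cvg_cst|]|exact: cvg_cst].
  rewrite mulr0 mul0r addr0 mulr0 in h; apply: (squeeze_cvgr _ (cvg_cst 0) h).
  by apply: nearW => n; rewrite subr0 cabs_ge0 /= window_bound.
by have := ccvg_lim c; rewrite (ccvg_lim z) => /esym/eqP; rewrite subr_eq0 => /eqP.
Qed.

End ContourShift.

(** * Quotients of Gauss products *)

Section GammaRatio.
Variable R : realType.
Local Notation Re := (@complex.Re R).
Local Notation Im := (@complex.Im R).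
Local Notation mu := (@lebesgue_measure R).
Local Notation lineT := (measurableTypeR R).
Implicit Types (c t : R) (s z : R[i]).

(** As [rgauss] approximates [1 / Gamma], this approximates [Gamma (c - s) / Gamma (c + s)]. *)
Definition gratio n c s : R[i] := rgauss n (c%:C + s) / rgauss n (c%:C - s).
Definition gamma_ratio c s : R[i] := rgamma (c%:C + s) / rgamma (c%:C - s).

Lemma cabs_rgauss n z : cabs (rgauss n z) =
  \prod_(0 <= k < n.+1) cabs (z + k%:R) / (n`!%:R * expR (ln n%:R * Re z)).
Proof.
rewrite /rgauss cabsM cabsV cabsM cabs_nat cabs_prod; congr (_ / (_ * _)).
by rewrite /cpow cabs_cexp !cE /= mul0r subr0.
Qed.

Lemma cabs_gratio n c s : cabs (gratio n c s) =
  \prod_(0 <= k < n.+1) (cabs (c%:C + s + k%:R) / cabs (c%:C - s + k%:R)) * expR (- (2 * ln n%:R * Re s)).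
Proof.
rewrite /gratio cabsM cabsV !cabs_rgauss prodf_div.
have -> : expR (- (2 * ln n%:R * Re s)) = expR (ln n%:R * Re (c%:C - s)) / expR (ln n%:R * Re (c%:C + s)).
  by rewrite -expRN -expRD; congr expR; rewrite !cE /=; ring.
have f0 : n`!%:R != 0 :> R by rewrite pnatr_eq0 -lt0n fact_gt0.
move: (\prod_(_ <= _ < _) cabs (_ + s + _)) (\prod_(_ <= _ < _) cabs (_ - s + _)) => a b.
have e0 : expR (ln n%:R * Re (c%:C + s)) != 0 by rewrite gt_eqF ?expR_gt0.
have e1 : expR (ln n%:R * Re (c%:C - s)) != 0 by rewrite gt_eqF ?expR_gt0.
move: (expR (ln n%:R * Re (c%:C + s))) (expR (ln n%:R * Re (c%:C - s))) e0 e1 => x y x0 y0.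
rewrite !invfM invrK; move: (b^-1) => b'.
by move: (n`!%:R : R) f0 => f f0; field; rewrite ?x0 ?y0 ?f0.
Qed.

(** Since [c + s + k = - (c - s + k) + 2 (c + k)], each quotient is at most [1 + 2 (c + k) / d]. The
    bound depends on [n] but not on [Im s], which is what a contour shift at fixed [n] requires. *)
Lemma cabs_gratio_le n c d A s : 0 < d -> 0 <= c -> `|Re s| <= A ->
  (forall k : nat, d <= cabs (c%:C - s + k%:R)) ->
  cabs (gratio n c s) <= \prod_(0 <= k < n.+1) (1 + 2 * (c + k%:R) / d) * expR (2 * `|ln n%:R| * A).
Proof.
move=> d0 c0 sA dk; rewrite cabs_gratio.
have pos k : 0 < cabs (c%:C - s + k%:R) by exact: lt_le_trans (dk k).
have A0 : 0 <= A := le_trans (normr_ge0 _) sA.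
apply: ler_pM; first by apply: prodr_ge0 => k _; rewrite divr_ge0 ?cabs_ge0.
- exact: expR_ge0.
- apply: ler_prod => k _; rewrite divr_ge0 ?cabs_ge0 //= ler_pdivrMr //.
  have -> : c%:C + s + k%:R = - (c%:C - s + k%:R) + (2 * (c + k%:R))%:C.
    by apply: ceqP; rewrite !cE /=; ring.
  have ck : 0 <= 2 * (c + k%:R) by rewrite mulr_ge0 ?addr_ge0.
  have Xd := dk k; rewrite (le_trans (cabsD _ _)) // cabsN cabsC ger0_norm //.
  move: (cabs _) (2 * _) Xd ck => X w Xd w0; rewrite mulrDl mul1r lerD2l.
  by rewrite -mulrA ler_peMr // mulrC ler_pdivlMr // mul1r.
- rewrite ler_expR (le_trans (ler_norm _)) // normrN !normrM ger0_norm //.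
  by rewrite ler_wpM2l // mulr_ge0.
Qed.

(** On the imaginary axis numerator and denominator of each factor are complex conjugates. *)
Lemma cabs_gratio_line n c t : 0 < c -> cabs (gratio n c (0 +i* t)) = 1.
Proof.
move=> c0; rewrite cabs_gratio /= mulr0 oppr0 expR0 mulr1 big1 // => k _.
have -> : c%:C - (0 +i* t) + k%:R = cconj (c%:C + (0 +i* t) + k%:R).
  by apply: ceqP; rewrite !cE /=; ring.
rewrite cabsJ divff // gt_eqF // cabs_gt0 //; apply/eqP => e.
have := f_equal Re e; rewrite !cE /= addr0 => /eqP; rewrite gt_eqF // ltr_pwDl //.
Qed.

Lemma cvg_gratio c s : (forall k : nat, c%:C - s + k%:R != 0) ->
  ccvg \oo (fun n => gratio n c s) (gamma_ratio c s).
Proof.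
move=> h; apply: ccvgM; first exact: cvg_rgauss.
by apply: ccvgV; [exact: rgamma_neq0|exact: cvg_rgauss].
Qed.

Lemma line_neq0 c t (k : nat) : 0 < c -> c%:C - (0 +i* t) + k%:R != 0.
Proof.
move=> c0; apply/eqP => e.
have := f_equal Re e; rewrite !cE /= subr0 => /eqP; rewrite gt_eqF // ltr_pwDl //.
Qed.

Lemma cabs_gamma_ratio_line c t : 0 < c -> cabs (gamma_ratio c (0 +i* t)) = 1.
Proof.
move=> c0; have h : cabs (gratio n c (0 +i* t)) @[n --> \oo] --> cabs (gamma_ratio c (0 +i* t)).
  by apply: cvg_cabs; apply: cvg_gratio => k; exact: line_neq0.
rewrite -(cvg_lim _ h) //; under eq_fun do rewrite cabs_gratio_line //.
exact: lim_cst.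
Qed.

Lemma ccont_gamma_ratio c (z : R -> R[i]) : ccont z -> (forall t k, c%:C - z t + k%:R != 0) ->
  ccont (fun t => gamma_ratio c (z t)).
Proof.
move=> cz h t; apply: ccvgM.
  by apply: ccvg_rgamma; apply: ccvgD => //; exact: ccvg_cst.
apply: ccvgV; first exact: rgamma_neq0.
by apply: ccvg_rgamma; apply: ccvgB => //; exact: ccvg_cst.
Qed.

(* Telescopes over [u = c, c + 1, ...]; the error [O(1/u^2)] is summable. *)
Lemma ratio_factor (sg u t : R) : 0 < sg -> 2^-1 <= u -> sg <= `|t| ->
  ((u + sg) ^+ 2 + t ^+ 2) / ((u - sg) ^+ 2 + t ^+ 2) <=
  expR (2 * sg * (ln ((u + 1) ^+ 2 + t ^+ 2) - ln (u ^+ 2 + t ^+ 2)) + 32 * sg * (1 + sg) * u^-1 ^+ 2).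
Proof.
move=> s0 u2 st.
have u0 : 0 < u by lra.
have t2 : sg ^+ 2 <= t ^+ 2 by rewrite -[t ^+ 2]real_normK ?num_real // ler_pXn2r ?nnegrE // ltW.
(* Here [sg <= |t|] enters: [(u - sg)^2 + sg^2 - u^2 / 2 = (u - 2 sg)^2 / 2]. *)
have a0 : u ^+ 2 / 2 <= (u - sg) ^+ 2 + t ^+ 2.
  by have := sqr_ge0 (u - 2 * sg); rewrite !sqrrB; lra.
have b0 : u ^+ 2 <= (u + 1) ^+ 2 + t ^+ 2 by have := sqr_ge0 t; rewrite sqrrD; lra.
have up : 0 < u ^+ 2 by rewrite exprn_gt0.
have q0 : 0 < u ^+ 2 + t ^+ 2 by rewrite ltr_wpDr ?sqr_ge0.
have ba : (u + 1) ^+ 2 + t ^+ 2 - ((u - sg) ^+ 2 + t ^+ 2) <= (1 + sg) * (4 * u).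
  have : (1 + sg) * (2 * u + 1 - sg) <= (1 + sg) * (4 * u) by rewrite ler_pM2l; lra.
  by apply: le_trans; rewrite le_eqVlt; apply/orP; left; apply/eqP; ring.
have bq : (u + 1) ^+ 2 + t ^+ 2 - (u ^+ 2 + t ^+ 2) = 2 * u + 1 by ring.
have -> : (u + sg) ^+ 2 + t ^+ 2 = (u - sg) ^+ 2 + t ^+ 2 + 4 * sg * u by ring.
move: a0 b0 q0 ba bq; set a := (u - sg) ^+ 2 + t ^+ 2; set b := (u + 1) ^+ 2 + t ^+ 2; set q := u ^+ 2 + t ^+ 2.
move=> a0 b0 q0 ba bq; clearbody a b q.
have ap : 0 < a by lra.
have bp : 0 < b by lra.
rewrite mulrDl divff ?gt_eqF //; apply: le_trans (expR_ge1Dx _) _; rewrite ler_expR.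
(* From [ln x <= x - 1] at [x = q / b], with [b - q = 2 u + 1]. *)
have l1 : 2 * u / b <= ln b - ln q.
  have qb : 0 < q / b by rewrite divr_gt0.
  have e1 : 1 + (q / b - 1) = q / b by ring.
  have h : ln (q / b) <= q / b - 1 by rewrite -[X in ln X]e1; apply: le_ln1Dx; rewrite ltrBrDr addrC subrr.
  move: h; rewrite ln_div // => h.
  have -> : 2 * u / b = 1 - q / b - b^-1.
    rewrite (_ : 2 * u = b - q - 1); last by lra.
    by field; rewrite gt_eqF.
  have : 0 <= b^-1 by rewrite invr_ge0 ltW.
  lra.
(* The difference is [4 sg u (b - a) / (a b)]; now [b - a <= 4 (1 + sg) u], [1 / a <= 2 / u^2] and
   [1 / b <= 1 / u^2]. *)
have l2 : 4 * sg * u / a - 4 * sg * u / b <= 32 * sg * (1 + sg) * u^-1 ^+ 2.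
  have -> : 4 * sg * u / a - 4 * sg * u / b = 4 * sg * u * (b - a) * (a^-1 * b^-1).
    by field; rewrite !gt_eqF.
  have i1 : a^-1 * b^-1 <= 2 * (u ^+ 2)^-1 * (u ^+ 2)^-1.
    have a1 : a^-1 <= 2 * (u ^+ 2)^-1.
      by have -> : 2 * (u ^+ 2)^-1 = (u ^+ 2 / 2)^-1; [rewrite invf_div|rewrite lef_pV2 ?posrE // divr_gt0].
    have b1 : b^-1 <= (u ^+ 2)^-1 by rewrite lef_pV2 ?posrE.
    by apply: ler_pM a1 b1; rewrite invr_ge0 ltW.
  have su : 0 <= 4 * sg * u by apply: mulr_ge0; lra.
  have ab0 : 0 <= a^-1 * b^-1 by apply: mulr_ge0; rewrite invr_ge0 ltW.
  apply: (@le_trans _ _ (4 * sg * u * ((1 + sg) * (4 * u)) * (a^-1 * b^-1))).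
    by apply: ler_wpM2r => //; exact: ler_wpM2l.
  apply: (@le_trans _ _ (4 * sg * u * ((1 + sg) * (4 * u)) * (2 * (u ^+ 2)^-1 * (u ^+ 2)^-1))).
    by apply: ler_wpM2l => //; apply: mulr_ge0 => //; apply: mulr_ge0; lra.
  rewrite le_eqVlt; apply/orP; left; apply/eqP; field; rewrite gt_eqF //.
have l3 : 2 * sg * (2 * u / b) <= 2 * sg * (ln b - ln q) by rewrite ler_wpM2l // mulr_ge0 ?ltW.
have e3 : 2 * sg * (2 * u / b) = 4 * sg * u / b by ring.
lra.
Qed.

(** Multiply [ratio_factor] over [u = c + k]. Both the logarithms and the error bound telescope;
    [256] is [32 * 8]. *)
Lemma gratio_tail_prod (sg c t : R) n : 0 < sg -> 2^-1 <= c -> sg <= `|t| ->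
  \prod_(0 <= k < n) (cabs (c%:C + (sg +i* t) + k%:R) / cabs (c%:C - (sg +i* t) + k%:R)) ^+ 2 <=
  expR (2 * sg * (ln ((c + n%:R) ^+ 2 + t ^+ 2) - ln (c ^+ 2 + t ^+ 2)) + 256 * sg * (1 + sg) * (1 - n.+1%:R^-1)).
Proof.
move=> s0 c2 st; elim: n => [|n ih].
  by rewrite big_nil addr0 subrr invr1 subrr !mulr0 addr0 expR0.
rewrite big_nat_recr //=.
set u := c + n%:R.
have u2 : 2^-1 <= u by rewrite (le_trans c2) // lerDl.
have h := ratio_factor s0 u2 st.
have -> : (cabs (c%:C + (sg +i* t) + n%:R) / cabs (c%:C - (sg +i* t) + n%:R)) ^+ 2 =
    ((u + sg) ^+ 2 + t ^+ 2) / ((u - sg) ^+ 2 + t ^+ 2).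
  rewrite expr_div_n !sqr_cabs !cE /= /u; congr (_ / _); ring.
apply: le_trans (ler_pM _ _ ih h) _.
- by apply: prodr_ge0 => k _; exact: sqr_ge0.
- by rewrite divr_ge0 // addr_ge0 // sqr_ge0.
rewrite -expRD ler_expR -/u.
have -> : c + n.+1%:R = u + 1 by rewrite -natr1 addrA.
(* As [u >= (n + 1) / 2], the left side is at most [4 / (n + 1)^2], and [n + 2 <= 2 (n + 1)]. *)
have e : u^-1 ^+ 2 <= 8 * (n.+1%:R^-1 - n.+2%:R^-1).
  have u1 : n.+1%:R / 2 <= u by rewrite /u -natr1; have := ler0n R n; lra.
  have up : 0 < u by lra.
  apply: (@le_trans _ _ (4 * n.+1%:R^-1 ^+ 2)).
    have -> : 4 * n.+1%:R^-1 ^+ 2 = (n.+1%:R / 2)^-1 ^+ 2 :> R by rewrite invf_div exprMn; ring.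
    have v0 : 0 <= u^-1 by rewrite invr_ge0 ltW.
    have w0 : 0 <= (n.+1%:R / 2 : R)^-1 by rewrite invr_ge0 divr_ge0.
    by rewrite ler_pXn2r ?nnegrE // lef_pV2 ?posrE ?divr_gt0.
  have -> : n.+2%:R = n.+1%:R + 1 :> R by rewrite natr1.
  have m1 : 1 <= n.+1%:R :> R by rewrite ler1n.
  move: (n.+1%:R : R) m1 => m m1.
  have -> : 8 * (m^-1 - (m + 1)^-1) = 8 * (m^-1 * (m + 1)^-1) by field; rewrite !gt_eqF //; lra.
  have -> : 4 * m^-1 ^+ 2 = 8 * (m^-1 * (2 * m)^-1) by field; rewrite gt_eqF //; lra.
  have mv : 0 <= m^-1 by rewrite invr_ge0; lra.
  rewrite ler_pM2l // ler_wpM2l //.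
  by rewrite lef_pV2 ?posrE; lra.
have k0 : 0 <= 32 * sg * (1 + sg) by rewrite !mulr_ge0 ?addr_ge0 ?ltW.
have := ler_wpM2l k0 e.
set L1 := ln _; set L2 := ln _; set L3 := ln _.
set x := n.+1%:R^-1; set y := n.+2%:R^-1.
have -> : 32 * sg * (1 + sg) * (8 * (x - y)) = 256 * sg * (1 + sg) * (1 - y) - 256 * sg * (1 + sg) * (1 - x) by ring.
set p := 256 * sg * (1 + sg) * (1 - y); set r := 256 * sg * (1 + sg) * (1 - x); set v := _ * u^-1 ^+ 2.
rewrite !mulrBr; set z1 := 2 * sg * L1; set z2 := 2 * sg * L2; set z3 := 2 * sg * L3.
lra.
Qed.

End GammaRatio.

(** * Bounds for the Gauss quotients that are uniform in the order of the product *)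

Section GammaRatioBounds.
Variable R : realType.
Local Notation Re := (@complex.Re R).
Local Notation Im := (@complex.Im R).
Local Notation mu := (@lebesgue_measure R).
Local Notation lineT := (measurableTypeR R).
Implicit Types (c t sg : R) (s z : R[i]).

(** The quotient of order [n] has the decay [(1 + t^2)^(- sg)] of its limit as long as [|t| <= n];
    for larger [|t|] it is only bounded. *)
Lemma gratio_tail sg c : 0 < sg -> 2^-1 <= c -> exists2 K, 0 <= K & forall n t, (0 < n)%N -> sg <= `|t| ->
  cabs (gratio n c (sg +i* t)) <= K * (if `|t| <= n%:R then expR (- (sg * ln (1 + t ^+ 2))) else 1).
Proof.
(* [M] compares [(c + n + 1)^2 + t^2] with the larger of [n^2] and [t^2]. The [4] compares [1 + t^2]
   with [c^2 + t^2], using [c >= 1/2]. [E] is half the constant of [gratio_tail_prod], which bounds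
   the square. *)
move=> s0 c2; pose M := (c + 2) ^+ 2 + 1; pose E := 128 * sg * (1 + sg).
exists (expR (E + sg * (ln M + ln 4))); first exact: expR_ge0.
move=> n t n0 st.
have M1 : 1 <= M by rewrite /M lerDr sqr_ge0.
have N1 : 1 <= n%:R :> R by rewrite ler1n.
have h1 : cabs (gratio n c (sg +i* t)) <=
    expR (E + sg * (ln ((c + n.+1%:R) ^+ 2 + t ^+ 2) - ln (c ^+ 2 + t ^+ 2) - 2 * ln n%:R)).
  rewrite cabs_gratio /=.
  have -> : E + sg * (ln ((c + n.+1%:R) ^+ 2 + t ^+ 2) - ln (c ^+ 2 + t ^+ 2) - 2 * ln n%:R) =
     E + sg * (ln ((c + n.+1%:R) ^+ 2 + t ^+ 2) - ln (c ^+ 2 + t ^+ 2)) + - (2 * ln n%:R * sg) by ring.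
  rewrite expRD ler_wpM2r ?expR_ge0 //.
  set P := \prod_(_ <= _ < _) _.
  have P0 : 0 <= P by apply: prodr_ge0 => k _; rewrite divr_ge0 ?cabs_ge0.
  rewrite -(@ler_pXn2r _ 2) ?nnegrE ?expR_ge0 // -expRM_natl -prodrXl.
  apply: le_trans (gratio_tail_prod n.+1 s0 c2 st) _; rewrite ler_expR.
  have y1 : 1 - n.+2%:R^-1 <= 1 :> R by rewrite gerBl invr_ge0.
  have e0 : 0 <= 256 * sg * (1 + sg) by rewrite !mulr_ge0 ?addr_ge0 ?ltW.
  have := ler_wpM2l e0 y1; rewrite /E; set L1 := ln _; set L2 := ln _; set y := n.+2%:R^-1.
  have -> : 2%:R * (128 * sg * (1 + sg) + sg * (L1 - L2)) = 256 * sg * (1 + sg) * 1 + 2 * sg * (L1 - L2) by ring.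
  by move=> ?; rewrite addrC lerD2r.
apply: le_trans h1 _.
have c0 : 0 < c by lra.
have q0 : 0 < c ^+ 2 + t ^+ 2 by rewrite ltr_wpDr ?sqr_ge0 // exprn_gt0.
have n2E : 2 * ln n%:R = ln (n%:R ^+ 2) :> R by rewrite lnXn ?(lt_le_trans _ N1) // mulr_natl.
have cn : c + n.+1%:R <= (c + 2) * n%:R.
  by rewrite -natr1; have := ler_wpM2l (ltW c0) N1; lra.
have cn2 : (c + n.+1%:R) ^+ 2 <= (c + 2) ^+ 2 * n%:R ^+ 2.
  by rewrite -exprMn ler_pXn2r ?nnegrE ?mulr_ge0 ?addr_ge0 // ltW.
have m1 : 0 < (c + n.+1%:R) ^+ 2 + t ^+ 2 by rewrite ltr_wpDr ?sqr_ge0 // exprn_gt0 // addr_gt0.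
have M0 : 0 < M by lra.
have N2 : 0 < n%:R ^+ 2 :> R by rewrite exprn_gt0 // (lt_le_trans _ N1).
have ln40 : 0 <= ln (4 : R) by rewrite ln_ge0 // ler1n.
have lnM0 : 0 <= ln M by rewrite ln_ge0.
case: ifPn => [tn|]; last first.
  rewrite -ltNge => nt; rewrite mulr1 ler_expR lerD2l; apply: ler_wpM2l; first exact: ltW.
  have t0 : 0 < t ^+ 2 by rewrite -[t ^+ 2]real_normK ?num_real // exprn_gt0 // (lt_trans _ nt) // (lt_le_trans _ N1).
  have nt2 : n%:R ^+ 2 <= t ^+ 2 by rewrite -[t ^+ 2]real_normK ?num_real // ler_pXn2r ?nnegrE // ltW.
  have l1 : ln ((c + n.+1%:R) ^+ 2 + t ^+ 2) <= ln M + ln (t ^+ 2).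
    have e : (c + n.+1%:R) ^+ 2 + t ^+ 2 <= M * t ^+ 2.
      by rewrite /M mulrDl mul1r lerD2r (le_trans cn2) // ler_wpM2l ?sqr_ge0.
    by rewrite -lnM ?posrE // ler_ln ?posrE // mulr_gt0.
  have l2 : ln (t ^+ 2) <= ln (c ^+ 2 + t ^+ 2) by rewrite ler_ln ?posrE // lerDr sqr_ge0.
  have : 0 <= ln (n%:R : R) by rewrite ln_ge0.
  lra.
rewrite -expRD ler_expR -[X in _ <= X]addrA lerD2l -mulrBr; apply: ler_wpM2l; first exact: ltW.
have tn2 : t ^+ 2 <= n%:R ^+ 2 by rewrite -[t ^+ 2]real_normK ?num_real // ler_pXn2r ?nnegrE.
have l1 : ln ((c + n.+1%:R) ^+ 2 + t ^+ 2) <= ln M + 2 * ln n%:R.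
  have e : (c + n.+1%:R) ^+ 2 + t ^+ 2 <= M * n%:R ^+ 2 by rewrite /M mulrDl mul1r; exact: lerD.
  by rewrite n2E -lnM ?posrE // ler_ln ?posrE // mulr_gt0.
have t1 : 0 < 1 + t ^+ 2 by rewrite ltr_wpDr ?sqr_ge0.
have l2 : ln (1 + t ^+ 2) <= ln 4 + ln (c ^+ 2 + t ^+ 2).
  have e : 1 + t ^+ 2 <= 4 * (c ^+ 2 + t ^+ 2).
    have : 2^-1 ^+ 2 <= c ^+ 2 by rewrite ler_pXn2r ?nnegrE // ltW.
    have := sqr_ge0 t; rewrite exprVn; lra.
  by rewrite -lnM ?posrE // ler_ln ?posrE // mulr_gt0.
lra.
Qed.

(** The first term, [(1 + t^2)^(-2 sg)], serves the range [|t| <= n] and the second the range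
    [|t| > n]. *)
Definition weight sg t : R := expR (- (2 * sg * ln (1 + t ^+ 2))) + expR (- 1 * `|t|).

Lemma weight_ge0 sg t : 0 <= weight sg t.
Proof. by rewrite addr_ge0 // expR_ge0. Qed.

(** For [|t| <= n] the two quotients contribute [(1 + t^2)^(- sg)] each. For [|t| > n] they are
    bounded and [exp (- t^2 / n) <= exp (- |t|)]. The factor [expR (sg ^+ 2)] bounds the rest of the
    regulariser. *)
Lemma gratio_pair_tail sg c1 c2 : 0 < sg -> 2^-1 <= c1 -> 2^-1 <= c2 ->
  exists2 K, 0 <= K & forall n t, (0 < n)%N -> sg <= `|t| ->
  cabs (gratio n c1 (sg +i* t) * gratio n c2 (sg +i* t) * cexp ((sg +i* t) * (sg +i* t) * (n%:R^-1)%:C)) <= K * weight sg t.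
Proof.
move=> s0 h1 h2; have [K1 K10 k1] := gratio_tail s0 h1; have [K2 K20 k2] := gratio_tail s0 h2.
exists (K1 * K2 * expR (sg ^+ 2)); first by rewrite !mulr_ge0 ?expR_ge0.
move=> n t n0 st; have := k1 n t n0 st; have := k2 n t n0 st; set s := sg +i* t.
have N1 : 1 <= n%:R :> R by rewrite ler1n.
have Np : 0 < n%:R :> R by rewrite ltr0n.
have eb : cabs (cexp (s * s * (n%:R^-1)%:C)) <= expR (sg ^+ 2) * expR (- (t ^+ 2 / n%:R)).
  rewrite cabs_cexp -expRD ler_expR !cE /= mulr0 subr0 mulrBl -!expr2 lerD2r.
  by rewrite ler_piMr ?sqr_ge0 // invf_le1.
have ge : expR (- (t ^+ 2 / n%:R)) <= 1 by rewrite -[X in _ <= X]expR0 ler_expR oppr_le0 divr_ge0 ?sqr_ge0.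
rewrite cabsM [cabs (gratio _ _ _ * _)]cabsM /weight; case: ifPn => [tn|nt] b2 b1.
  apply: (@le_trans _ _ (K1 * expR (- (sg * ln (1 + t ^+ 2))) * (K2 * expR (- (sg * ln (1 + t ^+ 2)))) * (expR (sg ^+ 2) * 1))).
    apply: ler_pM; rewrite ?mulr_ge0 ?cabs_ge0 //; first by apply: ler_pM; rewrite ?cabs_ge0.
    by apply: le_trans eb _; rewrite ler_wpM2l ?expR_ge0.
  have -> : - (2 * sg * ln (1 + t ^+ 2)) = - (sg * ln (1 + t ^+ 2)) + - (sg * ln (1 + t ^+ 2)) by ring.
  rewrite expRD; move: (expR (- (sg * _))) (expR_ge0 (- (sg * ln (1 + t ^+ 2)))) => a a0.
  move: (expR (- 1 * `|t|)) (expR_ge0 (- 1 * `|t|)) => b b0; rewrite mulr1 mulrDr.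
  have -> : K1 * a * (K2 * a) * expR (sg ^+ 2) = K1 * K2 * expR (sg ^+ 2) * (a * a) by ring.
  by rewrite lerDl !mulr_ge0 ?expR_ge0.
have tb : expR (- (t ^+ 2 / n%:R)) <= expR (- 1 * `|t|).
  rewrite ler_expR mulN1r lerN2 ler_pdivlMr // -[t ^+ 2]real_normK ?num_real // expr2 ler_wpM2l // ltW //.
  by rewrite ltNge.
apply: (@le_trans _ _ (K1 * 1 * (K2 * 1) * (expR (sg ^+ 2) * expR (- 1 * `|t|)))).
  apply: ler_pM; rewrite ?mulr_ge0 ?cabs_ge0 //; first by apply: ler_pM; rewrite ?cabs_ge0.
  by apply: le_trans eb _; rewrite ler_wpM2l ?expR_ge0.
rewrite mulrDr !mulr1 [X in X <= _]mulrA lerDr !mulr_ge0 ?expR_ge0 //.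
Qed.

Lemma even_integrable (w : R -> R) : (forall x, 0 <= w x) -> continuous w -> (forall x, w (- x) = w x) ->
  mu.-integrable setT (fun u => (w (expR u) * expR u)%:E) -> mu.-integrable setT (EFin \o w).
Proof.
move=> w0 cw we iw.
have f := integrable_fin_num measurableT iw.
have h : (\int[mu]_(x in `[0%R, +oo[) (w x)%:E = (fine (\int[mu]_u (w (expR u) * expR u)%:E)%E)%:E)%E.
  rewrite fineK // -ge0_integral_exp; [|by move=> x _; exact: cw|by move=> x _; exact: w0].
  have -> : @Rplus R = `]0, +oo[%classic by apply/seteqP; split => x; rewrite /Rplus /= in_itv /= andbT.
  rewrite integral_itv_obnd_cbnd //.
  by apply/measurable_EFinP; apply: measurable_funTS; exact: continuous_measurable_fun.
by have [] := even_integral w0 cw we h.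
Qed.

Lemma continuous_weight sg : continuous (fun t => expR (- (2 * sg * ln (1 + t ^+ 2)))).
Proof.
move=> t; apply: (@cvg_comp _ _ _ (fun t => - (2 * sg * ln (1 + t ^+ 2))) expR _ (nbhs (- (2 * sg * ln (1 + t ^+ 2))))); last exact: continuous_expR.
apply: cvgN; apply: cvgM; first exact: cvg_cst.
apply: (@cvg_comp _ _ _ (fun t => 1 + t ^+ 2) (@ln R) _ (nbhs (1 + t ^+ 2))).
  by apply: cvgD; [exact: cvg_cst|exact: exprn_continuous].
by apply: continuous_ln; rewrite ltr_wpDr ?sqr_ge0.
Qed.

(** The threshold [1/4] is that of the integrability of [|t|^(-4 sg)] at infinity. After [t = exp u]
    the integrand is at most an exponential in [- |u|]. *)
Lemma integrable_weight sg : 4^-1 < sg -> mu.-integrable setT (EFin \o weight sg).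
Proof.
move=> s4; rewrite /weight /comp; under eq_fun do rewrite EFinD.
apply: integrableD => //; last exact: integrable_expRN.
apply: (even_integrable (w := fun t => expR (- (2 * sg * ln (1 + t ^+ 2))))).
- by move=> x; exact: expR_ge0.
- exact: continuous_weight.
- by move=> x; rewrite sqrrN.
(* The rate is [4 sg - 1] for [u >= 0], from [ln (1 + exp (2 u)) >= 2 u], and [1] for [u < 0], from
   the Jacobian. *)
pose e := Num.min 1 (4 * sg - 1).
have e0 : 0 < e by rewrite lt_min ltr01 /=; lra.
have e1 : e <= 1 by rewrite ge_min lexx.
have e2 : e <= 4 * sg - 1 by rewrite ge_min lexx orbT.
apply: (le_integrable measurableT _ _ (integrable_expRN e0)).
  apply/measurable_EFinP; apply: measurable_funM; last exact: measurable_expR.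
  apply: continuous_measurable_fun => x.
  apply: (@continuous_comp _ _ _ expR (fun t => expR (- (2 * sg * ln (1 + t ^+ 2))))); first exact: continuous_expR.
  exact: continuous_weight.
move=> u _ /=; rewrite lee_fin [X in X <= _]ger0_norm ?mulr_ge0 ?expR_ge0 // [X in _ <= X]ger0_norm ?expR_ge0 // -expRD ler_expR.
have x0 : 0 <= expR u ^+ 2 by exact: sqr_ge0.
have L0 : 0 <= ln (1 + expR u ^+ 2) by rewrite ln_ge0 // lerDl.
have Lu : 2 * u <= ln (1 + expR u ^+ 2).
  by rewrite -[2 * u]expRK expRM_natl ler_ln ?posrE ?exprn_gt0 ?expR_gt0 ?lerDr // ltr_wpDr.
have s0 : 0 < sg by lra.
have [u0|u0] := leP 0 u.
  rewrite ger0_norm //.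
  have := ler_wpM2l (ltW s0) Lu; have := ler_wpM2r u0 e2; lra.
rewrite ltr0_norm //.
have := mulr_ge0 (ltW s0) L0; have : e * - u <= 1 * - u by rewrite ler_wpM2r //; lra.
lra.
Qed.

(** On a compact piece the limit of the denominators has a positive minimum [d] of its modulus; by
    uniform convergence the denominators stay above [d / 2] from some [N0] on, and [rgauss_le]
    bounds the numerators. *)
Lemma gratio_compact c (z : R -> R[i]) (A T : R) : ccont z -> 0 <= T ->
  (forall t (k : nat), c%:C - z t + k%:R != 0) ->
  (forall t, `|t| <= T -> cabs (c%:C + z t) <= A /\ cabs (c%:C - z t) <= A) ->
  exists K, exists2 N0, (0 < N0)%N & forall n t, (N0 <= n)%N -> `|t| <= T -> cabs (gratio n c (z t)) <= K.
Proof.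
move=> cz T0 z0 zA.
have cf : ccont (fun t => rgamma (c%:C - z t)).
  by move=> t; apply: ccvg_rgamma; apply: ccvgB => //; exact: ccvg_cst.
have cc : continuous (fun t => cabs (rgamma (c%:C - z t))) by move=> t; apply: cvg_cabs; exact: cf.
have TT : - T <= T by rewrite -subr_ge0; lra.
have [t0 _ ht0] := EVT_min TT (continuous_subspaceT cc).
set d := cabs (rgamma (c%:C - z t0)) in ht0.
have d0 : 0 < d by apply: cabs_gt0; exact: rgamma_neq0.
have A0 : 0 <= A by have := (zA 0 _).1; rewrite normr0 => /(_ T0); exact/le_trans/cabs_ge0.
have d2 : 0 < d / 2 by rewrite divr_gt0.
have [N0 _ hN0] : \forall n \near \oo, kcst A * n.+1%:R^-1 < d / 2.
  have c0 : kcst A * n.+1%:R^-1 @[n --> \oo] --> kcst A * 0.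
    by apply: cvgM; [exact: cvg_cst|exact: cvg_harmonic].
  by rewrite mulr0 in c0; exact: cvgr_lt c0 _ d2.
exists (A * (A + 1) * expR (ucst A) / (d / 2)), N0.+1 => // -[//|n] t Nn tT.
have [a1 a2] := zA t tT.
have lo : d / 2 <= cabs (rgauss n.+1 (c%:C - z t)).
  have h1 := @rgamma_sub R A n.+1 _ a2 isT; have h2 := hN0 n Nn.
  have h3 : d <= cabs (rgamma (c%:C - z t)) by apply: ht0; rewrite in_itv /= -ler_norml.
  have := lerB_cabs (rgamma (c%:C - z t)) (- (rgamma (c%:C - z t) - rgauss n.+1 (c%:C - z t))).
  rewrite cabsN subKr; apply: le_trans; rewrite lerBrDr; apply: le_trans h3.
  have {2}-> : d = d / 2 + d / 2 by field.
  by rewrite lerD2l (le_trans h1) // ltW.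
rewrite cabsM cabsV ler_pM ?invr_ge0 ?cabs_ge0 //.
  apply: le_trans (@rgauss_le R A n.+1 _ a1 isT) _; rewrite ler_wpM2l ?mulr_ge0 ?addr_ge0 // ler_expR.
  by rewrite ler_piMr ?ucst_ge0 // gerBl invr_ge0.
by rewrite lef_pV2 ?posrE // (lt_le_trans d2).
Qed.

(** The factorials cancel, leaving affine factors, their inverses and one exponential, the forms for
    which [nice] has closure lemmas. *)
Lemma gratioE n c s : gratio n c s =
  (\prod_(0 <= k < n.+1) (1 * s + (c + k%:R)%:C)) * (\prod_(0 <= k < n.+1) ((-1) * s + (c + k%:R)%:C)^-1) *
  cexp ((- (2 * ln n%:R))%:C * s + 0).
Proof.
rewrite /gratio /rgauss /cpow prodfV.
have e (k : nat) : c%:C + s + k%:R = 1 * s + (c + k%:R)%:C by apply: ceqP; rewrite !cE /=; ring.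
have e' (k : nat) : c%:C - s + k%:R = (-1) * s + (c + k%:R)%:C by apply: ceqP; rewrite !cE /=; ring.
rewrite (eq_bigr _ (fun k _ => e k)) [\prod_(0 <= k < _) (c%:C - s + k%:R)](eq_bigr _ (fun k _ => e' k)).
have -> : cexp ((- (2 * ln n%:R))%:C * s + 0) = cexp ((ln n%:R)%:C * (c%:C - s)) / cexp ((ln n%:R)%:C * (c%:C + s)).
  by rewrite -cexpN -cexpD; congr cexp; apply: ceqP; rewrite !cE /=; ring.
have f0 := @factc_neq0 R n.
have e0 := cexp_neq0 ((ln n%:R)%:C * (c%:C + s)); have e1 := cexp_neq0 ((ln n%:R)%:C * (c%:C - s)).
move: (\prod_(_ <= _ < _) _) (\prod_(_ <= _ < _) _) => a b.
move: (cexp _) (cexp _) (n`!%:R) e0 e1 f0 => x y f x0 y0 f0.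
rewrite !invfM invrK; move: (a^-1) => a'.
by field; rewrite ?x0 ?y0 ?f0.
Qed.

Lemma nice_gratio (U : set R[i]) n c (d : R) : 0 < d ->
  (forall s, U s -> forall k : nat, d <= cabs (c%:C - s + k%:R)) -> exists F', nice U (gratio n c) F'.
Proof.
move=> d0 dU.
have [F1 h1] := @nice_prod R U (fun k s => 1 * s + (c + k%:R)%:C) n.+1 (fun k => ex_intro _ _ (nice_affine U 1 (c + k%:R)%:C)).
have [|F2 h2] := @nice_prod R U (fun k s => ((-1) * s + (c + k%:R)%:C)^-1) n.+1.
  move=> k; eexists; apply: (niceV d0 _ (nice_affine U (-1) (c + k%:R)%:C)) => s Us.
  rewrite (_ : -1 * s + (c + k%:R)%:C = c%:C - s + k%:R); first exact: dU.
  by apply: ceqP; rewrite !cE /=; ring.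
have h3 := niceM (niceM h1 h2) (nice_cexp (nice_affine U (- (2 * ln n%:R))%:C 0)).
eexists; move: h3; congr nice; apply/funext => s; rewrite gratioE; reflexivity.
Qed.

End GammaRatioBounds.

(** * The Meijer transform *)

Section Assembly.
Variable R : realType.
Local Notation Re := (@complex.Re R).
Local Notation Im := (@complex.Im R).
Local Notation mu := (@lebesgue_measure R).
Local Notation lineT := (measurableTypeR R).
Local Notation D := (@Rplus R).
Let mD := @measurable_Rplus R.

(** All poles [c + k] are real, so only small [t] matters: for [|t| >= e] the imaginary part
    suffices, and near [t = 0] the curve stays to the left of [c - m], as does the segment from it
    to the axis. *)
Lemma homotopy_dist (c : R) (psi : R -> R) : continuous psi -> 0 < c -> psi 0 < c ->
  exists2 d, 0 < d & forall r t (k : nat), 0 <= r <= 1 ->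
    d <= cabs (c%:C - (((1 - r) * psi t) +i* t) + k%:R).
Proof.
(* Half the gap between [c] and the larger of [psi 0] and [0], because the homotopy ends at real
   part [0]. *)
move=> cpsi c0 pc; pose m := (c - Num.max (psi 0) 0) / 2.
have m0 : 0 < m by rewrite divr_gt0 // subr_gt0 gt_max pc.
have me : Num.max (psi 0) 0 + m = c - m by rewrite /m; field.
have [e /= e0 he] : \forall t \near (0 : R), psi t < psi 0 + m.
  have cp : psi t @[t --> (0 : R)] --> psi 0 by exact: cpsi.
  have pm : psi 0 < psi 0 + m by rewrite ltrDl.
  exact: cvgr_lt cp _ pm.
exists (Num.min m e); first by rewrite lt_min m0 e0.
move=> r t k /andP[r0 r1]; rewrite ge_min.
have [te|te] := ltP `|t| e; last first.
  apply/orP; right; rewrite (le_trans te) //.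
  by have := le_Im_cabs (c%:C - (((1 - r) * psi t) +i* t) + k%:R); rewrite !cE /= sub0r addr0 normrN.
have pt : psi t < psi 0 + m by apply: he; rewrite /ball /= sub0r normrN.
apply/orP; left; apply: le_trans (le_Re_cabs _); rewrite !cE /=.
apply: le_trans (ler_norm _).
have k0 : 0 <= k%:R :> R by [].
have q : (1 - r) * psi t <= c - m.
  rewrite -me; have [p0|p0] := leP 0 (psi t).
    apply: (@le_trans _ _ (psi t)); first by rewrite ler_piMl // gerBl.
    by rewrite (le_trans (ltW pt)) // lerD2r le_max lexx.
  apply: (@le_trans _ _ 0); last by apply: addr_ge0; [rewrite le_max lexx orbT|exact: ltW].
  by rewrite mulr_ge0_le0 ?subr_ge0 // ltW.
lra.
Qed.

Variables (b1 b2 gamma : R) (phi : R -> R).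
Hypotheses (b1_ge0 : 0 <= b1) (gamma_ge1 : 1 <= gamma) (b2_ge : (1 - gamma) / 2 <= b2).
Hypothesis hphi : meijer_contour b1%:C b2%:C (1 - gamma - b1)%:C (1 - gamma - b2)%:C phi.

Let c1 := b1 + gamma / 2.
Let c2 := b2 + gamma / 2.
Let psi t := phi t + gamma / 2.
Let k := gamma^-1.
Let g0 : 0 < gamma. Proof. by rewrite (lt_le_trans _ gamma_ge1). Qed.
Let k0 : 0 < k. Proof. by rewrite invr_gt0. Qed.
(** The lower bounds on [b1], [b2] and [gamma] put all poles at [Re s >= 1/2], hence to the right of
    the line [Re s = 0]. *)
Let c1h : 2^-1 <= c1. Proof. by rewrite -[2^-1]add0r lerD // ler_pdivlMr // mulVf. Qed.
Let c2h : 2^-1 <= c2. Proof. by apply: le_trans (lerD b2_ge (lexx (gamma / 2))); rewrite -mulrDl subrK mul1r. Qed.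
Let c10 : 0 < c1. Proof. by rewrite (lt_le_trans _ c1h). Qed.
Let c20 : 0 < c2. Proof. by rewrite (lt_le_trans _ c2h). Qed.

Let psi_lt : psi 0 < c1 /\ psi 0 < c2.
Proof.
case: hphi => _ _ /(_ 0%N) h1 /(_ 0%N) h2.
by move: h1 h2; rewrite !cE /= !addr0 /psi /c1 /c2 !ltrD2r.
Qed.

Let dpsi (t : R) : is_derive t 1 psi (derive1 phi t).
Proof.
case: hphi => -[d _] _ _ _.
have h : is_derive t 1 phi (derive1 phi t) by rewrite derive1E; exact: derivableP.
by have := is_deriveD h (is_derive_cst (gamma / 2) t 1); rewrite addr0.
Qed.
Let dpsiE : derive1 psi = derive1 phi.
Proof. by apply/funext => t; rewrite derive1E; apply: derive_val. Qed.
Let dpsi' (t : R) : is_derive t 1 psi (derive1 psi t).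
Proof. by rewrite dpsiE. Qed.
Let cpsi : continuous psi.
Proof. by move=> t; have := dpsi t => -[h _]; apply/differentiable_continuous/derivable1_diffP. Qed.
Let cdpsi : continuous (derive1 psi).
Proof. by rewrite dpsiE; case: hphi => -[]. Qed.

(** The four parameters add up to [2 - 2 gamma], so the contour condition is
    [g' > (1 - 2 gamma) / 4]; adding [gamma / 2] gives [1/4]. *)
Let psi_tail : exists sg T : R, [/\ 4^-1 < sg, 0 <= T & forall t, T <= `|t| -> psi t = sg].
Proof.
case: hphi => _ [g' [T [hg hT]]] _ _; exists (g' + gamma / 2), (Num.max T 0); split.
- by move: hg; rewrite !cE /=; lra.
- by rewrite le_max lexx orbT.
- by move=> t; rewrite ge_max => /andP[h _]; rewrite /psi hT.
Qed.

Let psi_bound : exists B, forall t, `|psi t| <= B /\ `|derive1 psi t| <= B.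
Proof.
have [sg [T [s4 T0 hT]]] := psi_tail.
have c1' : continuous (fun t => `|psi t|) by move=> t; apply: cvg_norm; exact: cpsi.
have c2' : continuous (fun t => `|derive1 psi t|) by move=> t; apply: cvg_norm; exact: cdpsi.
(* Beyond [T + 1] the function is constant in a neighbourhood, so its derivative vanishes there. *)
have TT : - (T + 1) <= T + 1 by lra.
have [t1 _ h1] := EVT_max TT (continuous_subspaceT c1').
have [t2 _ h2] := EVT_max TT (continuous_subspaceT c2').
exists (Num.max (Num.max `|psi t1| `|sg|) `|derive1 psi t2|) => t; rewrite !le_max.
have [tT|tT] := leP `|t| (T + 1).
  by rewrite h1 ?h2 ?orbT //; rewrite in_itv /= -ler_norml.
have -> : psi t = sg by apply: hT; lra.
have -> : derive1 psi t = 0.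
  rewrite derive1E -[RHS](@derive_cst _ _ _ sg t 1); apply: near_eq_derive.
  have h : \forall u \near t, T < `|u|.
    have cn : `|u| @[u --> t] --> `|t| by exact: norm_continuous.
    have tT' : T < `|t| by lra.
    exact: cvgr_gt cn _ tT'.
  by apply: filterS h => u uT; apply: hT; exact: ltW.
by rewrite lexx normr0 normr_ge0 !orbT.
Qed.

Let dist : exists2 d, 0 < d & forall r t (j : nat), 0 <= r <= 1 ->
  let s := ((1 - r) * psi t) +i* t in d <= cabs (c1%:C - s + j%:R) /\ d <= cabs (c2%:C - s + j%:R).
Proof.
have [p1 p2] := psi_lt.
have [d1 d10 h1] := homotopy_dist cpsi c10 p1; have [d2 d20 h2] := homotopy_dist cpsi c20 p2.
exists (Num.min d1 d2); first by rewrite lt_min d10.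
by move=> r t j r01 s; rewrite !ge_min /s h1 // h2 // orbT.
Qed.

(** [Q n] is the regularised quotient and [m] its limit. [X L s] is [x^l] for [L = ln x] and
    [l = s - gamma / 2]. *)
Let Q n s := gratio n c1 s * gratio n c2 s * cexp (s * s * (n%:R^-1)%:C).
Let m s := gamma_ratio c1 s * gamma_ratio c2 s.
Let X (L : R) s : R[i] := cexp (L%:C * s + (- (L * (gamma / 2)))%:C).
Let path t : R[i] := psi t +i* t.
Let speed t : R[i] := derive1 psi t +i* 1.

Let pathE t : path t = ((1 - 0) * psi t) +i* t. Proof. by rewrite subr0 mul1r. Qed.

(** Completing the square: [t^2 / n - |t| + n / 4 = (|t| - n / 2)^2 / n]. *)
Let gaussian_le n (t : R) : (0 < n)%N -> expR (- (t ^+ 2 / n%:R)) <= expR (n%:R / 4) * expR (- 1 * `|t|).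
Proof.
move=> n0; have N0 : 0 < n%:R :> R by rewrite ltr0n.
rewrite -expRD ler_expR -[t ^+ 2]real_normK ?num_real //; move: (`|t|) => u; move: (n%:R : R) N0 => N N0.
rewrite -subr_ge0 (_ : _ - _ = (u - N / 2) ^+ 2 / N); last by field; rewrite gt_eqF.
by rewrite divr_ge0 ?sqr_ge0 // ltW.
Qed.

Let cabs_reg n (a t : R) : cabs (cexp ((a +i* t) * (a +i* t) * (n%:R^-1)%:C)) = expR (a ^+ 2 / n%:R) * expR (- (t ^+ 2 / n%:R)).
Proof. by rewrite cabs_cexp -expRD !cE /=; congr expR; ring. Qed.

Let cabs_X L (a t : R) : cabs (X L (a +i* t)) = expR (L * (a - gamma / 2)).
Proof. by rewrite cabs_cexp !cE /=; congr expR; ring. Qed.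

Lemma nice_integrand (U : set R[i]) d n L : 0 < d ->
  (forall s, U s -> forall j : nat, d <= cabs (c1%:C - s + j%:R) /\ d <= cabs (c2%:C - s + j%:R)) ->
  exists F', nice U (fun s => Q n s * X L s) F'.
Proof.
move=> d0 dU.
have [F1 h1] := nice_gratio n d0 (fun s Us j => (dU s Us j).1).
have [F2 h2] := nice_gratio n d0 (fun s Us j => (dU s Us j).2).
have h3 := nice_cexp (niceM (nice_affine U 1 0) (nice_affine U (n%:R^-1)%:C 0)).
have h4 := nice_cexp (nice_affine U L%:C (- (L * (gamma / 2)))%:C).
eexists; have := niceM (niceM (niceM h1 h2) h3) h4; congr nice; apply/funext => s.
by have -> : (1 * s + 0) * ((n%:R^-1)%:C * s + 0) = s * s * (n%:R^-1)%:C by ring.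
Qed.

(** At fixed [n] the quotients are bounded along the whole homotopy and the regulariser decays like
    [exp (- |t|)], so [contour_shift] applies with that [g]. *)
Lemma integrand_shift n L : (0 < n)%N ->
  cint mu setT (fun t => Q n (path t) * X L (path t) * speed t) =
  cint mu setT (fun t => Q n (0 +i* t) * X L (0 +i* t) * (0 +i* 1)).
Proof.
move=> n0; have [d d0 hd] := dist; have [B hB] := psi_bound.
have B0 : 0 <= B := le_trans (normr_ge0 _) (hB 0).1.
pose U : set R[i] := [set s | forall j : nat, d <= cabs (c1%:C - s + j%:R) /\ d <= cabs (c2%:C - s + j%:R)].
have [F' nE] := @nice_integrand U d n L d0 (fun s Us => Us).
have Up r t : 0 <= r <= 1 -> U (((1 - r) * psi t) +i* t) by move=> r01 j; exact: hd.
have ab r t : 0 <= r <= 1 -> `|(1 - r) * psi t| <= B.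
  move=> /andP[r0 r1]; rewrite normrM (le_trans _ (hB t).1) // ler_piMl // ger0_norm ?subr_ge0 // gerBl //.
pose K1 := \prod_(0 <= j < n.+1) (1 + 2 * (c1 + j%:R) / d) * expR (2 * `|ln n%:R| * B).
pose K2 := \prod_(0 <= j < n.+1) (1 + 2 * (c2 + j%:R) / d) * expR (2 * `|ln n%:R| * B).
have K0 c : 0 < c -> 0 <= \prod_(0 <= j < n.+1) (1 + 2 * (c + j%:R) / d) * expR (2 * `|ln n%:R| * B).
  move=> c0; rewrite mulr_ge0 ?expR_ge0 // prodr_ge0 // => j _.
  by rewrite addr_ge0 // divr_ge0 ?ltW // mulr_gt0 // ltr_pwDl.
pose K := K1 * K2 * (expR (B ^+ 2) * expR (n%:R / 4)) * expR (`|L| * (B + gamma / 2)).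
apply: (@contour_shift R U _ F' psi (fun t => expR (- 1 * `|t|)) K B nE dpsi' cdpsi) => //.
- by move=> t; case: (hB t).
- by move=> t; case: (hB t).
- move=> r t r01; have ra := ab r t r01.
  have h1 : cabs (gratio n c1 (((1 - r) * psi t) +i* t)) <= K1.
    by apply: cabs_gratio_le => //; [exact: ltW|move=> j; case: (Up r t r01 j)].
  have h2 : cabs (gratio n c2 (((1 - r) * psi t) +i* t)) <= K2.
    by apply: cabs_gratio_le => //; [exact: ltW|move=> j; case: (Up r t r01 j)].
  rewrite cabsM /Q cabsM [cabs (gratio _ _ _ * _)]cabsM cabs_reg cabs_X.
  have -> : K * expR (- 1 * `|t|) = K1 * K2 * (expR (B ^+ 2) * (expR (n%:R / 4) * expR (- 1 * `|t|))) * expR (`|L| * (B + gamma / 2)).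
    by rewrite /K; ring.
  have N1 : 1 <= n%:R :> R by rewrite ler1n.
  move: ((1 - r) * psi t) ra h1 h2 => a ra h1 h2.
  apply: ler_pM; rewrite ?expR_ge0 //.
  + by rewrite !mulr_ge0 ?cabs_ge0 ?expR_ge0.
  + apply: ler_pM; rewrite ?mulr_ge0 ?cabs_ge0 ?expR_ge0 //; first by apply: ler_pM; rewrite ?cabs_ge0.
    apply: ler_pM; rewrite ?expR_ge0 //; last exact: gaussian_le.
    rewrite ler_expR (le_trans (ler_piMr (sqr_ge0 _) _)) ?invf_le1 ?(lt_le_trans _ N1) //.
    by rewrite -[a ^+ 2]real_normK ?num_real // ler_pXn2r ?nnegrE.
  + rewrite ler_expR (le_trans (ler_norm _)) // normrM ler_wpM2l //.
    by rewrite (le_trans (ler_normB _ _)) // lerD // ger0_norm // divr_ge0 // ltW.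
- exact: integrable_expRN.
- by under eq_fun do rewrite normr_nat; exact: cvg_expRn.
- by under eq_fun do rewrite normrN normr_nat; exact: cvg_expRn.
Qed.

Let Upath t (j : nat) : c1%:C - path t + j%:R != 0 /\ c2%:C - path t + j%:R != 0.
Proof.
have [d d0 h] := dist; have [h1 h2] := h 0 t j (itv01_0 R); rewrite -pathE in h1 h2.
by split; apply/eqP => e; [move: h1|move: h2]; rewrite e cabs0 leNgt d0.
Qed.

Let ccont_path : ccont path.
Proof. by move=> t; split => /=; [exact: cpsi|exact: cvg_id]. Qed.
Let ccont_line : ccont (fun t : R => 0 +i* t).
Proof. by move=> t; split => /=; [exact: cvg_cst|exact: cvg_id]. Qed.
Let ccont_speed : ccont speed.
Proof. by move=> t; split => /=; [exact: cdpsi|exact: cvg_cst]. Qed.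

Lemma ccont_gratio n (c : R) (z : R -> R[i]) : ccont z -> (forall t (j : nat), c%:C - z t + j%:R != 0) ->
  ccont (fun t => gratio n c (z t)).
Proof.
move=> cz h t; apply: ccvgM.
  by apply: ccvg_rgauss; apply: ccvgD => //; exact: ccvg_cst.
apply: ccvgV; first exact: rgauss_neq0.
by apply: ccvg_rgauss; apply: ccvgB => //; exact: ccvg_cst.
Qed.

Let ccont_Q n (z : R -> R[i]) : ccont z -> (forall t (j : nat), c1%:C - z t + j%:R != 0 /\ c2%:C - z t + j%:R != 0) ->
  ccont (fun t => Q n (z t)).
Proof.
move=> cz h t; apply: ccvgM.
  by apply: ccvgM; apply: ccont_gratio => // u j; case: (h u j).
by apply: ccvg_cexp; apply: ccvgM; [exact: ccvgM|exact: ccvg_cst].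
Qed.
Let ccont_X L (z : R -> R[i]) : ccont z -> ccont (fun t => X L (z t)).
Proof.
move=> cz t; apply: ccvg_cexp; apply: ccvgD; last exact: ccvg_cst.
by apply: ccvgM => //; exact: ccvg_cst.
Qed.

Let cvg_Q s : (forall j : nat, c1%:C - s + j%:R != 0 /\ c2%:C - s + j%:R != 0) -> ccvg \oo (fun n => Q n.+1 s) (m s).
Proof.
move=> h; rewrite -[m s]mulr1.
have e : ccvg \oo (fun n => cexp (s * s * (n.+1%:R^-1)%:C)) 1.
  rewrite -(@cexp0 R) -[X in cexp X](mulr0 (s * s)).
  by apply: ccvg_cexp; apply: ccvgM; [exact: ccvg_cst|apply: (@ccvgC _ _ _ _ _ 0); exact: cvg_harmonic].
have key (c : R) : (forall j : nat, c%:C - s + j%:R != 0) -> ccvg \oo (fun n => gratio n.+1 c s) (gamma_ratio c s).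
  by move=> /cvg_gratio [u v]; split; [move: u|move: v]; rewrite -cvg_shiftS.
by apply: ccvgM => //; apply: ccvgM; apply: key => j; case: (h j).
Qed.

(** One majorant for all large [n] on the original contour: the tail bound on the vertical ends and
    the compact bound in between. *)
Let Q_dom : exists sg K N0, [/\ 4^-1 < sg, 0 <= K, (0 < N0)%N &
  forall n t, (N0 <= n)%N -> cabs (Q n (path t)) <= K * weight sg t].
Proof.
have [sg [T [s4 T0 hT]]] := psi_tail; have [B hB] := psi_bound.
have s0 : 0 < sg by rewrite (lt_trans _ s4) // invr_gt0.
have B0 : 0 <= B := le_trans (normr_ge0 _) (hB 0).1.
have [K K0 hK] := gratio_pair_tail s0 c1h c2h.
(* Beyond [T] the contour is vertical, and the tail estimate also requires [sg <= |t|]. *)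
pose T1 := Num.max T sg.
have T10 : 0 <= T1 by rewrite le_max T0.
have bd (c : R) : 0 < c -> forall t, `|t| <= T1 -> cabs (c%:C + path t) <= c + (B + T1) /\ cabs (c%:C - path t) <= c + (B + T1).
  move=> c0 t tT; have h : cabs (path t) <= B + T1.
    by rewrite (le_trans (le_cabs_ReIm _)) //= lerD //; case: (hB t).
  have e : cabs c%:C = c by rewrite cabsC ger0_norm // ltW.
  by rewrite (le_trans (cabsD _ _)) ?(le_trans (cabsB _ _)) // e lerD2l.
have [K1 [N1 N10 h1]] := gratio_compact ccont_path T10 (fun t j => (Upath t j).1) (bd c1 c10).
have [K2 [N2 N20 h2]] := gratio_compact ccont_path T10 (fun t j => (Upath t j).2) (bd c2 c20).
exists sg, (K + `|K1| * `|K2| * expR (B ^+ 2) * expR T1), (maxn N1 N2); split => //.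
- by rewrite addr_ge0 // !mulr_ge0 ?expR_ge0.
- by rewrite leq_max N10.
move=> n t; rewrite geq_max => /andP[n1 n2].
have n0 : (0 < n)%N by exact: leq_trans n1.
have w0 := weight_ge0 sg t.
have [tT|tT] := leP `|t| T1; last first.
  move: tT; rewrite gt_max => /andP[tT ts].
  have -> : path t = sg +i* t by rewrite /path hT // ltW.
  apply: le_trans (hK n t n0 (ltW ts)) _; rewrite ler_wpM2r // lerDl !mulr_ge0 ?expR_ge0 //.
have N1' : 1 <= n%:R :> R by rewrite ler1n.
have q1 := h1 n t n1 tT; have q2 := h2 n t n2 tT.
have q3 : cabs (Q n (path t)) <= `|K1| * `|K2| * expR (B ^+ 2).
  rewrite /Q cabsM [cabs (gratio _ _ _ * _)]cabsM; apply: ler_pM; rewrite ?mulr_ge0 ?cabs_ge0 //.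
    by apply: ler_pM; rewrite ?cabs_ge0 // ?(le_trans q1) ?(le_trans q2) ?ler_norm.
  rewrite /path cabs_reg -expRD ler_expR -[X in _ <= X]addr0 lerD //; last first.
    by rewrite oppr_le0 divr_ge0 ?sqr_ge0.
  rewrite (le_trans (ler_piMr (sqr_ge0 _) _)) ?invf_le1 ?(lt_le_trans _ N1') //.
  by rewrite -[psi t ^+ 2]real_normK ?num_real // ler_pXn2r ?nnegrE //; case: (hB t).
apply: le_trans q3 _.
(* On [|t| <= T1] the weight is bounded below, so a constant bound can be rewritten as a multiple of
   it. *)
have w1 : 1 <= expR T1 * weight sg t.
  have : 1 <= expR T1 * expR (- 1 * `|t|).
    by rewrite -expRD -[X in X <= _]expR0 ler_expR mulN1r subr_ge0.
  move=> /le_trans; apply; rewrite ler_wpM2l ?expR_ge0 // lerDr expR_ge0 //.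
have KK : 0 <= `|K1| * `|K2| * expR (B ^+ 2) by rewrite !mulr_ge0 ?expR_ge0.
move: (`|K1| * `|K2| * expR (B ^+ 2)) KK => P KK.
apply: (@le_trans _ _ (P * (expR T1 * weight sg t))); first by rewrite ler_peMr.
by rewrite mulrDl -mulrA lerDr mulr_ge0.
Qed.

(** The regularised integral along the original contour; [H0] is the Mellin-Barnes integral itself,
    up to the factor [1 / (2 pi i)]. *)
Let A n L := cint mu setT (fun t => Q n (path t) * X L (path t) * speed t).
Let H0 L := cint mu setT (fun t => m (path t) * X L (path t) * speed t).

(** The bound is explicit in [L], because [L] is later an affine function of [ln y] and must stay
    bounded on the support of the test function. *)
Let A_lim : exists K N0, [/\ 0 <= K, (0 < N0)%N,
  forall L, ccvg \oo (fun n => A (n + N0) L) (H0 L) &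
  forall n L, cabs (A (n + N0) L) <= expR (`|L| * K) * K].
Proof.
have [sg [K [N0 [s4 K0 N00 hQ]]]] := Q_dom; have [B hB] := psi_bound.
have B0 : 0 <= B := le_trans (normr_ge0 _) (hB 0).1.
have iw := integrable_weight s4.
pose W := \int[mu]_t weight sg t.
have W0 : 0 <= W by apply: Rintegral_ge0 => t _; exact: weight_ge0.
(* One constant for two purposes: the rate of growth in [|L|] and the total mass of the majorant. *)
pose K' := B + gamma / 2 + 2 * (K * (B + 1) * W).
have KW : 0 <= 2 * (K * (B + 1) * W) by rewrite !mulr_ge0 // addr_ge0.
have Bg : 0 <= B + gamma / 2 by rewrite addr_ge0 // divr_ge0 // ltW.
have dom n L t : (N0 <= n)%N ->
    cabs (Q n (path t) * X L (path t) * speed t) <= expR (`|L| * K') * (K * (B + 1)) * weight sg t.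
  move=> nN; have -> : expR (`|L| * K') * (K * (B + 1)) * weight sg t = K * weight sg t * expR (`|L| * K') * (B + 1) by ring.
  rewrite cabsM [cabs (Q _ _ * _)]cabsM; apply: ler_pM; rewrite ?mulr_ge0 ?cabs_ge0 //.
    apply: ler_pM; rewrite ?cabs_ge0 ?hQ // cabs_X ler_expR (le_trans (ler_norm _)) // normrM ler_wpM2l //.
    have g2 : 0 <= gamma / 2 by rewrite divr_ge0 // ltW.
    rewrite (le_trans (ler_normB _ _)) // (ger0_norm g2).
    by rewrite /K' -[X in X <= _]addr0 lerD // lerD2r; case: (hB t).
  rewrite (le_trans (le_cabs_ReIm _)) //= normr1 lerD2r; by case: (hB t).
have igw (L : R) : mu.-integrable setT (EFin \o (fun t => expR (`|L| * K') * (K * (B + 1)) * weight sg t)).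
  by rewrite /comp; under eq_fun do rewrite EFinM; exact: integrableZl.
have mE n L : cmeas [set: lineT] (fun t => Q n (path t) * X L (path t) * speed t).
  apply: ccont_cmeasT => t; apply: ccvgM; last exact: ccont_speed.
  by apply: ccvgM; [exact: (ccont_Q n ccont_path Upath)|exact: (ccont_X L ccont_path)].
exists K', N0; split => //; first by rewrite addr_ge0.
- move=> L; have [||_ h] := @cint_dctT R (fun n t => Q (n + N0)%N (path t) * X L (path t) * speed t)
    (fun t => m (path t) * X L (path t) * speed t) _ _ _ (igw L) (fun n t => dom _ L t (leq_addl n N0)); last exact: h.
  + by move=> n; exact: mE.
  + move=> t; apply: ccvgM; last exact: ccvg_cst.
    apply: ccvgM; last exact: ccvg_cst.
    have [q1 q2] := cvg_Q (Upath t).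
    case: N0 N00 {hQ dom} => // N0 _; split.
      by rewrite -(cvg_shiftn N0) in q1; move: q1; under eq_fun do rewrite -addnS.
    by rewrite -(cvg_shiftn N0) in q2; move: q2; under eq_fun do rewrite -addnS.
- move=> n L; apply: le_trans (cint_leT (mE _ _) (igw L) (fun t => dom _ _ _ (leq_addl _ _))) _.
  rewrite RintegralZl //.
  have -> : 2 * (expR (`|L| * K') * (K * (B + 1)) * W) = expR (`|L| * K') * (2 * (K * (B + 1) * W)) by ring.
  by rewrite ler_wpM2l ?expR_ge0 // lerDr.
Qed.

Let mline t := m (0 +i* t).
Let ccont_mline : ccont mline.
Proof.
by move=> t; apply: ccvgM; apply: ccont_gamma_ratio => // u j; exact: line_neq0.
Qed.
Let mline1 t : cabs (mline t) = 1.
Proof. by rewrite cabsM !cabs_gamma_ratio_line ?mulr1. Qed.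
Let cabs_Qline n t : cabs (Q n (0 +i* t)) = expR (- (t ^+ 2 / n%:R)).
Proof. by rewrite /Q cabsM [cabs (gratio _ _ _ * _)]cabsM !cabs_gratio_line // !mul1r cabs_reg expr0n /= mul0r expR0 mul1r. Qed.

(** The shift [s = l + gamma / 2] carried out, with [1 / rgamma] for [cGamma]; the division by Gamma
    becomes a multiplication by [rgamma]. *)
Lemma meijerGE (x : R) : 0 < x ->
  meijerG2004 phi b1%:C b2%:C (1 - gamma - b1)%:C (1 - gamma - b2)%:C x = (0 +i* (2 * pi))^-1 * H0 (ln x).
Proof.
move=> x0.
suff e : cint mu setT (fun t => meijer_integrand b1%:C b2%:C (1 - gamma - b1)%:C (1 - gamma - b2)%:C x (phi t +i* t) *
    (derive1 phi t +i* 1)) = H0 (ln x) by rewrite /meijerG2004 -e; reflexivity.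
apply: eq_cintT => t; rewrite /speed dpsiE; apply: (f_equal (fun z => z * (derive1 phi t +i* 1))).
rewrite /meijer_integrand !cGammaE.
have -> : b1%:C - (phi t +i* t) = c1%:C - path t by apply: ceqP; rewrite /c1 /path /psi !cE /=; ring.
have -> : b2%:C - (phi t +i* t) = c2%:C - path t by apply: ceqP; rewrite /c2 /path /psi !cE /=; ring.
have -> : 1 - (1 - gamma - b1)%:C + (phi t +i* t) = c1%:C + path t by apply: ceqP; rewrite /c1 /path /psi !cE /=; field.
have -> : 1 - (1 - gamma - b2)%:C + (phi t +i* t) = c2%:C + path t by apply: ceqP; rewrite /c2 /path /psi !cE /=; field.
have -> : cpow x (phi t +i* t) = X (ln x) (path t).
  by rewrite /cpow /X; congr cexp; apply: ceqP; rewrite /path /psi !cE /=; ring.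
rewrite /m /gamma_ratio invfM !invrK; ring.
Qed.

(** * The transform of one test function at one point *)

Section Transform.
Variables (f : R -> R[i]) (x : R).
Hypotheses (tf : test_function f) (x0 : 0 < x).
Let L y := k * (ln x + ln y).

Let mL : measurable_fun [set: lineT] L.
Proof.
apply: measurable_funM; first exact: measurable_cst.
by apply: measurable_funD; [exact: measurable_cst|exact: measurable_ln].
Qed.
Let mf : cmeas [set: lineT] f. Proof. exact: test_cmeas. Qed.

Let f_supp : exists N M, [/\ 0 <= N, 0 <= M, forall y, f y != 0 -> `|ln y| <= N &
  forall y, cabs (f y) <= M * \1_(`[expR (- N), expR N]%classic) y].
Proof.
have [N [M [N0 M0 f0 fM]]] := test_bound_exp tf; exists N, M; split=> // y.
  move=> fy; have : y \in `[expR (- N), expR N] by apply: contraNT fy => /f0 ->.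
  rewrite in_itv /= => /andP[ya yb]; have y0 : 0 < y by rewrite (lt_le_trans _ ya) ?expR_gt0.
  by rewrite ler_norml -[- N]expRK -[X in _ && (_ <= X)]expRK !ler_ln ?posrE ?expR_gt0 // ya.
rewrite indicE; have [yn|/f0 ->] := boolP (y \in `[expR (- N), expR N]).
  by rewrite mem_set // mulr1.
by rewrite cabs0 mulr_ge0.
Qed.
Let f_Rplus y : f y * (\1_D y : R)%:C = f y.
Proof.
rewrite indicE; have [Dy|Dy] := pselect (D y); first by rewrite mem_set // mulr1.
rewrite memNset // mulr0; have [a [c [a0 _ h]]] := test_support tf; rewrite h //.
rewrite in_itv /= negb_and -!ltNge; apply/orP; left; apply: le_lt_trans a0.
by rewrite leNgt; apply/negP.
Qed.

Let cint_Rplus (G : R -> R[i]) : cint mu D (fun y => G y * f y) = cint mu setT (fun y => G y * f y).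
Proof. by rewrite cint_mkcond; apply: eq_cintT => y; rewrite -mulrA f_Rplus. Qed.

Let line_mellin b : cintegrable mu setT (fun y => cexp ((ln y)%:C * b) * f y) /\
  cint mu setT (fun y => cexp ((ln y)%:C * b) * f y) = mellin f (b + 1).
Proof.
have [N [M [N0 M0 fN fM]]] := f_supp; split.
  apply: (@cintegrable_leT _ _ (fun y => expR (N * cabs b) * M * (\1_(`[expR (- N), expR N]%classic) y : R))).
  - apply: cmeasM => //; apply: cmeas_cexp; apply: cmeasM; last exact: cmeas_cst.
    by apply: cmeasC; exact: measurable_ln.
  - exact: integrable_cst_indic.
  move=> y; have [fy|fy] := eqVneq (f y) 0; first by rewrite fy mulr0 cabs0 !mulr_ge0 ?expR_ge0.
  rewrite cabsM -mulrA ler_pM ?cabs_ge0 // cabs_cexp ler_expR !cE /= mul0r subr0.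
  by rewrite (le_trans (ler_norm _)) // normrM ler_pM // ?le_Re_cabs // fN.
rewrite -cint_Rplus -cint_mellin //; apply: eq_cint => y _; exact: mulrC.
Qed.

(** What remains after the integration over [y]: the [i] of [ds = i dt], the power of [x], and the
    Mellin transform of [f]. As [k * gamma / 2 = 1/2], the power of [y] is [y^(-1/2 + i k t)], so
    the Mellin variable lies on [Re = 1/2]. *)
Let V t : R[i] := (0 +i* 1) * cexp ((k * ln x)%:C * ((0 +i* t) - (gamma / 2)%:C)) * mhat k f t.

Let X_L y t : X (L y) (0 +i* t) =
  cexp ((k * ln x)%:C * ((0 +i* t) - (gamma / 2)%:C)) * cexp ((ln y)%:C * (k%:C * ((0 +i* t) - (gamma / 2)%:C))).
Proof. by rewrite -cexpD /X /L; congr cexp; apply: ceqP; rewrite !cE /=; ring. Qed.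

(** At fixed [n] the contour is moved first; on the line the Gaussian factor makes the double
    integral absolutely convergent, and Fubini exchanges [y] and [t]. *)
Let A_pair n : (0 < n)%N -> cintegrable mu setT (fun y => A n (L y) * f y) /\
  cint mu setT (fun y => A n (L y) * f y) = cint mu setT (fun t => Q n (0 +i* t) * V t).
Proof.
move=> n0; have [N [M [N0 M0 fN fM]]] := f_supp.
pose Lm := k * (`|ln x| + N).
have Lm0 : 0 <= Lm by rewrite mulr_ge0 ?addr_ge0 // ltW.
have Lle y : f y != 0 -> `|L y| <= Lm.
  move=> /fN yN; rewrite /L /Lm normrM (gtr0_norm k0) ler_wpM2l ?(ltW k0) //.
  by rewrite (le_trans (ler_normD _ _)) // lerD2l.
have g2 : 0 <= gamma / 2 by rewrite divr_ge0 // ltW.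
pose F z := Q n (0 +i* z.2) * X (L z.1) (0 +i* z.2) * (0 +i* 1) * f z.1.
have ci : cabs (0 +i* 1 : R[i]) = 1 by rewrite /cabs /= expr0n expr1n add0r sqrtr1.
have Xle l t : cabs (X l (0 +i* t)) <= expR (`|l| * (gamma / 2)).
  by rewrite cabs_X ler_expR sub0r mulrN -mulNr ler_wpM2r // -normrN ler_norm.
pose h1 y := expR (Lm * (gamma / 2)) * M * (\1_(`[expR (- N), expR N]%classic) y : R).
pose h2 (t : R) := expR (n%:R / 4) * expR (- 1 * `|t|).
have ih1 : mu.-integrable setT (EFin \o h1) by exact: integrable_cst_indic.
have ih2 : mu.-integrable setT (EFin \o h2).
  by rewrite /h2 /comp; under eq_fun do rewrite EFinM; apply: integrableZl => //; exact: integrable_expRN.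
have Fle y t : cabs (F (y, t)) <= h1 y * h2 t.
  rewrite /F /=; have [fy|fy] := eqVneq (f y) 0.
    by rewrite fy mulr0 cabs0 !mulr_ge0 ?expR_ge0.
  have -> : h1 y * h2 t = h2 t * expR (Lm * (gamma / 2)) * 1 * (M * (\1_(`[expR (- N), expR N]%classic) y : R)).
    by rewrite /h1; ring.
  rewrite cabsM [cabs (_ * (0 +i* 1))]cabsM ci [cabs (Q _ _ * _)]cabsM cabs_Qline.
  have hh : 0 <= h2 t by rewrite mulr_ge0 ?expR_ge0.
  apply: ler_pM; rewrite ?mulr_ge0 ?cabs_ge0 ?expR_ge0 //.
  rewrite !mulr1; apply: ler_pM; rewrite ?expR_ge0 ?cabs_ge0 //; first exact: gaussian_le.
  by rewrite (le_trans (Xle _ _)) // ler_expR ler_wpM2r // Lle.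
have lineN t j : c1%:C - (0 +i* t) + j%:R != 0 /\ c2%:C - (0 +i* t) + j%:R != 0.
  by split; exact: line_neq0.
have cQ : ccont (fun t => Q n (0 +i* t)) by exact: (ccont_Q n ccont_line).
have m1 : measurable_fun [set: lineT * lineT] fst by exact: measurable_fst.
have m2 : measurable_fun [set: lineT * lineT] snd by exact: measurable_snd.
have mc (h : R -> R[i]) (r : R * R -> R) : cmeas [set: lineT] h -> measurable_fun [set: lineT * lineT] r -> cmeas [set: lineT * lineT] (fun z => h (r z)).
  by move=> [u v] mr; split; [exact: (measurableT_comp u)|exact: (measurableT_comp v)].
have mL1 : measurable_fun [set: lineT * lineT] (fun z => L z.1) by exact: (measurableT_comp mL m1).
have mF : cmeas [set: lineT * lineT] F.
  apply: cmeasM; last exact: mc.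
  apply: cmeasM; last exact: cmeas_cst.
  apply: cmeasM; first exact: (mc (fun t => Q n (0 +i* t)) snd (ccont_cmeasT cQ) m2).
  apply: cmeas_cexp; apply: cmeasD.
    apply: cmeasM; first exact: cmeasC.
    by split => /=; [exact: measurable_cst|exact: m2].
  apply: cmeasC; apply: measurable_funN; apply: measurable_funM => //; exact: measurable_cst.
have key := @cint_fubini _ _ _ lineT lineT mu mu h1 h2 ih1 ih2 F mF Fle.
have ic := @cintegrable_cint _ _ _ lineT lineT mu mu h1 h2 ih1 ih2 F mF Fle.
have AF y : cint mu setT (fun t => F (y, t)) = A n (L y) * f y.
  have eA : A n (L y) = cint mu setT (fun t => Q n (0 +i* t) * X (L y) (0 +i* t) * (0 +i* 1)) := integrand_shift (L y) n0.
  rewrite eA.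
  have iG : cintegrable mu setT (fun t => Q n (0 +i* t) * X (L y) (0 +i* t) * (0 +i* 1)).
    apply: (@cintegrable_leT _ _ (fun t => expR (`|L y| * (gamma / 2)) * h2 t)).
    - apply: ccont_cmeasT => t; apply: ccvgM; last exact: ccvg_cst.
      by apply: ccvgM; [exact: cQ|exact: (ccont_X _ ccont_line)].
    - by rewrite /comp; under eq_fun do rewrite EFinM; exact: integrableZl.
    move=> t; rewrite cabsM ci mulr1 [cabs (Q _ _ * _)]cabsM mulrC.
    apply: ler_pM; [exact: cabs_ge0|exact: cabs_ge0|exact: Xle|].
    by rewrite cabs_Qline; exact: gaussian_le.
  by rewrite -(@cintZr _ _ lineT mu setT _ _ measurableT iG).
split.
  have e : (fun y => cint mu setT (fun t => F (y, t))) = (fun y => A n (L y) * f y) by apply/funext => y; exact: AF.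
  by move: ic; rewrite e.
rewrite -(eq_cintT AF) key; apply: eq_cintT => t.
have [iY cY] := line_mellin (k%:C * ((0 +i* t) - (gamma / 2)%:C)).
rewrite /V; have -> : mhat k f t = mellin f (k%:C * ((0 +i* t) - (gamma / 2)%:C) + 1).
  rewrite /mhat; apply: (f_equal (mellin f)); apply: ceqP; rewrite !cE /=; last by ring.
  by rewrite /k; field; rewrite gt_eqF.
rewrite -cY mulrA mulrA.
rewrite -(@cintZ _ _ lineT mu setT _ (Q n (0 +i* t) * (0 +i* 1) * cexp ((k * ln x)%:C * ((0 +i* t) - (gamma / 2)%:C))) measurableT iY).
by apply: eq_cintT => y; rewrite /F /= X_L; ring.
Qed.

(** On the line [Q n] has modulus at most [1], so the decay of the Mellin transform in [V] is the
    majorant. *)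
Let mellin_side : ccvg \oo (fun n => cint mu setT (fun t => Q n.+1 (0 +i* t) * V t))
  (cint mu setT (fun t => mline t * V t)).
Proof.
have [C C0 hC] := mhat_decay mline1 k0 tf.
have lineN t j : c1%:C - (0 +i* t) + j%:R != 0 /\ c2%:C - (0 +i* t) + j%:R != 0.
  by split; exact: line_neq0.
have cV : ccont V.
  move=> t; apply: ccvgM; last exact: ccont_mhat.
  apply: ccvgM; first exact: ccvg_cst.
  apply: ccvg_cexp; apply: ccvgM; first exact: ccvg_cst.
  by apply: ccvgB; [exact: ccont_line|exact: ccvg_cst].
pose K := expR (k * ln x * (- (gamma / 2))).
have VC t : cabs (V t) <= K * C * (1 + t ^+ 2)^-1.
  rewrite /V !cabsM cabs_cexp; have := hC t; rewrite cabsM mline1 mul1r => h.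
  have -> : cabs (0 +i* 1 : R[i]) = 1 by rewrite /cabs /= expr0n expr1n add0r sqrtr1.
  rewrite mul1r -mulrA ler_pM ?cabs_ge0 ?expR_ge0 //.
  by rewrite !cE /= mul0r subr0 sub0r.
have [||||_ h] := @cint_dctT R (fun n t => Q n.+1 (0 +i* t) * V t) (fun t => mline t * V t)
  (fun t => K * C * (1 + t ^+ 2)^-1).
- by move=> n; apply: ccont_cmeasT => t; apply: ccvgM; [exact: (ccont_Q _ ccont_line)|exact: cV].
- by move=> t; apply: ccvgM; [exact: cvg_Q|exact: ccvg_cst].
- by rewrite /comp; under eq_fun do rewrite EFinM; apply: integrableZl => //; exact: integrable_oneDsqrV.
- move=> n t; rewrite cabsM cabs_Qline (le_trans _ (VC t)) // ler_piMl ?cabs_ge0 //.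
  by rewrite -[X in _ <= X]expR0 ler_expR oppr_le0 divr_ge0 ?sqr_ge0.
exact: h.
Qed.

(** The limit of the same sequence as in [mellin_side], now computed along the original contour,
    where [A_lim] and the compact support of [f] give domination. *)
Let contour_side : cintegrable mu setT (fun y => H0 (L y) * f y) /\
  cint mu setT (fun y => H0 (L y) * f y) = cint mu setT (fun t => mline t * V t).
Proof.
have [N [M [N0 M0 fN fM]]] := f_supp; have [K [n0 [K0 n00 Al Ab]]] := A_lim.
pose Lm := k * (`|ln x| + N).
have Lle y : f y != 0 -> `|L y| <= Lm.
  move=> /fN yN; rewrite /L /Lm normrM (gtr0_norm k0) ler_wpM2l ?(ltW k0) //.
  by rewrite (le_trans (ler_normD _ _)) // lerD2l.
have [||||iH h] := @cint_dctT R (fun n y => A (n + n0)%N (L y) * f y) (fun y => H0 (L y) * f y)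
  (fun y => expR (Lm * K) * K * M * (\1_(`[expR (- N), expR N]%classic) y : R)).
- move=> n; have nn : (0 < n + n0)%N by rewrite addn_gt0 n00 orbT.
  exact: cintegrable_cmeas (A_pair nn).1.
- by move=> y; apply: ccvgM; [exact: Al|exact: ccvg_cst].
- exact: integrable_cst_indic.
- move=> n y; have [fy|fy] := eqVneq (f y) 0; first by rewrite fy mulr0 cabs0 !mulr_ge0 ?expR_ge0.
  rewrite cabsM -[X in _ <= X]mulrA ler_pM ?cabs_ge0 // (le_trans (Ab _ _)) // ler_wpM2r // ler_expR.
  by rewrite ler_wpM2r // Lle.
split=> //; rewrite -(ccvg_lim h).
(* Writing [n0] as a successor aligns the index [n + n0] with the [n.+1] of [mellin_side]. *)
case: n0 n00 {Al Ab h} => // n1 _.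
have e : (fun n => cint mu setT (fun y => A (n + n1.+1)%N (L y) * f y)) =
    (fun n => cint mu setT (fun t => Q (n + n1).+1 (0 +i* t) * V t)).
  by apply/funext => n; have [|_ <-] := @A_pair (n + n1).+1; [by []|rewrite addnS].
rewrite e; apply: ccvg_lim; have [u v] := mellin_side.
by split; [move: u|move: v]; rewrite -(cvg_shiftn n1); apply.
Qed.

Lemma S_transformE : S_transform phi b1 b2 gamma f x = mellin_op mline k f x.
Proof.
have [iH eH] := contour_side.
have e1 : cint mu D (fun y => meijerG2004 phi b1%:C b2%:C (1 - gamma - b1)%:C (1 - gamma - b2)%:C ((x * y) `^ gamma^-1) * f y) =
    (0 +i* (2 * pi))^-1 * cint mu setT (fun t => mline t * V t).
  rewrite -eH -(@cintZ _ _ lineT mu setT _ _ measurableT iH).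
  transitivity (cint mu D (fun y => (0 +i* (2 * pi))^-1 * H0 (L y) * f y)).
    apply: eq_cint => y y0; have xy : 0 < x * y by exact: mulr_gt0.
    have -> : L y = ln ((x * y) `^ gamma^-1) by rewrite ln_powR lnM.
    apply: (f_equal (fun z => z * f y)); apply: meijerGE; exact: powR_gt0.
  rewrite cint_Rplus; apply: eq_cintT => y; rewrite mulrA; reflexivity.
have e2 : cint mu setT (fun t => mline t * V t) =
    (0 +i* 1) * (expR (- (ln x / 2)))%:C * fourier (mmul mline k f) k (ln x).
  have im := cintegrable_mmul ccont_mline mline1 k0 tf.
  have iF : cintegrable mu setT (fun t => mmul mline k f t * expi (k * t * ln x)).
    apply: (cintegrable_leT _ (cintegrable_cabs measurableT im)).
      apply: cmeasM; first exact: cintegrable_cmeas im.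
      apply: cmeas_expi; apply: measurable_funM; last exact: measurable_cst.
      by apply: measurable_funM; [exact: measurable_cst|exact: measurable_id].
    by move=> t; rewrite cabsM cabs_expi mulr1.
  rewrite -(@cintZ _ _ lineT mu setT _ _ measurableT iF); apply: eq_cintT => t.
  have e : cexp ((k * ln x)%:C * ((0 +i* t) - (gamma / 2)%:C)) = expi (k * t * ln x) * (expR (- (ln x / 2)))%:C.
    rewrite -cexpC /expi -cexpD; congr cexp; apply: ceqP; rewrite !cE /=; last by ring.
    by rewrite /k; field; rewrite gt_eqF.
  by rewrite /V e /mmul; ring.
have i0 : (0 +i* 1 : R[i]) != 0 by apply/eqP => /(f_equal Im) /= /eqP; rewrite oner_eq0.
have p0 : (2 * pi)%:C != 0 :> R[i].
  by apply/eqP => /(f_equal Re) /= /eqP; rewrite gt_eqF // mulr_gt0 // pi_gt0.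
(* The constants: [(1 / gamma) * 1 / (2 pi i) * i = k / (2 pi)]. *)
have e3 : (gamma^-1)%:C * (0 +i* (2 * pi))^-1 * (0 +i* 1) = (k / (2 * pi))%:C :> R[i].
  have -> : 0 +i* (2 * pi) = (2 * pi)%:C * (0 +i* 1) :> R[i] by apply: ceqP; rewrite !cE /=; ring.
  have -> : (k / (2 * pi))%:C = (gamma^-1)%:C * ((2 * pi)^-1)%:C :> R[i] by exact: CM.
  have -> : ((2 * pi)^-1)%:C = ((2 * pi)%:C)^-1 :> R[i].
    by apply: (mulfI p0); rewrite mulfV // -CM mulfV // gt_eqF // mulr_gt0 // pi_gt0.
  by rewrite invfM -!mulrA mulVf // mulr1.
rewrite /S_transform (e1 : cintegral D _ = _) e2 /mellin_op CM -e3 -/k.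
by move: (fourier _ _ _) ((0 +i* (2 * pi))^-1) => a b; ring.
Qed.

End Transform.

Lemma S_transform_unitary : exists S,
  L2_extension (S_transform phi b1 b2 gamma) S /\ L2_unitary S.
Proof.
have [S [[oS cS eS] uS]] := mellin_op_unitary ccont_mline mline1 k0.
exists S; split=> //; split=> // f tf; have [N [mN N0 NS]] := eS f tf.
by exists N; split=> // x /= h; apply: NS => /= h'; apply: h => Dx; rewrite h' // S_transformE.
Qed.

End Assembly.

Theorem corollary1p9p2 (R : realType) (b1 b2 gamma : R)
  (hb1 : half_integer b1) (hb2 : half_integer b2) (hgamma : half_integer gamma)
  (b1_ge0 : 0 <= b1) (gamma_ge1 : 1 <= gamma)
  (b2_ge : (1 - gamma) / 2 <= b2) (b2_le : b2 <= 1 / 2 + b1)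
  (phi : R -> R)
  (hphi : meijer_contour b1%:C b2%:C (1 - gamma - b1)%:C (1 - gamma - b2)%:C phi) :
  exists S : (R -> R[i]) -> (R -> R[i]),
    L2_extension (S_transform phi b1 b2 gamma) S /\ L2_unitary S.
Proof. exact: S_transform_unitary. Qed.
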